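(* Let $V$ be a commutative valuation ring of arbitrary Krull dimension with field of quotients $F$, let $K/F$ be a finite Galois extension with group $G$ such that $V$ is unramified and defectless in $K$, let $S$ be the integral closure of $V$ in $K$, let $f:G\times G\to K\setminus\{0\}$ be a normalized two-cocycle with $f(G\times G)\subseteq S\setminus\{0\}$, and let $A_f=\sum_{\sigma\in G}Sx_\sigma$ be the associated crossed-product $V$-order. Let $H=\{\sigma\in G\mid f(\sigma,\sigma^{-1})\in U(S)\}$. (1) The following are equivalent: (i) $A_f$ is semihereditary; (ii) for all $\tau,\gamma\in G$ and every maximal ideal $M$ of $S$, $f(\tau,\gamma)\notin M^2$; (iii) for each $\tau\in G$ and each maximal ideal $M$ of $S$, $f(\tau,\tau^{-1})\notin M^2$. (2) If $J(V)$ is a non-principal ideal of $V$, then the following are equivalent: (i) $A_f$ is semihereditary; (ii) $A_f$ is an Azumaya algebra over $V$; (iii) $H=G$.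
   Context: For a ring $R$, $J(R)$ is its Jacobson radical and $U(R)$ its group of units. A ring is semihereditary if its finitely generated one-sided ideals are projective modules. A two-cocycle $f$ satisfies $f(\sigma,\tau)f(\sigma\tau,\gamma)=\sigma(f(\tau,\gamma))f(\sigma,\tau\gamma)$; it is normalized if $f(1,\sigma)=f(\sigma,1)=1$ for all $\sigma\in G$. Its values are not required to lie in $U(S)$. $\Sigma_f=(K/F,G,f)=\sum_{\sigma\in G}Kx_\sigma$ is the crossed-product central simple $F$-algebra, the left $K$-vector space with basis $\{x_\sigma\}_{\sigma\in G}$ and multiplication $x_\sigma s=\sigma(s)x_\sigma$ ($s\in K$), $x_\sigma x_\tau=f(\sigma,\tau)x_{\sigma\tau}$; $A_f=\sum_{\sigma\in G}Sx_\sigma$ is a subring of it with identity $x_1=1$ and center $V$. ''$V$ is unramified and defectless in $K$'' means (equivalently, since $K/F$ is finite Galois) that for a valuation ring $V_1$ of $K$ lying over $V$ the inertial group $\{\sigma\in G\mid \sigma(x)-x\in J(V_1)\ \forall x\in V_1\}$ is trivial (these groups are conjugate for different $V_1$). Then $S$ is a finitely generated $V$-module. The set $H$ is a subgroup of $G$. *)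

(* Defs.v *)
From HB Require Import structures.
From mathcomp Require Import all_boot all_order all_algebra all_fingroup.
From mathcomp Require Import all_solvable all_field.
From mathcomp Require Import boolp.

Set Implicit Arguments.
Unset Strict Implicit.
Unset Printing Implicit Defensive.

Import GRing.Theory.
Local Open Scope ring_scope.

Section Modules.
Variable R : pzRingType.

Definition finitely_generated (P : lmodType R) : Prop :=
  exists s : seq P, forall x : P, exists c : 'I_(size s) -> R,
    x = \sum_(i < size s) c i *: s`_i.

Definition projective (P : lmodType R) : Prop :=
  forall (M N : lmodType R) (g : {linear M -> N}) (h : {linear P -> N}),
    (forall y, exists x, g x = y) ->
    exists l : {linear P -> M}, forall x, g (l x) = h x.

Definition faithful (P : lmodType R) : Prop :=
  forall r : R, (forall x : P, r *: x = 0) -> r = 0.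

Definition submod (M : lmodType R) (I : submodClosed M) : Type :=
  {x : M | x \in I}.

HB.instance Definition _ (M : lmodType R) (I : submodClosed M) :=
  SubChoice.on (submod I).
HB.instance Definition _ (M : lmodType R) (I : submodClosed M) :=
  [SubChoice_isSubLmodule of submod I by <:].

End Modules.

(* Left ideals of R are the submodules of the left module R^o; right ideals   *)
(* of R are the left ideals of the opposite ring R^c.                         *)
Definition left_semihereditary (R : nzRingType) : Prop :=
  forall I : submodClosed R^o,
    finitely_generated (submod I) -> projective (submod I).

Definition semihereditary (R : nzRingType) : Prop :=
  left_semihereditary R /\ left_semihereditary R^c.

Definition maximal_left_ideal (R : nzRingType) (M : submodClosed R^o) : Prop :=
  1 \notin M /\
  forall I : submodClosed R^o, {subset M <= I} -> 1 \notin I ->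
    {subset I <= M}.

Definition in_jacobson (R : nzRingType) (x : R) : Prop :=
  forall M : submodClosed R^o, maximal_left_ideal M -> x \in M.

Definition in_ideal_square (R : comNzRingType) (M : submodClosed R^o) (x : R) :
    Prop :=
  exists s : seq (R * R),
    {in s, forall p, p.1 \in M /\ p.2 \in M} /\ x = \sum_(p <- s) p.1 * p.2.

Definition jacobson_principal (R : comNzRingType) : Prop :=
  exists a : R, forall x : R, in_jacobson x <-> exists r, x = r * a.

(* A list of pairs (m, n) stands for the sum of the m (x) n; tensor_eq is     *)
(* equality of the sums in the tensor product M (x)_R N.                      *)
Inductive tensor_eq (R : comNzRingType) (M N : lmodType R) :
    seq (M * N) -> seq (M * N) -> Prop :=
| tensor_refl s : tensor_eq s s
| tensor_sym s t : tensor_eq s t -> tensor_eq t s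
| tensor_trans s t u : tensor_eq s t -> tensor_eq t u -> tensor_eq s u
| tensor_cat s s' t t' :
    tensor_eq s s' -> tensor_eq t t' -> tensor_eq (s ++ t) (s' ++ t')
| tensor_catC s t : tensor_eq (s ++ t) (t ++ s)
| tensor_0l n : tensor_eq [:: (0, n)] [::]
| tensor_Dl m m' n : tensor_eq [:: (m + m', n)] [:: (m, n); (m', n)]
| tensor_Dr m n n' : tensor_eq [:: (m, n + n')] [:: (m, n); (m, n')]
| tensor_Z a m n : tensor_eq [:: (a *: m, n)] [:: (m, a *: n)].

(* The action of sum_i a_i (x) b_i in A (x)_R A^op on A: x |-> sum_i a_i x b_i. *)
Definition enveloping_action (R : comNzRingType) (A : algType R)
  (s : seq (A * A)) (x : A) : A := \sum_(p <- s) p.1 * x * p.2.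

(* A is a faithful finitely generated projective R-module, and the canonical  *)
(* map A (x)_R A^op -> End_R(A) is bijective.                                 *)
Definition azumaya (R : comNzRingType) (A : algType R) : Prop :=
  [/\ finitely_generated A, projective A, faithful A,
      forall s t : seq (A * A),
        enveloping_action s =1 enveloping_action t -> tensor_eq s t
    & forall phi : {linear A -> A},
        exists s : seq (A * A), enveloping_action s =1 phi].

Section Subring.
Variables (L : fieldType) (D : subringClosed L).

Definition subring_type : Type := {x : L | x \in D}.

HB.instance Definition _ := SubChoice.on subring_type.
HB.instance Definition _ := [SubChoice_isSubComNzRing of subring_type by <:].

Definition subring_unit : {pred subring_type} :=
  fun x => (val x != 0) && ((val x)^-1 \in D).

Definition subring_inv (x : subring_type) : subring_type :=
  if subring_unit x then insubd x (val x)^-1 else x.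

Fact subring_mulVx : {in subring_unit, left_inverse 1 subring_inv *%R}.
Proof.
move=> x Ux; apply: val_inj; rewrite rmorphM rmorph1 /= /subring_inv.
have /andP[nz_x Dx] : subring_unit x := Ux.
by rewrite (Ux : subring_unit x) val_insubd Dx mulVf.
Qed.

Fact subring_unitPl (x y : subring_type) : y * x = 1 -> subring_unit x.
Proof.
move=> /(congr1 val); rewrite rmorphM rmorph1 /= => yx1.
have nz_x : val x != 0.
  by apply/eqP=> x0; move/eqP: yx1; rewrite x0 mulr0 eq_sym oner_eq0.
have := valP y; rewrite -(mulfK nz_x (val y)) yx1 mul1r => Dx.
by rewrite /subring_unit nz_x.
Qed.

Fact subring_invr_out : {in [predC subring_unit], subring_inv =1 id}.
Proof.
move=> x /negP Ux; rewrite /subring_inv.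
by case: ifP => // Ux'; case: Ux.
Qed.

HB.instance Definition _ := GRing.ComNzRing_hasMulInverse.Build subring_type
  subring_mulVx subring_unitPl subring_invr_out.

(* This forces L to be the field of fractions of D. *)
Definition valuation_ring : Prop := forall x : L, x \in D \/ x^-1 \in D.

End Subring.

Section IntegralClosure.
Variables (F : fieldType) (V : subringClosed F) (K : fieldExtType F).

Definition integral_closure : {pred K} :=
  fun x => `[< integralOver (in_alg K \o (val : subring_type V -> F)) x >].

Fact integral_closure_subring : subring_closed integral_closure.
Proof.
split=> [|x y /asboolP Ix /asboolP Iy|x y /asboolP Ix /asboolP Iy].
- by apply/asboolP; exact: integral1.
- by apply/asboolP; exact: integral_sub.
- by apply/asboolP; exact: integral_mul.
Qed.

HB.instance Definition _ :=
  GRing.isSubringClosed.Build K integral_closure integral_closure_subring.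

End IntegralClosure.
Arguments integral_closure {F} V K.

Section Unramified.
Variables (F : fieldType) (V : subringClosed F) (K : splittingFieldType F).

Definition lies_over (V1 : subringClosed K) : Prop :=
  valuation_ring V1 /\ forall a : F, (a%:A \in V1) = (a \in V).

(* gal_of {:K} is the type of all the F-automorphisms of K. *)
Definition in_inertia (V1 : subringClosed K) (s : gal_of {:K}) : Prop :=
  forall x : subring_type V1, exists2 y : subring_type V1,
    in_jacobson y & val y = s (val x) - val x.

Definition unramified_defectless : Prop :=
  forall V1 : subringClosed K, lies_over V1 ->
  forall s : gal_of {:K}, in_inertia V1 s -> s = 1%g.

End Unramified.
Arguments unramified_defectless {F} V K.

(* In gal_of {:K}, (s * t)%g is s followed by t; gcomp s t is the usual       *)
(* composite, x |-> s (t x), which is the product of the Galois group here.   *)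
Definition gcomp (F : fieldType) (K : splittingFieldType F)
  (s t : gal_of {:K}) : gal_of {:K} := (t * s)%g.

Record normalized_cocycle (F : fieldType) (K : splittingFieldType F) :=
  NormalizedCocycle {
  cocycle_fun :> gal_of {:K} -> gal_of {:K} -> K;
  cocycle_neq0 : forall s t, cocycle_fun s t != 0;
  cocycle1l : forall s, cocycle_fun 1%g s = 1;
  cocycle1r : forall s, cocycle_fun s 1%g = 1;
  cocycleP : forall s t u,
    cocycle_fun s t * cocycle_fun (gcomp s t) u =
    s (cocycle_fun t u) * cocycle_fun s (gcomp t u) }.

(* CrossedProduct f u stands for \sum_s u(s) x_s. It is a wrapper because     *)
(* {ffun G -> K} already carries the pointwise product.                       *)
Record crossed_product (F : fieldType) (K : splittingFieldType F)
    (f : normalized_cocycle K) : Type :=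
  CrossedProduct { coef : {ffun gal_of {:K} -> K} }.

Section CrossedProduct.
Variables (F : fieldType) (K : splittingFieldType F).
Variable f : normalized_cocycle K.
Local Notation G := (gal_of {:K}).
Local Notation Sigma := (crossed_product f).

Fact coefK : cancel (@coef F K f) (@CrossedProduct F K f). Proof. by case. Qed.

HB.instance Definition _ := Choice.copy Sigma (can_type coefK).

Definition crossed_add (u v : Sigma) := CrossedProduct f (coef u + coef v).
Definition crossed_opp (u : Sigma) := CrossedProduct f (- coef u).

Fact crossed_addA : associative crossed_add.
Proof. by move=> u v w; rewrite /crossed_add /= addrA. Qed.
Fact crossed_addC : commutative crossed_add.
Proof. by move=> u v; rewrite /crossed_add addrC. Qed.
Fact crossed_add0 : left_id (CrossedProduct f 0) crossed_add.
Proof. by case=> u; rewrite /crossed_add /= add0r. Qed.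
Fact crossed_addN : left_inverse (CrossedProduct f 0) crossed_opp crossed_add.
Proof. by move=> u; rewrite /crossed_add /= addNr. Qed.

HB.instance Definition _ := GRing.isZmodule.Build Sigma
  crossed_addA crossed_addC crossed_add0 crossed_addN.

(* (\sum_s a_s x_s) (\sum_t b_t x_t) = \sum_(s, t) a_s s(b_t) f(s, t) x_(st). *)
Definition crossed_mul (u v : Sigma) : Sigma := CrossedProduct f
  [ffun r => \sum_s \sum_(t | gcomp s t == r) coef u s * s (coef v t) * f s t].

Definition crossed_one : Sigma :=
  CrossedProduct f [ffun s => if s == 1%g then 1 else 0].

Lemma coef_inj : injective (@coef F K f). Proof. exact: can_inj coefK. Qed.

Lemma galcompE (s t : G) x : gcomp s t x = s (t x).
Proof. by rewrite /gcomp galM ?memvf. Qed.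

Lemma gcomp_reindex (s r : G) (E : G -> K) :
  \sum_(t | gcomp s t == r) E t = E (r * s^-1)%g.
Proof.
by rewrite (big_pred1 (r * s^-1)%g) // => t;
  rewrite /gcomp -(inj_eq (mulIg s^-1)%g) mulgK.
Qed.

Lemma crossed_mulE u v r : coef (crossed_mul u v) r =
  \sum_s coef u s * s (coef v (r * s^-1)%g) * f s (r * s^-1)%g.
Proof. by rewrite ffunE; apply: eq_bigr => s _; rewrite gcomp_reindex. Qed.

Fact crossed_mulA : associative crossed_mul.
Proof.
move=> u v w; apply/coef_inj/ffunP=> r; rewrite !crossed_mulE.
transitivity (\sum_s \sum_t
    coef u s * s (coef v t) * gcomp s t (coef w (r * s^-1 * t^-1)%g)
    * (f s t * f (gcomp s t) (r * s^-1 * t^-1)%g)).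
  apply: eq_bigr => s _; rewrite crossed_mulE rmorph_sum mulr_sumr mulr_suml.
  apply: eq_bigr => t _; rewrite cocycleP !rmorphM /= galcompE.
  by rewrite /gcomp mulgKV -!mulrA.
under [RHS]eq_bigr => q _ do rewrite crossed_mulE !mulr_suml.
rewrite [RHS]exchange_big /=; apply: eq_bigr => s _.
rewrite [RHS](reindex_inj (mulIg s)) /=; apply: eq_bigr => t _.
rewrite mulgK /gcomp invMg mulgA -!mulrA; congr (_ * (_ * _)).
by rewrite mulrCA.
Qed.

Fact crossed_mul1r : left_id crossed_one crossed_mul.
Proof.
move=> u; apply/coef_inj/ffunP=> r; rewrite crossed_mulE (bigD1 1%g) //= big1.
  by rewrite ffunE eqxx invg1 mulg1 gal_id cocycle1l mul1r mulr1 addr0.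
by move=> s /negPf s1; rewrite ffunE s1 !mul0r.
Qed.

Fact crossed_mulr1 : right_id crossed_one crossed_mul.
Proof.
move=> u; apply/coef_inj/ffunP=> r; rewrite crossed_mulE (bigD1 r) //= big1.
  by rewrite ffunE mulgV eqxx rmorph1 cocycle1r !mulr1 addr0.
move=> s /negPf sr; rewrite ffunE -eq_mulgV1 eq_sym sr rmorph0.
by rewrite mulr0 mul0r.
Qed.

Fact crossed_mulDl : left_distributive crossed_mul +%R.
Proof.
move=> u v w; apply/coef_inj/ffunP=> r; rewrite [in RHS]ffunE !crossed_mulE.
by rewrite -big_split; apply: eq_bigr => s _; rewrite ffunE !mulrDl.
Qed.

Fact crossed_mulDr : right_distributive crossed_mul +%R.
Proof.
move=> u v w; apply/coef_inj/ffunP=> r; rewrite [in RHS]ffunE !crossed_mulE.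
rewrite -big_split; apply: eq_bigr => s _.
by rewrite ffunE rmorphD mulrDr mulrDl.
Qed.

Fact crossed_one_neq0 : crossed_one != 0.
Proof.
apply/eqP=> /(congr1 (@coef F K f))/ffunP/(_ 1%g); rewrite !ffunE eqxx.
by move/eqP; rewrite oner_eq0.
Qed.

HB.instance Definition _ := GRing.Zmodule_isNzRing.Build Sigma
  crossed_mulA crossed_mul1r crossed_mulr1 crossed_mulDl crossed_mulDr
  crossed_one_neq0.

Definition crossed_scale (a : F) (u : Sigma) := CrossedProduct f (a *: coef u).

Fact crossed_scaleA a b u :
  crossed_scale a (crossed_scale b u) = crossed_scale (a * b) u.
Proof. by rewrite /crossed_scale /= scalerA. Qed.
Fact crossed_scale1 : left_id 1 crossed_scale.
Proof. by case=> u; rewrite /crossed_scale /= scale1r. Qed.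
Fact crossed_scaleDr : right_distributive crossed_scale +%R.
Proof. by move=> a u v; rewrite /crossed_scale /= scalerDr. Qed.
Fact crossed_scaleDl u : {morph crossed_scale^~ u : a b / a + b}.
Proof. by move=> a b; rewrite /crossed_scale /= scalerDl. Qed.

HB.instance Definition _ := GRing.Zmodule_isLmodule.Build F Sigma
  crossed_scaleA crossed_scale1 crossed_scaleDr crossed_scaleDl.

Fact crossed_scaleAl (a : F) (u v : Sigma) : a *: (u * v) = (a *: u) * v.
Proof.
apply/coef_inj/ffunP=> r; rewrite [in LHS]ffunE !crossed_mulE scaler_sumr.
by apply: eq_bigr => s _; rewrite ffunE !scalerAl.
Qed.
HB.instance Definition _ := GRing.Lmodule_isLalgebra.Build F Sigma
  crossed_scaleAl.

Fact crossed_scaleAr (a : F) (u v : Sigma) : a *: (u * v) = u * (a *: v).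
Proof.
apply/coef_inj/ffunP=> r; rewrite [in LHS]ffunE !crossed_mulE scaler_sumr.
by apply: eq_bigr => s _; rewrite ffunE linearZ /= -scalerAr -scalerAl.
Qed.
HB.instance Definition _ := GRing.Lalgebra_isAlgebra.Build F Sigma
  crossed_scaleAr.

(* crossed_basis c s is c x_s. *)
Definition crossed_basis (c : K) (s : G) : Sigma :=
  CrossedProduct f [ffun t => if t == s then c else 0].

Lemma crossed_basisM c d s t :
  crossed_basis c s * crossed_basis d t =
  crossed_basis (c * s d * f s t) (gcomp s t).
Proof.
apply/coef_inj/ffunP=> r; rewrite crossed_mulE (bigD1 s) //= big1 ?addr0.
  rewrite !ffunE eqxx -(inj_eq (mulIg s)) mulgKV /gcomp.
  by case: eqP => [->|_]; rewrite ?mulgK // rmorph0 mulr0 mul0r.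
by move=> s' /negPf ns; rewrite ffunE ns !mul0r.
Qed.

End CrossedProduct.

Section CrossedOrder.
Variables (F : fieldType) (V : subringClosed F) (K : splittingFieldType F).

Definition integral_values (f : normalized_cocycle K) : Prop :=
  forall s t, f s t \in integral_closure V K.

Variable f : normalized_cocycle K.
Local Notation S := (integral_closure V K).

Lemma integral_closure_gal (s : gal_of {:K}) x : x \in S -> s x \in S.
Proof.
move=> /asboolP[p p_monic px0]; apply/asboolP; exists p => //.
have : root (map_poly s (map_poly (in_alg K \o val) p)) (s x).
  by rewrite rmorph_root.
congr (root _ _); rewrite -map_poly_comp.
by apply: eq_map_poly => a /=; rewrite linearZ /= rmorph1.
Qed.

(* The proof that f has values in S is needed for closure under products. *)
Definition crossed_order_pred (hf : integral_values f) :
    {pred crossed_product f} :=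
  fun u => [forall s, coef u s \in S].

Variable hf : integral_values f.

Fact crossed_order_subring : subring_closed (crossed_order_pred hf).
Proof.
split=> [|u v /forallP Su /forallP Sv|u v /forallP Su /forallP Sv].
- apply/forallP=> s; rewrite ffunE.
  by case: ifP => _; [exact: rpred1 | exact: rpred0].
- by apply/forallP=> s; rewrite !ffunE; apply: rpredB.
- apply/forallP=> r; rewrite ffunE; apply: rpred_sum => s _.
  apply: rpred_sum => t _; apply: rpredM; last exact: hf.
  by apply: rpredM; rewrite ?Su // integral_closure_gal ?Sv.
Qed.

HB.instance Definition _ := GRing.isSubringClosed.Build (crossed_product f)
  (crossed_order_pred hf) crossed_order_subring.

Definition crossed_order : Type :=
  {u : crossed_product f | u \in crossed_order_pred hf}.

HB.instance Definition _ := SubChoice.on crossed_order.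
HB.instance Definition _ := [SubChoice_isSubNzRing of crossed_order by <:].

Fact crossed_order_scale_subproof (a : subring_type V) (u : crossed_order) :
  val a *: val u \in crossed_order_pred hf.
Proof.
apply/forallP=> s; rewrite ffunE -mulr_algl rpredM //; last first.
  exact: (forallP (valP u)).
by apply/asboolP; exact: integral_id.
Qed.

Definition crossed_order_scale (a : subring_type V) (u : crossed_order) :
    crossed_order :=
  Sub (val a *: val u) (crossed_order_scale_subproof a u).

Fact crossed_order_scaleA a b u :
  crossed_order_scale a (crossed_order_scale b u) =
  crossed_order_scale (a * b) u.
Proof. by apply: val_inj; rewrite /= scalerA. Qed.
Fact crossed_order_scale1 : left_id 1 crossed_order_scale.
Proof. by move=> u; apply: val_inj; rewrite /= scale1r. Qed.
Fact crossed_order_scaleDr : right_distributive crossed_order_scale +%R.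
Proof. by move=> a u v; apply: val_inj; rewrite /= scalerDr. Qed.
Fact crossed_order_scaleDl u :
  {morph crossed_order_scale^~ u : a b / a + b}.
Proof. by move=> a b; apply: val_inj; rewrite /= scalerDl. Qed.

HB.instance Definition _ := GRing.Zmodule_isLmodule.Build
  (subring_type V) crossed_order crossed_order_scaleA crossed_order_scale1
  crossed_order_scaleDr crossed_order_scaleDl.

Fact crossed_order_scaleAl (a : subring_type V) (u v : crossed_order) :
  a *: (u * v) = (a *: u) * v.
Proof. by apply: val_inj; rewrite /= scalerAl. Qed.
HB.instance Definition _ := GRing.Lmodule_isLalgebra.Build
  (subring_type V) crossed_order crossed_order_scaleAl.

Fact crossed_order_scaleAr (a : subring_type V) (u v : crossed_order) :
  a *: (u * v) = u * (a *: v).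
Proof. by apply: val_inj; rewrite /= scalerAr. Qed.
HB.instance Definition _ := GRing.Lalgebra_isAlgebra.Build
  (subring_type V) crossed_order crossed_order_scaleAr.

Definition cocycleS (s t : gal_of {:K}) : subring_type S := Sub (f s t) (hf s t).

Definition cocycle_subgroup : {set gal_of {:K}} :=
  [set s | cocycleS s s^-1%g \is a GRing.unit].

End CrossedOrder.

(* Main.v *)
(** The inertia condition gives Galois coordinates for S over V: finitely many
    a_i, b_i in S with sum_i a_i s(b_i) = [s = 1] (Chase-Harrison-Rosenberg).
    They make S a finite projective V-module and turn V-linear maps into
    S-linear ones by averaging.

    If A_f is semihereditary and f(t, t^-1) = sum_j b_j a_j lies in M^2, a dual
    basis for the left ideal generated by x_(t^-1) and the a_j puts 1 in M.

    Conversely, if no f(t, t^-1) lies in any M^2, then either all f(t, t^-1) are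
    units (put pi = 1), or J(V) = pi V and every f(t, t^-1) divides pi.  In both
    cases there are y_s in A_f with x_s y_s = y_s x_s = pi.  For a finitely
    generated torsion-free A_f-module P let J = sum_s y_s P.  For every S-linear
    q : J -> P the map m |-> sum_s x_s q(y_s m) is A_f-linear, and P is
    projective as soon as some map of this form is bijective.  When J(V) = pi V,
    choose p : J -> P with p(pi m) = m modulo J and let q = c p with c in S.
    Locally at a maximal ideal the submodules x_s P form a chain, because
    f(s, r) f(sr, r^-1) = s(f(r, r^-1)) is not in the square of any maximal
    ideal; on the layers of this chain the map acts by partial traces of c.
    Choosing c with all partial traces nonzero makes it injective modulo pi,
    hence bijective.

    A_f is Azumaya exactly when all f(t, t^-1) are units, and when J(V) is not
    principal every maximal ideal M of S satisfies M = M^2. *)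

Require Import Defs.
From HB Require Import structures.
From mathcomp Require Import all_boot all_order all_algebra all_fingroup.
From mathcomp Require Import all_solvable all_field.
From mathcomp Require Import boolp ring generic_quotient.
From mathcomp Require classical_sets.

Set Implicit Arguments.
Unset Strict Implicit.
Unset Printing Implicit Defensive.

Import GRing.Theory.
Local Open Scope ring_scope.

(** * Maximal ideals *)

(** V has arbitrary rank and S need not be noetherian, so the module arguments express local
    statements by multipliers outside a maximal ideal M. One maximal ideal M0 is fixed and only its
    conjugates s |-> M0 (g s) are visited: an ideal of S contained in none of them contains an
    element whose norm is a unit of V, hence contains 1. The obstacle to averaging is that x_s is
    invertible only up to pi. The map to be averaged is therefore given on J, where coordinates can
    be divided by pi. The price is that the average is no longer multiplication by the trace of c:
    on the layer of x_h P only those s with x_s P locally equal to x_h P contribute, so the weight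
    is a partial trace, and a single c has to serve all classes and all conjugates. Right ideals
    follow from left ideals because the opposite order is a crossed product with the same values
    f(t, t^-1). *)

Record is_max (R : comNzRingType) (M : R -> bool) : Prop := IsMax {
  max0 : M 0;
  maxD : forall x y, M x -> M y -> M (x + y);
  maxMl : forall r x, M x -> M (r * x);
  max1 : ~~ M 1;
  max_inv : forall x, ~~ M x -> exists r, M (1 - r * x) }.

Section MaximalIdeals.
Variable R : comNzRingType.
Implicit Types (M : R -> bool) (x y : R).

Lemma maxMr M x r : is_max M -> M x -> M (x * r).
Proof. by move=> mM Mx; rewrite mulrC; apply: maxMl. Qed.

Lemma maxN M x : is_max M -> M x -> M (- x).
Proof. by move=> mM Mx; rewrite -mulN1r; apply: maxMl. Qed.

Lemma maxB M x y : is_max M -> M x -> M y -> M (x - y).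
Proof. by move=> mM Mx My; apply: maxD => //; apply: maxN. Qed.

Lemma max_addl M x y : is_max M -> M x -> M (x + y) = M y.
Proof.
move=> mM Mx; apply/idP/idP=> [Mxy|]; last exact: maxD.
by rewrite -(addKr x y); apply: maxD => //; apply: maxN.
Qed.

Lemma max_sum M (I : Type) (r : seq I) (P : pred I) (E : I -> R) :
  is_max M -> (forall i, P i -> M (E i)) -> M (\sum_(i <- r | P i) E i).
Proof.
by move=> mM ME; elim/big_ind: _ => //; [apply: max0 | apply: maxD].
Qed.

Lemma max_prime M x y : is_max M -> M (x * y) = M x || M y.
Proof.
move=> mM; apply/idP/idP=> [Mxy|/orP[]]; [|exact: maxMr|exact: maxMl].
case: (boolP (M x)) => // /(max_inv mM)[r Mr]; rewrite /= -[y]mul1r.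
rewrite -(subrK (r * x) 1) mulrDl -mulrA; apply: maxD => //.
  exact: maxMr.
exact: maxMl.
Qed.

Lemma max_prod M (I : Type) (r : seq I) (E : I -> R) :
  is_max M -> (forall i, ~~ M (E i)) -> ~~ M (\prod_(i <- r) E i).
Proof.
move=> mM ME; elim/big_rec: _ => [|i x _ Mx]; first exact: max1.
by rewrite max_prime // negb_or ME.
Qed.

Lemma exists_max : exists M : R -> bool, is_max M.
Proof.
(* [P] leaves out membership of 0, since the union of the empty chain is empty; [A0] recovers it
   from maximality. *)
pose P (A : classical_sets.set R) := [/\ forall x y, A x -> A y -> A (x + y),
  forall r x, A x -> A (r * x) & ~ A 1].
have [F FP totF|A [[AD AM A1] Amax]] := @classical_sets.Zorn_bigcup R P.
  split.
  - move=> x y [X FX Xx] [Y FY Yy].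
    have [XY|YX] := totF _ _ FX FY.
      by exists Y => //; case: (FP _ FY) => YD _ _; apply: YD => //; apply: XY.
    by exists X => //; case: (FP _ FX) => XD _ _; apply: XD => //; apply: YX.
  - by move=> r x [X FX Xx]; exists X => //; case: (FP _ FX) => _ XM _; apply: XM.
  - by move=> [X FX X1]; case: (FP _ FX).
have bigger (B : classical_sets.set R) :
    (forall x, A x -> B x) -> P B -> forall x, B x -> A x.
  move=> AB PB x Bx; apply: contrapT => nAx; apply: (Amax B) => //.
  by split=> // BA; apply: nAx; apply: BA.
have A0 : A 0.
  apply: contrapT => nA0; apply: nA0; apply: (bigger (fun x => A x \/ x = 0)).
  - by move=> x; left.
  - split.
    + move=> x y [Ax|->] [Ay|->]; rewrite ?add0r ?addr0; auto.
    + by move=> r x [Ax|->]; [left; apply: AM | right; rewrite mulr0].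
    + by case=> // /eqP; rewrite oner_eq0.
  - by right.
exists (fun x => `[< A x >]); split; first exact/asboolP.
- by move=> x y /asboolP Ax /asboolP Ay; apply/asboolP/AD.
- by move=> r x /asboolP Ax; apply/asboolP/AM.
- exact/asboolP.
move=> x /asboolP nAx; apply: contrapT => nE; apply: nAx.
apply: (bigger (fun y => exists2 a, A a & exists r, y = a + r * x)).
- by move=> y Ay; exists y => //; exists 0; rewrite mul0r addr0.
- split.
  + move=> _ _ [a Aa [r ->]] [b Ab [s ->]]; exists (a + b); first exact: AD.
    by exists (r + s); rewrite mulrDl addrACA.
  + move=> r _ [a Aa [s ->]]; exists (r * a); first exact: AM.
    by exists (r * s); rewrite mulrDr mulrA.
  + case=> a Aa [r E1]; apply: nE; exists r; apply/asboolP.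
    by rewrite E1 addrK.
- by exists 0 => //; exists 1; rewrite add0r mul1r.
Qed.

Section Extend.
Variables (M : submodClosed R^o) (x : R).
Definition extended_ideal : {pred R^o} :=
  fun y => `[< exists2 m, m \in M & exists r, y = m + r * x >].
Fact extended_ideal_subproof : subsemimod_closed extended_ideal.
Proof.
split; first split.
- by apply/asboolP; exists 0; [apply: rpred0 | exists 0; rewrite mul0r addr0].
- move=> _ _ /asboolP[a Ma [r ->]] /asboolP[b Mb [s ->]].
  apply/asboolP; exists (a + b); first exact: rpredD.
  by exists (r + s); rewrite mulrDl addrACA.
- move=> r _ /asboolP[a Ma [s ->]]; apply/asboolP; exists (r * a).
    exact: (@rpredZ R R^o M r).
  by exists (r * s); rewrite -[_ *: _]/(r * (a + s * x)) mulrDr mulrA.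
Qed.
HB.instance Definition _ :=
  GRing.isSubmodClosed.Build R R^o extended_ideal extended_ideal_subproof.
End Extend.

(** [is_max] replaces maximality among ideals by invertibility modulo M, for bare Boolean
    predicates: these can be composed with automorphisms without rebuilding an ideal structure. *)
Lemma maximal_is_max (M : submodClosed R^o) :
  maximal_left_ideal M -> is_max (fun x => x \in M).
Proof.
case=> M1 Mmax; split=> //.
- exact: rpred0.
- by move=> x y; apply: rpredD.
- by move=> r x Mx; apply: (@rpredZ R R^o M r).
move=> x nMx; apply: contrapT => nE; move/negP: nMx; apply.
apply: (Mmax (extended_ideal M x)).
- by move=> y My; apply/asboolP; exists y => //; exists 0; rewrite mul0r addr0.
- apply/asboolP=> -[m Mm [r E1]]; apply: nE; exists r.
  by rewrite E1 addrK.
- by apply/asboolP; exists 0; [apply: rpred0 | exists 1; rewrite add0r mul1r].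
Qed.

Section OfMax.
Variables (M : R -> bool) (mM : is_max M).
Definition max_pred (_ : is_max M) : {pred R^o} := fun x => M x.
Fact max_pred_subproof : subsemimod_closed (max_pred mM).
Proof.
split; first split; first exact: (max0 mM).
- by move=> x y; apply: (maxD mM).
- by move=> r x; apply: (maxMl mM).
Qed.
HB.instance Definition _ :=
  GRing.isSubmodClosed.Build R R^o (max_pred mM) max_pred_subproof.
End OfMax.

(** The way back: conditions (ii) and (iii) speak of [submodClosed] ideals, the arguments of
    conjugate predicates. *)
Lemma is_max_maximal (M : R -> bool) : is_max M ->
  exists N : submodClosed R^o, (forall x, (x \in N) = M x)
                               /\ maximal_left_ideal N.
Proof.
move=> mM; exists (max_pred mM : submodClosed R^o); split=> //.
split; first exact: (max1 mM).
move=> I sMI I1 x Ix; apply: contraT => /(max_inv mM)[r Mr].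
case/negP: I1; rewrite -(subrK (r * x) 1); apply: rpredD; first exact: sMI.
exact: (@rpredZ R R^o I r).
Qed.

End MaximalIdeals.

(** * The integral closure of a valuation ring *)

Section IntegralClosureLocal.
Variables (F : fieldType) (V : subringClosed F) (K : splittingFieldType F).
Hypothesis hV : valuation_ring V.
Hypothesis hK : galois 1 {:K}.
Local Notation G := (gal_of {:K}).
Local Notation S := (integral_closure V K).
Local Notation St := (subring_type S).
Local Notation Vt := (subring_type V).

Lemma integral_closure_root (p : {poly K}) x :
  p \is monic -> root p x -> p \is a polyOver S -> x \in S.
Proof.
move=> p_monic px0 /allP Sp; apply/asboolP.
by apply: (integral_root_monic p_monic px0) => a /Sp /asboolP.
Qed.

(** An arbitrary partial value b at the start lets inductions restart in the middle of a
    polynomial. *)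
Definition horner_from (x b : K) (l : seq St) :=
  foldl (fun b a => b * x + val a) b l.

(** Multiplying a relation for x with leading coefficient b by a power of b makes it monic in b x.
    The induction does this one coefficient at a time: q is the part already rewritten, and c
    collects the powers of b. *)
Lemma horner_from_scaled (x b : K) (l : seq St) (q : {poly K}) (c h : K) :
  b \in S -> c \in S -> q \is monic -> q \is a polyOver S ->
  q.[b * x] = c * h ->
  exists (q' : {poly K}) (c' : K),
    [/\ q' \is monic, q' \is a polyOver S & q'.[b * x] = c' * horner_from x h l].
Proof.
move=> Sb; elim: l q c h => [|a l IHl] q c h Sc mq Sq qbx; first by exists q, c.
apply: (IHl (q * 'X + (val a * c * b)%:P) (c * b)).
- exact: rpredM.
- rewrite monicE lead_coefDl ?lead_coefMX -?monicE //.
  rewrite size_mulX ?monic_neq0 // ltnS (leq_trans (size_polyC_leq1 _)) //.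
  by rewrite size_poly_gt0 monic_neq0.
- rewrite rpredD ?rpredM ?polyOverX // polyOverC !rpredM //; exact: valP.
- rewrite hornerMXaddC qbx; ring.
Qed.

Lemma horner_from_integral (x : K) (b : St) (l : seq St) :
  (0 < size l)%N -> horner_from x (val b) l = 0 ->
  exists c : St, val c = val b * x.
Proof.
case: l => // a l _ /= h0.
have mXa : 'X + (val a)%:P \is monic.
  by have := monicXsubC (- val a); rewrite polyCN opprK.
have [||q [c [mq Sq]]] := @horner_from_scaled x (val b) l ('X + (val a)%:P) 1
  (val b * x + val a) (valP b) (rpred1 _) mXa.
- by rewrite rpredD ?polyOverX // polyOverC; exact: valP.
- by rewrite !hornerE.
rewrite h0 mulr0 => /eqP qbx0.
by exists (Sub (val b * x) (integral_closure_root mq qbx0 Sq)).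
Qed.

(* Seidenberg's argument: in a Horner scheme vanishing at x all partial values
   b and their multiples b x are integral, and they cannot all lie in M. *)
Lemma horner_from_max (M : St -> bool) (x : K) (b : St) (l : seq St) :
  is_max M -> ~~ M b || has (fun a => ~~ M a) l ->
  horner_from x (val b) l = 0 ->
  exists b' c : St, val c = val b' * x /\ (~~ M b' || ~~ M c).
Proof.
move=> mM; elim: l b => [|a l IHl] b Mbl h0.
  have b0 : b = 0 by apply: val_inj; exact: h0.
  by rewrite b0 (max0 mM) in Mbl.
have [//|c cE] := horner_from_integral _ h0.
case: (boolP (~~ M b || ~~ M c)) => [Mbc|]; first by exists b, c.
rewrite negb_or !negbK => /andP[Mb Mc]; apply: (IHl (c + a)).
  by rewrite max_addl //; move: Mbl; rewrite Mb.
by move: h0; rewrite /horner_from /= -cE.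
Qed.

Lemma valuation_max (l : seq F) : has (fun a => a != 0) l ->
  exists2 k, k \in l /\ k != 0 & forall a, a \in l -> a / k \in V.
Proof.
elim: l => //= a l IHl; case: (boolP (has _ l)) => [/IHl[k [lk nzk] Vk] _|l0].
  have Vk' : a / k \in V -> exists2 k, k \in a :: l /\ k != 0 &
      forall b, b \in a :: l -> b / k \in V.
    move=> Vak; exists k; first by split=> //; rewrite inE lk orbT.
    by move=> b; rewrite inE => /predU1P[->|/Vk].
  case: (eqVneq a 0) => [a0|nza].
    by apply: Vk'; rewrite a0 mul0r rpred0.
  have [/Vk'//|Vka] := hV (a / k).
  exists a; first by split=> //; rewrite inE eqxx.
  move=> b; rewrite inE => /predU1P[->|/Vk Vbk]; first by rewrite divff ?rpred1.
  rewrite invf_div in Vka.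
  by rewrite -(divfK nzk b) -[_ / a]mulrA rpredM.
rewrite orbF => nza; exists a; first by split=> //; rewrite inE eqxx.
move=> b; rewrite inE => /predU1P[->|lb]; first by rewrite divff ?rpred1.
by have := hasPn l0 _ lb; rewrite negbK => /eqP->; rewrite mul0r rpred0.
Qed.

Definition base_to_closure (v : Vt) : St :=
  Sub (val v)%:A (introT (asboolP _) (integral_id _ v)).

Definition gal_closure (g : G) (s : St) : St :=
  Sub (g (val s)) (integral_closure_gal g (valP s)).

Fact gal_closure_zmod g : zmod_morphism (gal_closure g).
Proof. by move=> x y; apply: val_inj; rewrite /= rmorphB. Qed.
Fact gal_closure_monoid g : monoid_morphism (gal_closure g).
Proof.
by split=> [|x y]; apply: val_inj; rewrite /= ?rmorph1 // rmorphM.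
Qed.
HB.instance Definition _ g := GRing.isZmodMorphism.Build St St (gal_closure g)
  (gal_closure_zmod g).
HB.instance Definition _ g := GRing.isMonoidMorphism.Build St St (gal_closure g)
  (gal_closure_monoid g).

Fact base_to_closure_zmod : zmod_morphism base_to_closure.
Proof. by move=> x y; apply: val_inj; rewrite /= scalerBl. Qed.
Fact base_to_closure_monoid : monoid_morphism base_to_closure.
Proof.
split=> [|x y]; apply: val_inj; rewrite /= ?scale1r //.
by rewrite mulr_algl scalerA.
Qed.
HB.instance Definition _ := GRing.isZmodMorphism.Build Vt St base_to_closure
  base_to_closure_zmod.
HB.instance Definition _ := GRing.isMonoidMorphism.Build Vt St base_to_closure
  base_to_closure_monoid.

Lemma gal_closure1 s : gal_closure 1%g s = s.
Proof. by apply: val_inj; rewrite /= gal_id. Qed.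

Lemma gal_closureM g h s : gal_closure (gcomp g h) s = gal_closure g (gal_closure h s).
Proof. by apply: val_inj; rewrite /= galcompE. Qed.

Lemma gal_closure_base g v : gal_closure g (base_to_closure v) = base_to_closure v.
Proof. by apply: val_inj; rewrite /= linearZ /= rmorph1. Qed.

Lemma base_inj : injective base_to_closure.
Proof.
by move=> v w /(congr1 val)/(@fmorph_inj _ _ (in_alg K)) vw; apply: val_inj.
Qed.

Lemma valSM (s t : St) : val (s * t) = val s * val t. Proof. by []. Qed.
Lemma valSB (s t : St) : val (s - t) = val s - val t. Proof. by []. Qed.
Lemma valSg g (s : St) : val (gal_closure g s) = g (val s). Proof. by []. Qed.
Lemma valSv v : val (base_to_closure v) = (val v)%:A. Proof. by []. Qed.

Lemma val_eq0 (s : St) : (val s == 0) = (s == 0).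
Proof. by rewrite -(inj_eq val_inj). Qed.

Lemma mulS_eq0 (s t : St) : (s * t == 0) = (s == 0) || (t == 0).
Proof. by rewrite -!val_eq0 -mulf_eq0. Qed.

Lemma mulSI (s t u : St) : s != 0 -> s * t = s * u -> t = u.
Proof.
move=> nzs /eqP; rewrite -subr_eq0 -mulrBr mulS_eq0 (negPf nzs) subr_eq0.
by move/eqP.
Qed.

Lemma base_eq0 (v : Vt) : (base_to_closure v == 0) = (v == 0).
Proof. by rewrite -(inj_eq base_inj) rmorph0. Qed.

Lemma gal_closure_eq0 g (s : St) : (gal_closure g s == 0) = (s == 0).
Proof. by rewrite -!val_eq0 /= fmorph_eq0. Qed.

Lemma integrally_closed_base (a : F) : a%:A \in S -> a \in V.
Proof.
case: (hV a) => // Va' /asboolP[p mp /rootP pa0].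
case: (eqVneq a 0) => [->|nza]; first exact: rpred0.
have {pa0} : \sum_(i < size p) val p`_i * a ^+ i = 0.
  apply: (fmorph_inj (in_alg K)); rewrite rmorph0 -[RHS]pa0.
  rewrite horner_coef size_map_poly_id0 ?(monicP mp) ?rmorph1 ?oner_neq0 //.
  rewrite rmorph_sum; apply: eq_bigr => i _.
  by rewrite rmorphM rmorphXn coef_map.
have := monicP mp; rewrite lead_coefE; have := monic_neq0 mp; rewrite -size_poly_eq0.
case: (size p) => // n _ /=.
case: n => [|n] pn1; rewrite big_ord_recr /= pn1 (_ : sval (1 : Vt) = 1) ?mul1r //.
  by move/eqP; rewrite big_ord0 add0r oner_eq0.
move/eqP; rewrite addrC addr_eq0 => /eqP an.
have -> : a = a ^+ n.+1 * a^-1 ^+ n.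
  by rewrite exprS -mulrA -exprMn divff // expr1n mulr1.
rewrite an mulNr rpredN mulr_suml rpred_sum // => i _.
have -> : a^-1 ^+ n = a^-1 ^+ i * a^-1 ^+ (n - i).
  by rewrite -exprD subnKC // -ltnS.
rewrite -mulrA [a ^+ i * _]mulrA -exprMn divff // expr1n mul1r.
by rewrite rpredM ?rpredX //; exact: (valP (p`_i)).
Qed.

Lemma gal_all (g : G) : g \in 'Gal({:K} / 1)%g.
Proof.
rewrite gal_kHom ?subvf //; apply/kAHomP => x /vlineP[a ->].
by rewrite linearZ /= rmorph1.
Qed.

Lemma fixed_base (x : St) : (forall g, gal_closure g x = x) ->
  exists v, base_to_closure v = x.
Proof.
move=> gx; have : val x \in 1%VS.
  rewrite -(galois_fixedField hK); apply/fixedFieldP => [|g _].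
    exact: memvf.
  exact: (congr1 val (gx g)).
case/vlineP=> a xE; have Sa : a%:A \in S by rewrite -xE; exact: valP.
by exists (Sub a (integrally_closed_base Sa)); apply: val_inj; rewrite /= xE.
Qed.

Definition nonunit (v : Vt) := v \isn't a GRing.unit.

Lemma base_unitE (v : Vt) : (v \is a GRing.unit) = (val v != 0) && ((val v)^-1 \in V).
Proof. by []. Qed.

Lemma base_div (v w : Vt) : (exists u, v = u * w) \/ (exists u, w = u * v).
Proof.
case: (eqVneq (val w) 0) => [w0|nzw].
  by right; exists 0; apply: val_inj; rewrite /= mul0r.
case: (eqVneq (val v) 0) => [v0|nzv].
  by left; exists 0; apply: val_inj; rewrite /= mul0r.
have [Vq|] := hV (val v / val w).
  by left; exists (Sub (val v / val w) Vq); apply: val_inj; rewrite /= divfK.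
rewrite invf_div => Vq.
by right; exists (Sub (val w / val v) Vq); apply: val_inj; rewrite /= divfK.
Qed.

Lemma nonunit0 : nonunit 0.
Proof. by rewrite /nonunit base_unitE /= eqxx. Qed.

Lemma nonunitMl v w : nonunit w -> nonunit (v * w).
Proof. by rewrite /nonunit unitrM negb_and => ->; rewrite orbT. Qed.

Lemma nonunitD v w : nonunit v -> nonunit w -> nonunit (v + w).
Proof.
move=> nv nw; have [[u ->]|[u ->]] := base_div v w.
  by rewrite -[X in _ + X]mul1r -mulrDl nonunitMl.
by rewrite -[X in X + _]mul1r -mulrDl nonunitMl.
Qed.

Lemma nonunit1B v : nonunit v -> 1 - v \is a GRing.unit.
Proof.
move=> nv; apply: contraT => n1v.
by have := nonunitD n1v nv; rewrite subrK /nonunit unitr1.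
Qed.

(** Expanding the product gives 1 - z v with z in S. The norm is fixed by the Galois group, so z is
    fixed once v is cancelled, and z lies in V. For a nonunit v the norm is then a unit, which is
    how nonunits of V are seen to lie in every maximal ideal of S. *)
Lemma norm1B (v : Vt) (r : St) :
  exists z : Vt, base_to_closure (1 - z * v)
                 = \prod_g gal_closure g (1 - r * base_to_closure v).
Proof.
set N := \prod_g _.
have [n nE] : exists n, base_to_closure n = N.
  apply: fixed_base => h; rewrite rmorph_prod /N [RHS](reindex_inj (mulIg h)).
  by apply: eq_bigr => g _; rewrite /= -gal_closureM.
have [z zE] : exists z, N = 1 - z * base_to_closure v.
  rewrite /N; elim/big_rec: _ => [|g y _ [z ->]].
    by exists 0; rewrite mul0r subr0.
  rewrite rmorphB rmorph1 rmorphM /= gal_closure_base.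
  exists (z + gal_closure g r - gal_closure g r * base_to_closure v * z); ring.
case: (eqVneq v 0) => [v0|nzv].
  by exists 0; rewrite zE v0 !rmorph0 !mulr0 !subr0 rmorph1.
have [w wE] : exists w, base_to_closure w = z.
  apply: fixed_base => g; apply: (@mulSI (base_to_closure v)).
    by rewrite base_eq0.
  rewrite -{1}(gal_closure_base g) -rmorphM.
  have -> : base_to_closure v * z = 1 - base_to_closure n.
    by rewrite nE zE subKr mulrC.
  by rewrite rmorphB rmorph1 /= gal_closure_base.
by exists w; rewrite zE rmorphB rmorph1 rmorphM /= wE.
Qed.

Lemma nonunit_max (M : St -> bool) v : is_max M -> nonunit v -> M (base_to_closure v).
Proof.
move=> mM nv; apply: contraT => /(max_inv mM)[r].
have [z zE] := norm1B v r; rewrite -[1 - _]gal_closure1 => M1.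
have : M (base_to_closure (1 - z * v)).
  by rewrite zE (bigD1 1%g) //= maxMr.
have Uz : 1 - z * v \is a GRing.unit by apply/nonunit1B/nonunitMl.
move/(maxMl mM (base_to_closure (1 - z * v)^-1)).
by rewrite -rmorphM mulVr // rmorph1 (negPf (max1 mM)).
Qed.

End IntegralClosureLocal.

(** * Localization and inertia *)

Section Localization.
Variables (F : fieldType) (V : subringClosed F) (K : splittingFieldType F).
Local Notation St := (subring_type (integral_closure V K)).
Variable M : St -> bool.
Hypothesis mM : is_max M.

(** The proof argument is there so that the subring instance, whose closure properties rest on M
    being prime, can be attached to the predicate. *)
Definition localization of is_max M : {pred K} :=
  fun x => `[< exists s t : St, ~~ M s /\ val t = val s * x >].

Fact localization_subring : subring_closed (localization mM).
Proof.
split=> [|x y /asboolP[s [t [Ms tE]]] /asboolP[s' [t' [Ms' tE']]]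
         |x y /asboolP[s [t [Ms tE]]] /asboolP[s' [t' [Ms' tE']]]];
  apply/asboolP.
- by exists 1, 1; rewrite (max1 mM) mulr1.
- exists (s * s'), (s' * t - s * t'); rewrite max_prime // negb_or Ms Ms'.
  by split=> //; rewrite valSB !valSM tE tE'; ring.
- exists (s * s'), (t * t'); rewrite max_prime // negb_or Ms Ms'.
  by split=> //; rewrite !valSM tE tE'; ring.
Qed.
HB.instance Definition _ := GRing.isSubringClosed.Build K (localization mM)
  localization_subring.
End Localization.

Section Unramified.
Variables (F : fieldType) (V : subringClosed F) (K : splittingFieldType F).
Hypothesis hV : valuation_ring V.
Hypothesis hK : galois 1 {:K}.
Hypothesis hu : unramified_defectless V K.
Local Notation G := (gal_of {:K}).
Local Notation S := (integral_closure V K).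
Local Notation St := (subring_type S).
Local Notation Vt := (subring_type V).
Local Notation gal := (@gal_closure F V K).
Local Notation base := (@base_to_closure F V K).

(** The localization at M is a valuation ring, stated through numerators and denominators. Dividing
    the coefficients of an equation of x over F by one of least valuation puts them in V and makes
    one of them 1, hence outside M; the Horner argument then applies. *)
Lemma local_valuation (M : St -> bool) (x : K) : is_max M ->
  exists b c : St, val c = val b * x /\ (~~ M b || ~~ M c).
Proof.
move=> mM; have [p mp /rootP px0] := alg_integral x.
have [|k [pk nzk] Vk] := @valuation_max F V hV p.
  apply/hasP; exists (lead_coef p); rewrite ?lead_coef_eq0 ?monic_neq0 //.
  by rewrite lead_coefE mem_nth // prednK // size_poly_gt0 monic_neq0.
pose f (a : F) : St := insubd 0 (a / k)%:A.
have fE a : a \in (p : seq F) -> val (f a) = (a / k)%:A.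
  move=> pa; have Sa : (a / k)%:A \in S := valP (base (Sub (a / k) (Vk a pa))).
  by rewrite /f val_insubd Sa.
apply: (@horner_from_max F V K M x 0 (rev [seq f a | a <- p]) mM).
  rewrite has_rev has_map (max0 mM) /=; apply/hasP; exists k => //=.
  suff -> : f k = 1 by rewrite (max1 mM).
  by apply: val_inj; rewrite fE // divff // scale1r.
suff : forall s : seq F, {subset s <= (p : seq F)} ->
    horner_from x 0 (rev [seq f a | a <- s])
    = k^-1%:A * horner_rec [seq a%:A | a <- s] x.
  move=> /(_ p)->//; move: px0; rewrite map_polyE horner_Poly => ->.
  by rewrite mulr0.
elim=> [|a s IHs] sp; first by rewrite /horner_from /= mulr0.
rewrite /= rev_cons /horner_from -cats1 foldl_cat /= -/(horner_from _ _ _).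
rewrite IHs => [|b sb]; last by apply: sp; rewrite inE sb orbT.
rewrite fE ?sp ?inE ?eqxx // mulrDr mulrA; congr (_ + _).
by rewrite mulr_algl scalerA mulrC.
Qed.

Lemma localization_valuation (M : St -> bool) (mM : is_max M) :
  valuation_ring (localization mM).
Proof.
move=> x; have [b [c [cE /orP[Mb|Mc]]]] := local_valuation x mM.
  by left; apply/asboolP; exists b, c.
right; apply/asboolP; exists c, b; split=> //; rewrite cE.
case: (eqVneq x 0) => [x0|nzx]; last by rewrite mulfK.
case/negP: Mc; suff -> : c = 0 by exact: max0.
by apply: val_inj; rewrite cE x0 mulr0.
Qed.

Lemma localization_lies_over (M : St -> bool) (mM : is_max M) :
  lies_over V (localization mM).
Proof.
split; first exact: localization_valuation.
move=> a; apply/asboolP/idP => [[s [t [Ms tE]]]|Va]; last first.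
  exists 1, (base (Sub a Va)); rewrite (max1 mM) /=; split=> //.
  by rewrite mul1r.
case: (hV a) => // Va'; apply: contraT => nVa.
have nza : a != 0 by apply: contraNneq nVa => ->; rewrite rpred0.
have nv : nonunit (Sub a^-1 Va' : Vt).
  by rewrite /nonunit base_unitE /= invrK negb_and nVa orbT.
case/negP: Ms; suff -> : s = t * base (Sub a^-1 Va').
  by apply: maxMl => //; exact: (nonunit_max hV hK mM nv).
apply: val_inj; rewrite valSM valSv tE /= -mulrA.
by rewrite mulr_algl scalerA divff // scale1r mulr1.
Qed.

(** If g moved every s by an element of M, it would be in the inertia group of the localization at
    M: for x = t / s one has g x - x = m / (s g(s)) with m = g(t) s - t g(s) in M, while g(s) stays
    outside M. *)
Lemma inertia_trivial (M : St -> bool) (g : G) : is_max M -> g != 1%g ->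
  exists s, ~~ M (gal g s - s).
Proof.
move=> mM; apply: contraNP => /forallNP nE.
have gM s : M (gal g s - s) by apply: contrapT => /negP/nE.
have gMs s : M (gal g s) = M s.
  by rewrite -{1}(subrK s (gal g s)) max_addl.
apply/eqP; apply: (hu (localization_lies_over mM)) => x.
have /asboolP[s [t [Ms tE]]] := valP x.
have nzs : val s != 0.
  by rewrite val_eq0; apply: contraNneq Ms => ->; exact: (max0 mM).
have ngs : val (gal g s) != 0 by rewrite /= fmorph_eq0.
pose m := gal g t * s - t * gal g s.
have Mm : M m.
  have -> : m = (gal g t - t) * s - t * (gal g s - s) by rewrite /m; ring.
  by apply: maxB => //; [apply: maxMr | apply: maxMl].
have xE : val x = val t / val s by rewrite tE mulrAC divff // mul1r.
pose z := g (val x) - val x.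
have zE : val (s * gal g s) * z = val m.
  rewrite /z xE fmorph_div /m valSB !valSM !valSg.
  by field; rewrite nzs.
have Msg : ~~ M (s * gal g s) by rewrite max_prime // gMs orbb.
have Lz : z \in localization mM by apply/asboolP; exists (s * gal g s), m.
(* If z were outside a maximal ideal N, some 1 - r z would be in N; but its numerator u is outside
   M, so 1 - r z is invertible in the localization. *)
exists (Sub z Lz) => // N /maximal_is_max mN.
apply: contraT => /(max_inv mN)[r].
have /asboolP[s' [t' [Ms' tE']]] := valP r.
have uE : val (s' * (s * gal g s) - t' * m)
           = val (s' * (s * gal g s)) * (1 - val r * z).
  by rewrite valSB !valSM tE' -zE !valSM; ring.
have Mu : ~~ M (s' * (s * gal g s) - t' * m).
  apply: contra (_ : ~~ M (s' * (s * gal g s))).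
    move=> Mu; rewrite -(subrK (t' * m) (_ * _)); apply: maxD => //.
    exact: maxMl.
  by rewrite max_prime // negb_or Ms'.
set u := s' * _ - _ in uE Mu.
have nzu : val u != 0.
  by rewrite val_eq0; apply: contraNneq Mu => ->; exact: (max0 mM).
have nz1 : 1 - val r * z != 0.
  by apply: contraNneq nzu => rz; rewrite uE rz mulr0.
have Li : (1 - val r * z)^-1 \in localization mM.
  apply/asboolP; exists u, (s' * (s * gal g s)); split=> //.
  by rewrite uE mulfK.
move/(maxMl mN (Sub (1 - val r * z)^-1 Li)).
suff -> : Sub (1 - val r * z)^-1 Li * (1 - r * Sub z Lz) = 1.
  by rewrite (negPf (max1 mN)).
by apply: val_inj; rewrite rmorphM rmorphB rmorph1 rmorphM /= mulVf.
Qed.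

End Unramified.

(** * Galois coordinates and the trace *)

Section Semilocal.
Variables (F : fieldType) (V : subringClosed F) (K : splittingFieldType F).
Hypothesis hV : valuation_ring V.
Hypothesis hK : galois 1 {:K}.
Local Notation G := (gal_of {:K}).
Local Notation S := (integral_closure V K).
Local Notation St := (subring_type S).
Local Notation Vt := (subring_type V).
Local Notation gal := (@gal_closure F V K).
Local Notation base := (@base_to_closure F V K).
Variable M0 : St -> bool.
Hypothesis mM0 : is_max M0.

Lemma gcompV (g h : G) : gcomp (gcomp g h) h^-1%g = g.
Proof. by rewrite /gcomp mulKg. Qed.
Lemma gcompVK (g h : G) : gcomp (gcomp g h^-1%g) h = g.
Proof. by rewrite /gcomp mulKVg. Qed.
Lemma gcompKV (g h : G) : gcomp g (gcomp g^-1%g h) = h.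
Proof. by rewrite /gcomp mulgKV. Qed.
Lemma gcompK (g h : G) : gcomp g^-1%g (gcomp g h) = h.
Proof. by rewrite /gcomp mulgK. Qed.
Lemma gcompA (g h k : G) : gcomp g (gcomp h k) = gcomp (gcomp g h) k.
Proof. by rewrite /gcomp mulgA. Qed.
Lemma gcomp1g (g : G) : gcomp 1%g g = g. Proof. exact: mulg1. Qed.
Lemma gcompg1 (g : G) : gcomp g 1%g = g. Proof. exact: mul1g. Qed.
Lemma gcompgV (g : G) : gcomp g g^-1%g = 1%g. Proof. exact: mulVg. Qed.
Lemma gcompVg (g : G) : gcomp g^-1%g g = 1%g. Proof. exact: mulgV. Qed.

Lemma gal_closureK g : cancel (gal g) (gal g^-1%g).
Proof. by move=> s; rewrite -gal_closureM gcompVg gal_closure1. Qed.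
Lemma gal_closureKV g : cancel (gal g^-1%g) (gal g).
Proof. by move=> s; rewrite -gal_closureM gcompgV gal_closure1. Qed.

Lemma conj_max g : is_max (fun s => M0 (gal g s)).
Proof.
split=> [|x y Mx My|r x Mx||x /(max_inv mM0)[r Mr]].
- by rewrite rmorph0 (max0 mM0).
- by rewrite rmorphD (maxD mM0).
- by rewrite rmorphM (maxMl mM0).
- by rewrite rmorph1 (max1 mM0).
- by exists (gal g^-1%g r); rewrite rmorphB rmorph1 rmorphM /= gal_closureKV.
Qed.

Lemma norm_base (n : St) : exists v, base v = \prod_g gal g n.
Proof.
apply: (fixed_base hV hK) => h; rewrite rmorph_prod [RHS](reindex_inj (mulIg h)).
by apply: eq_bigr => g _; rewrite /= -gal_closureM.
Qed.

Lemma trace_base (n : St) : exists v, base v = \sum_g gal g n.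
Proof.
apply: (fixed_base hV hK) => h; rewrite rmorph_sum [RHS](reindex_inj (mulIg h)).
by apply: eq_bigr => g _; rewrite /= -gal_closureM.
Qed.

Lemma base_max v : M0 (base v) = nonunit v.
Proof.
apply/idP/idP=> [Mv|]; last exact: (nonunit_max hV hK mM0).
apply: contraT; rewrite negbK => Uv; move/(maxMl mM0 (base v^-1)): Mv.
by rewrite -rmorphM mulVr // rmorph1 (negPf (max1 mM0)).
Qed.

(** Choose a_g in A with g(1 - a_g) in M0. Then n = 1 - prod (1 - a_g) lies in A and outside every
    conjugate, so its norm, an element of V outside M0, is a unit; and the norm is a multiple of n.
    This is the passage from local to global used below. *)
Lemma ideal_unit (A : St -> Prop) :
    (forall x y, A x -> A y -> A (x + y)) -> (forall r x, A x -> A (r * x)) ->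
  (forall g, exists2 s, A s & ~~ M0 (gal g s)) -> A 1.
Proof.
move=> AD AM AE.
have /fin_all_exists2[a Aa Ma] g : exists2 a, A a & M0 (gal g (1 - a)).
  have [s As /(max_inv mM0)[r Mr]] := AE g.
  exists (gal g^-1%g r * s); first exact: AM.
  by rewrite rmorphB rmorph1 rmorphM /= gal_closureKV.
pose n := 1 - \prod_g (1 - a g).
have An : A n.
  have A0 : A 0 by rewrite -(mul0r (a 1%g)); apply: AM.
  suff [y Ay yE] : exists2 y, A y & \prod_g (1 - a g) = 1 - y.
    by rewrite /n yE subKr.
  elim/big_rec: _ => [|g y _ [z Az ->]]; first by exists 0; rewrite ?subr0.
  exists (a g + (1 - a g) * z); first by apply: AD => //; apply: AM.
  ring.
have Mn g : ~~ M0 (gal g n).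
  rewrite rmorphB rmorph1; apply/negP=> M1.
  case/negP: (max1 mM0); rewrite -(subrK (gal g (\prod_h (1 - a h))) 1).
  apply: maxD => //; rewrite (bigD1 g) //= rmorphM; apply: maxMr => //.
  exact: Ma.
have [v vE] := norm_base n.
have Uv : v \is a GRing.unit.
  apply: contraT; rewrite -/(nonunit v) -base_max vE => M.
  by have := max_prod (index_enum G) mM0 Mn; rewrite M.
have : A (base v^-1 * base v).
  apply: (AM); rewrite vE (bigD1 1%g) //= mulrC gal_closure1; exact: AM.
by rewrite -rmorphM mulVr // rmorph1.
Qed.

Lemma notin_conj (g : G) (Q : pred G) :
  (forall h, Q h -> exists2 s, M0 (gal h s) & ~~ M0 (gal g s)) ->
  exists2 e, ~~ M0 (gal g e) & forall h, Q h -> M0 (gal h e).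
Proof.
move=> QE.
have /fin_all_exists2[s sE Ms] h : exists2 s, Q h -> M0 (gal h s) & ~~ M0 (gal g s).
  case: (boolP (Q h)) => [/QE[s ? ?]|_]; first by exists s.
  by exists 1; rewrite ?rmorph1 ?(max1 mM0).
exists (\prod_h s h); first by rewrite rmorph_prod; apply: max_prod.
move=> h Qh; rewrite (bigD1 h) //= rmorphM; apply: maxMr => //; exact: sE.
Qed.

Lemma conj_notin_sub (g h : G) s : M0 (gal h s) -> ~~ M0 (gal g s) ->
  exists2 s, M0 (gal g s) & ~~ M0 (gal h s).
Proof.
move=> Mh /(max_inv mM0)[r Mr]; exists (1 - gal g^-1%g r * s).
  by rewrite rmorphB rmorph1 rmorphM /= gal_closureKV.
rewrite rmorphB rmorph1 rmorphM /=.
apply/negP=> M1; case/negP: (max1 mM0).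
rewrite -(subrK (gal h (gal g^-1%g r) * gal h s) 1); apply: maxD => //.
exact: maxMl.
Qed.

(** The factor e is taken outside the conjugate at g and inside all conjugates that miss m, so that
    nothing changes locally at g. *)
Lemma to_jacobson (g : G) m : M0 (gal g m) ->
  exists2 e, ~~ M0 (gal g e) & forall h, M0 (gal h (e * m)).
Proof.
move=> Mm; have [|e Me Qe] := @notin_conj g (fun h => ~~ M0 (gal h m)).
  by move=> h Mh; apply: conj_notin_sub Mm Mh.
exists e => // h; rewrite rmorphM max_prime //=.
by case: (boolP (M0 (gal h m))) => [_|/Qe->]; rewrite ?orbT.
Qed.

Hypothesis hu : unramified_defectless V K.

Lemma coords_one (g : G) : g != 1%g ->
  exists l : seq (St * St), \sum_(p <- l) p.1 * p.2 = 1
                            /\ \sum_(p <- l) p.1 * gal g p.2 = 0.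
Proof.
move=> ng; pose A s := exists l : seq (St * St),
  s = \sum_(p <- l) p.1 * (gal g p.2 - p.2).
have [||h|l l1] := @ideal_unit A.
- by move=> _ _ [l ->] [l' ->]; exists (l ++ l'); rewrite big_cat.
- move=> r _ [l ->]; exists [seq (r * p.1, p.2) | p <- l].
  by rewrite big_map mulr_sumr; apply: eq_bigr => p _; rewrite mulrA.
- have [s Ms] := inertia_trivial hV hK hu (conj_max h) ng.
  by exists (gal g s - s) => //; exists [:: (1, s)]; rewrite big_seq1 mul1r.
(* From 1 = sum a_i (g(b_i) - b_i), the pairs (-a_i, b_i) have sums 1 - a without g and -a with g;
   the extra pair (a, 1) corrects both. *)
pose a := \sum_(p <- l) p.1 * gal g p.2.
exists ((a, 1) :: [seq (- p.1, p.2) | p <- l]).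
rewrite !big_cons !big_map /= rmorph1 mulr1; split.
  rewrite l1 /a -big_split /=; apply: eq_bigr => p _; ring.
by rewrite /a -big_split big1 //= => p _; ring.
Qed.

(** Taking all pairwise products of two families multiplies their sums for every g. Combining the
    families of [coords_one] over all g != 1 thus gives 0 at each of them and 1 at the identity. *)
Lemma galois_coordinates : exists l : seq (St * St),
  forall g, \sum_(p <- l) p.1 * gal g p.2 = (g == 1%g)%:R.
Proof.
suff [l [l1 lg]] : exists l : seq (St * St), \sum_(p <- l) p.1 * p.2 = 1 /\
    forall g, g \in index_enum G -> g != 1%g -> \sum_(p <- l) p.1 * gal g p.2 = 0.
  exists l => g; case: eqVneq => [->|ng]; last by rewrite lg ?mem_index_enum.
  by rewrite -[RHS]l1; apply: eq_bigr => p _; rewrite gal_closure1.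
elim: (index_enum G) => [|h s [l [l1 lg]]].
  by exists [:: (1, 1)]; rewrite big_seq1 mulr1.
case: (eqVneq h 1%g) => [->|nh].
  exists l; split=> // g; rewrite inE => /predU1P[->|]; first by rewrite eqxx.
  exact: lg.
have [l' [l'1 l'h]] := coords_one nh.
have prodE (g : G) : \sum_(p <- [seq (p.1 * q.1, p.2 * q.2) | p <- l, q <- l'])
    p.1 * gal g p.2
    = (\sum_(p <- l) p.1 * gal g p.2) * (\sum_(p <- l') p.1 * gal g p.2).
  rewrite big_allpairs_dep /= mulr_suml; apply: eq_bigr => p _.
  by rewrite mulr_sumr; apply: eq_bigr => q _; rewrite rmorphM /=; ring.
exists [seq (p.1 * q.1, p.2 * q.2) | p <- l, q <- l']; split.
  have := prodE 1%g; under eq_bigr do rewrite gal_closure1.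
  move=> ->; under eq_bigr do rewrite gal_closure1.
  by under [X in _ * X]eq_bigr do rewrite gal_closure1; rewrite l1 l'1 mulr1.
move=> g; rewrite inE prodE => /predU1P[->|gs] ng; first by rewrite l'h mulr0.
by rewrite lg // mul0r.
Qed.

End Semilocal.

Section Trace.
Variables (F : fieldType) (V : subringClosed F) (K : splittingFieldType F).
Hypothesis hV : valuation_ring V.
Hypothesis hK : galois 1 {:K}.
Local Notation G := (gal_of {:K}).
Local Notation S := (integral_closure V K).
Local Notation St := (subring_type S).
Local Notation Vt := (subring_type V).
Local Notation gal := (@gal_closure F V K).
Local Notation base := (@base_to_closure F V K).

Definition trace (s : St) : Vt := sval (cid (trace_base hV hK s)).

Lemma traceE s : base (trace s) = \sum_g gal g s.
Proof. exact: (svalP (cid (trace_base hV hK s))). Qed.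

Lemma traceD s t : trace (s + t) = trace s + trace t.
Proof.
apply: (@base_inj F V K); rewrite rmorphD /= !traceE -big_split.
by apply: eq_bigr => g _; rewrite rmorphD.
Qed.

Lemma traceZ v s : trace (base v * s) = v * trace s.
Proof.
apply: (@base_inj F V K); rewrite rmorphM /= !traceE mulr_sumr.
by apply: eq_bigr => g _; rewrite rmorphM /= gal_closure_base.
Qed.

Variable l : seq (St * St).
Hypothesis hl : forall g, \sum_(p <- l) p.1 * gal g p.2 = (g == 1%g)%:R.

Lemma coords_dual g : \sum_(p <- l) gal g p.1 * p.2 = (g == 1%g)%:R.
Proof.
rewrite -[RHS](gal_closureKV g) rmorph_nat -invg_eq1 -hl rmorph_sum.
by apply: eq_bigr => p _; rewrite rmorphM /= gal_closureKV.
Qed.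

(** The two components of [l] are dual generating families for the trace form. *)
Lemma trace_dual s : s = \sum_(p <- l) p.1 * base (trace (p.2 * s)).
Proof.
under eq_bigr do rewrite traceE mulr_sumr; rewrite exchange_big /=.
under eq_bigr => g _ do under eq_bigr do rewrite rmorphM mulrA.
under eq_bigr do rewrite -mulr_suml hl.
rewrite (bigD1 1%g) //= big1 ?eqxx ?mul1r ?gal_closure1 ?addr0 //.
by move=> g /negPf->; rewrite mul0r.
Qed.

Lemma trace_dual' s : s = \sum_(p <- l) base (trace (s * p.1)) * p.2.
Proof.
under eq_bigr do rewrite traceE mulr_suml; rewrite exchange_big /=.
under eq_bigr => g _ do under eq_bigr do rewrite rmorphM -mulrA.
under eq_bigr do rewrite -mulr_sumr coords_dual.
rewrite (bigD1 1%g) //= big1 ?eqxx ?mulr1 ?gal_closure1 ?addr0 //.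
by move=> g /negPf->; rewrite mulr0.
Qed.

(** The Casimir element sum a_i (x) b_i of S over V commutes with S; b is any V-balanced map, so no
    tensor product is formed. Expand s a_p on the a_q, move the coefficients, which lie in V, to the
    right, and sum over p. *)
Lemma casimir (T : nmodType) (b : St -> St -> T) s :
    (forall x y z, b (x + y) z = b x z + b y z) ->
    (forall x y z, b x (y + z) = b x y + b x z) ->
    (forall z, b 0 z = 0) -> (forall z, b z 0 = 0) ->
    (forall v x y, b (x * base v) y = b x (base v * y)) ->
  \sum_(p <- l) b (s * p.1) p.2 = \sum_(p <- l) b p.1 (p.2 * s).
Proof.
move=> bDl bDr b0l b0r bZ.
have b_suml (r : seq (St * St)) (E : St * St -> St) z :
    b (\sum_(p <- r) E p) z = \sum_(p <- r) b (E p) z.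
  by elim: r => [|p r IHr]; rewrite ?big_nil // !big_cons bDl IHr.
have b_sumr (r : seq (St * St)) (E : St * St -> St) z :
    b z (\sum_(p <- r) E p) = \sum_(p <- r) b z (E p).
  by elim: r => [|p r IHr]; rewrite ?big_nil // !big_cons bDr IHr.
transitivity (\sum_(p <- l) \sum_(q <- l) b q.1 (base (trace (q.2 * (s * p.1))) * p.2)).
  apply: eq_bigr => p _; rewrite {1}(trace_dual (s * p.1)) b_suml.
  by apply: eq_bigr => q _; rewrite bZ.
rewrite exchange_big /=; apply: eq_bigr => q _.
rewrite -b_sumr; congr (b _ _); rewrite [RHS]trace_dual'.
by apply: eq_bigr => p _; rewrite mulrA.
Qed.

Variable M0 : St -> bool.
Hypothesis mM0 : is_max M0.

Lemma jacobson_trace s t : (forall g, M0 (gal g s)) -> nonunit (trace (t * s)).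
Proof.
move=> Ms; rewrite -(base_max hV hK mM0) traceE; apply: max_sum => // g _.
by rewrite rmorphM; apply: (maxMl mM0 _ (Ms g)).
Qed.

(** Unramifiedness in local form: at g the maximal ideal is generated by nonunits of V. Once e m
    lies in all conjugates, the traces of its multiples are nonunits, and these are its coordinates
    on [l]. *)
Lemma uniformizer g m : M0 (gal g m) ->
  exists2 e, ~~ M0 (gal g e) & exists v : St * St -> Vt,
    (forall p, nonunit (v p)) /\ e * m = \sum_(p <- l) p.1 * base (v p).
Proof.
move=> /(to_jacobson mM0)[e Me Mem]; exists e => //.
exists (fun p => trace (p.2 * (e * m))); split; last exact: trace_dual.
by move=> p; apply: (jacobson_trace _ Mem).
Qed.

End Trace.

(** * Modules over a valuation ring *)

Section Combinations.
Variables (A : pzRingType) (N : lmodType A).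
Implicit Types (e s : seq N) (v w : nat -> A).

(** Coefficients are indexed by all naturals and ignored past the end of the list, so that lists can
    be extended and concatenated without casts. *)
Definition lincomb v e := \sum_(j < size e) v j *: e`_j.
Definition spans e m := exists v, m = lincomb v e.

Lemma lincomb_nil v : lincomb v [::] = 0. Proof. exact: big_ord0. Qed.

Lemma lincomb_cons v x e :
  lincomb v (x :: e) = v 0%N *: x + lincomb (fun j => v j.+1) e.
Proof. by rewrite /lincomb /= big_ord_recl. Qed.

Lemma lincombD v w e : lincomb (fun j => v j + w j) e = lincomb v e + lincomb w e.
Proof. by rewrite -big_split; apply: eq_bigr => j _; rewrite scalerDl. Qed.

Lemma lincombZ a v e : lincomb (fun j => a * v j) e = a *: lincomb v e.
Proof. by rewrite scaler_sumr; apply: eq_bigr => j _; rewrite scalerA. Qed.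

Lemma lincombN v e : lincomb (fun j => - v j) e = - lincomb v e.
Proof. by rewrite -sumrN; apply: eq_bigr => j _; rewrite scaleNr. Qed.

Lemma lincomb0 e : lincomb (fun=> 0) e = 0.
Proof. by rewrite /lincomb big1 // => j _; rewrite scale0r. Qed.

Lemma lincomb_cat v e e' :
  lincomb v (e ++ e') = lincomb v e + lincomb (fun j => v (size e + j)%N) e'.
Proof.
elim: e v => [|x e IHe] v; first by rewrite lincomb_nil add0r.
by rewrite cat_cons !lincomb_cons IHe addrA.
Qed.

Lemma spansD e m m' : spans e m -> spans e m' -> spans e (m + m').
Proof. by move=> [v ->] [w ->]; eexists; rewrite -lincombD. Qed.
Lemma spansZ e a m : spans e m -> spans e (a *: m).
Proof. by move=> [v ->]; eexists; rewrite -lincombZ. Qed.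
Lemma spans0 e : spans e 0.
Proof. by exists (fun=> 0); rewrite lincomb0. Qed.
Lemma spans_head x e : spans (x :: e) x.
Proof.
exists (fun j => if j is _.+1 then 0 else 1).
by rewrite lincomb_cons scale1r lincomb0 addr0.
Qed.
Lemma spans_cons x e m : spans e m -> spans (x :: e) m.
Proof.
move=> [v ->]; exists (fun j => if j is j'.+1 then v j' else 0).
by rewrite lincomb_cons scale0r add0r.
Qed.
Lemma spans_mem e m : m \in e -> spans e m.
Proof.
elim: e => // x e IHe; rewrite inE => /predU1P[->|/IHe]; last exact: spans_cons.
exact: spans_head.
Qed.
Lemma spans_closed (J : N -> Prop) e m : J 0 ->
    (forall x y, J x -> J y -> J (x + y)) -> (forall a x, J x -> J (a *: x)) ->
  (forall x, x \in e -> J x) -> spans e m -> J m.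
Proof.
move=> J0 JD JZ Je [v ->]; rewrite /lincomb; elim/big_rec: _ => // j x _ Jx.
by apply: JD => //; apply: JZ; apply: Je; rewrite mem_nth.
Qed.
Lemma spans_trans e e' m :
  (forall x, x \in e -> spans e' x) -> spans e m -> spans e' m.
Proof.
move=> ee'; apply: spans_closed => //; [exact: spans0 | exact: spansD|].
by move=> a x; apply: spansZ.
Qed.
Lemma spans_sum (I : Type) (r : seq I) (Q : pred I) (E : I -> N) e :
  (forall k, Q k -> spans e (E k)) -> spans e (\sum_(k <- r | Q k) E k).
Proof.
by move=> eE; elim/big_ind: _ => //; [exact: spans0 | exact: spansD].
Qed.
End Combinations.

Section BaseModules.
Variables (F : fieldType) (V : subringClosed F).
Hypothesis hV : valuation_ring V.
Local Notation Vt := (subring_type V).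
Variable N : lmodType Vt.
Implicit Types (e s : seq N) (v : nat -> Vt) (w a : Vt).

(** This is all of J(V)N: over a valuation ring a sum of multiples by nonunits is a single such
    multiple. *)
Definition radical_elt (m : N) := exists2 w : Vt, nonunit w & exists m', m = w *: m'.

(** N / J is a vector space over V / J(V), and e is a sublist of s that becomes a basis of the span
    of s in it. *)
Lemma extract_basis (J : N -> Prop) s :
    (forall x y, J x -> J y -> J (x + y)) -> (forall a x, J x -> J (a *: x)) ->
    (forall w m, nonunit w -> J (w *: m)) ->
  exists e, [/\ {subset e <= s},
    forall m, m \in s -> exists v, J (m - lincomb v e) &
    forall v, J (lincomb v e) -> forall j, (j < size e)%N -> nonunit (v j)].
Proof.
move=> JD JZ JV.
have J0 : J 0 by rewrite -(scale0r (0 : N)); apply: JV; exact: nonunit0.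
elim: s => [|x s [e [es se eJ]]]; first by exists [::].
case: (pselect (exists v, J (x - lincomb v e))) => [xe|nxe].
  exists e; split=> // m; first by rewrite inE orbC => /es->.
  by rewrite inE => /predU1P[->|/se].
exists (x :: e); split.
- move=> m; rewrite inE => /predU1P[->|/es sm]; first exact: mem_head.
  by rewrite inE sm orbT.
- move=> m; rewrite inE => /predU1P[->|/se[v Jv]].
    exists (fun j => if j is _.+1 then 0 else 1).
    by rewrite lincomb_cons scale1r lincomb0 addr0 subrr.
  exists (fun j => if j is j'.+1 then v j' else 0).
  by rewrite lincomb_cons scale0r add0r.
- move=> v; rewrite lincomb_cons => Jv.
  have nv0 : nonunit (v 0%N).
    apply: contraT; rewrite negbK => Uv; case: nxe.
    exists (fun j => - ((v 0%N)^-1 * v j.+1)).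
    rewrite lincombN opprK lincombZ -{1}[x]scale1r -(mulVr Uv) -scalerA -scalerDr.
    exact: JZ.
  case=> [|j] //=; apply: (eJ (fun j => v j.+1)).
  rewrite -(addKr (v 0%N *: x) (lincomb _ _)) -scaleNr; apply: JD => //.
  by apply: JV; rewrite -mulN1r nonunitMl.
Qed.

(** The elements of s are discarded one at a time. If x = w m' modulo the span of e with w a
    nonunit, expanding m' on all generators and isolating x leaves the invertible factor 1 - w
    v_0. *)
Lemma nakayama s e : (forall m, spans (s ++ e) m) ->
    (forall m, exists2 m', radical_elt m' & spans e (m - m')) ->
  forall m, spans e m.
Proof.
elim: s => // x s IHs se me; apply: (IHs) => // m.
apply: spans_trans (se m) => y; rewrite cat_cons inE => /predU1P[->{y}|]; last first.
  exact: spans_mem.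
have [_ [w nw [m' ->]] xe] := me x.
have [v m'E] := se m'; rewrite cat_cons lincomb_cons in m'E.
have U : 1 - w * v 0%N \is a GRing.unit.
  by apply: nonunit1B => //; rewrite mulrC nonunitMl.
rewrite -[x]scale1r -(mulVr U) -scalerA; apply: spansZ.
have -> : (1 - w * v 0%N) *: x = (x - w *: m') + w *: lincomb (fun j => v j.+1) (s ++ e).
  by rewrite m'E scalerDr opprD addrA addrNK scalerBl scale1r scalerA.
apply: spansD; last by apply: spansZ; eexists.
by apply: spans_trans xe => z ez; apply: spans_mem; rewrite mem_cat ez orbT.
Qed.

Lemma radicalD m m' : radical_elt m -> radical_elt m' -> radical_elt (m + m').
Proof.
move=> [v nv [x ->]] [w nw [y ->]]; have [[u uE]|[u uE]] := base_div hV v w.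
  by exists w => //; exists (u *: x + y); rewrite uE mulrC -scalerA -scalerDr.
by exists v => //; exists (x + u *: y); rewrite uE mulrC -scalerA -scalerDr.
Qed.

Lemma radicalZ a m : radical_elt m -> radical_elt (a *: m).
Proof.
move=> [v nv [x ->]]; exists v => //; exists (a *: x).
by rewrite !scalerA mulrC.
Qed.

(** e1 lifts a basis of N / J and e2 one of J / J(V)N, so together they give a basis of N / J(V)N
    and span N by Nakayama. On J the coordinates along e1 are nonunits, which later permits dividing
    them by pi. *)
Lemma adapted_basis (J : N -> Prop) s sJ :
    (forall x y, J x -> J y -> J (x + y)) -> (forall a x, J x -> J (a *: x)) ->
    (forall w m, nonunit w -> J (w *: m)) ->
    (forall m, spans s m) -> (forall m, m \in sJ -> J m) ->
    (forall m, J m -> spans sJ m) ->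
  exists e1 e2, [/\ forall m, spans (e1 ++ e2) m, forall m, m \in e2 -> J m,
    forall v, J (lincomb v e1) -> forall j, (j < size e1)%N -> nonunit (v j) &
    forall v, radical_elt (lincomb v (e1 ++ e2)) ->
      forall j, (j < size (e1 ++ e2))%N -> nonunit (v j)].
Proof.
move=> JD JZ JV ss sJJ JsJ.
have J0 : J 0 by rewrite -(scale0r (0 : N)); apply: JV; exact: nonunit0.
have radJ m : radical_elt m -> J m by case=> w nw [m' ->]; exact: JV.
have [e1 [_ se1 e1J]] := extract_basis s JD JZ JV.
have [|e2 [e2s se2 e2J]] := extract_basis sJ radicalD radicalZ.
  by move=> w m nw; exists w => //; exists m.
have Je2 m : m \in e2 -> J m by move=> /e2s/sJJ.
exists e1, e2; split=> //.
- apply: (@nakayama s) => m.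
    by apply: spans_trans (ss m) => x sx; apply: spans_mem; rewrite mem_cat sx.
  apply: (@spans_closed _ _
    (fun m => exists2 m', radical_elt m' & spans (e1 ++ e2) (m - m')) s) (ss m).
  + exists 0; first by exists 0; [exact: nonunit0 | exists 0; rewrite scaler0].
    by rewrite subr0; exact: spans0.
  + move=> x y [x' rx xe] [y' ry ye]; exists (x' + y'); first exact: radicalD.
    by rewrite opprD addrACA; apply: spansD.
  + move=> a x [x' rx xe]; exists (a *: x'); first exact: radicalZ.
    by rewrite -scalerBr; apply: spansZ.
  + move=> x /se1[v Jx].
    have [x' rx xe] : exists2 x', radical_elt x' & spans e2 (x - lincomb v e1 - x').
      apply: (@spans_closed _ _
        (fun m => exists2 m', radical_elt m' & spans e2 (m - m')) sJ) (JsJ _ Jx).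
      * exists 0; first by exists 0; [exact: nonunit0 | exists 0; rewrite scaler0].
        by rewrite subr0; exact: spans0.
      * move=> x1 y [x' rx xe] [y' ry ye]; exists (x' + y'); first exact: radicalD.
        by rewrite opprD addrACA; apply: spansD.
      * move=> a x1 [x' rx xe]; exists (a *: x'); first exact: radicalZ.
        by rewrite -scalerBr; apply: spansZ.
      * move=> y /se2[w wy]; exists (y - lincomb w e2) => //.
        by rewrite subKr; exists w.
    exists x' => //.
    have -> : x - x' = x - lincomb v e1 - x' + lincomb v e1.
      by rewrite addrAC subrK.
    apply: spansD.
      by apply: spans_trans xe => z ez; apply: spans_mem; rewrite mem_cat ez orbT.
    by apply: (@spans_trans _ _ e1);
      [move=> z ez; apply: spans_mem; rewrite mem_cat ez | exists v].
- move=> v rv.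
  have nv1 j : (j < size e1)%N -> nonunit (v j).
    apply: e1J; rewrite -(addrK (lincomb (fun j => v (size e1 + j)%N) e2) (lincomb v e1)).
    rewrite -lincomb_cat; apply: (JD); first exact: radJ.
    by rewrite -lincombN; apply: (@spans_closed _ _ J e2) => //; eexists.
  move=> j; rewrite size_cat => je; case: (ltnP j (size e1)) => [/nv1//|je1].
  rewrite -(subnKC je1); apply: (e2J (fun j => v (size e1 + j)%N)); last first.
    by rewrite ltn_subLR.
  rewrite -(addKr (lincomb v e1) (lincomb _ e2)) -lincomb_cat.
  apply: radicalD => //; rewrite -lincombN /lincomb.
  elim/big_rec: _ => [|i x _ rx].
    by exists 0; [exact: nonunit0 | exists 0; rewrite scaler0].
  apply: radicalD => //; exists (- v i); last by exists e1`_i.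
  by rewrite -mulN1r nonunitMl ?nv1.
Qed.

Section Basis.
Variable e : seq N.
Hypothesis e_spans : forall m, spans e m.
Hypothesis e_free : forall v, radical_elt (lincomb v e) ->
  forall j, (j < size e)%N -> nonunit (v j).

Hypothesis N_tf : forall a (m : N), a != 0 -> a *: m = 0 -> m = 0.

Lemma radical0 : radical_elt 0.
Proof. by exists 0; [exact: nonunit0 | exists 0; rewrite scaler0]. Qed.

(** Division by an entry of least valuation makes a row primitive; its entry 1 is what contradicts
    independence modulo the radical. *)
Lemma scale_to_base n (x : 'rV[F]_n) : x != 0 ->
  exists k : F, k != 0 /\ exists v : nat -> Vt,
    (forall j : 'I_n, val (v j) = k * x 0 j) /\
    (exists j : 'I_n, v j = 1 /\ k = (x 0 j)^-1).
Proof.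
move=> nzx; have [|k [/mapP[j _ kE] nzk] Vk] :=
    valuation_max hV (l := [seq x 0 j | j <- enum 'I_n]).
  case/rV0Pn: nzx => j xj; apply/hasP; exists (x 0 j) => //.
  by apply: map_f; rewrite mem_enum.
exists k^-1; rewrite invr_eq0; split=> //.
pose v i : Vt := if insub i is Some j then insubd 0 (x 0 j / k) else 0.
have vE i : val (v (val i)) = x 0 i / k.
  rewrite /v valK val_insubd Vk //; apply: map_f; exact: mem_enum.
exists v; split=> [i|]; first by rewrite vE mulrC.
exists j; split; last by rewrite kE.
by apply: val_inj; rewrite vE -kE divff.
Qed.

Lemma lincomb_free v : lincomb v e = 0 -> forall j, (j < size e)%N -> v j = 0.
Proof.
move=> v0 j je; apply/eqP; apply: contraT => nzv.
pose x := \row_(i < size e) val (v i).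
have [|k [nzk [w [wE [i [wi _]]]]]] := @scale_to_base _ x.
  apply/rV0Pn; exists (Ordinal je); rewrite mxE /=.
  by apply: contraNneq nzv => vj; apply/eqP/val_inj.
have vkE (i' : 'I_(size e)) : v i' = v i * w i'.
  have nzvi : val (v i) != 0.
    apply/eqP => vi; have /eqP := wE i; rewrite wi mxE vi mulr0.
    by rewrite (oner_eq0 F).
  apply: val_inj; have := wE i; rewrite wi mxE => k1.
  rewrite [RHS]/= -/(val (v i)) -/(val (w i')) wE mxE mulrCA mulrA -k1.
  by rewrite /= mul1r.
have vi0 : v i != 0.
  apply: contraNneq nzv => vi; rewrite -[j]/(val (Ordinal je)) vkE vi mul0r.
  by [].
have we : lincomb w e = 0.
  apply: (N_tf vi0); rewrite -lincombZ -[RHS]v0.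
  by apply: eq_bigr => i' _; rewrite (vkE i').
have := e_free (v := w); rewrite we => /(_ radical0 i (ltn_ord i)).
by rewrite wi /nonunit unitr1.
Qed.

Definition bcoord (m : N) : nat -> Vt := sval (cid (e_spans m)).

Lemma bcoordE m : lincomb (bcoord m) e = m.
Proof. by rewrite -(svalP (cid (e_spans m))). Qed.

Lemma bcoord_uniq v m j : lincomb v e = m -> (j < size e)%N -> bcoord m j = v j.
Proof.
move=> vm je; apply/eqP; rewrite -subr_eq0; apply/eqP.
apply: (@lincomb_free (fun j => bcoord m j - v j)) => //.
by rewrite lincombD lincombN bcoordE vm subrr.
Qed.

Lemma bcoordD m m' j : (j < size e)%N -> bcoord (m + m') j = bcoord m j + bcoord m' j.
Proof.
move=> je; apply: (@bcoord_uniq (fun j => bcoord m j + bcoord m' j)) => //.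
by rewrite lincombD !bcoordE.
Qed.

Lemma bcoordZ a m j : (j < size e)%N -> bcoord (a *: m) j = a * bcoord m j.
Proof.
move=> je; apply: (@bcoord_uniq (fun j => a * bcoord m j)) => //.
by rewrite lincombZ bcoordE.
Qed.

Variable t : N -> N.
Hypothesis tD : forall x y, t (x + y) = t x + t y.
Hypothesis tZ : forall a x, t (a *: x) = a *: t x.
Hypothesis t_rad : forall m, radical_elt (t m) -> radical_elt m.

(** Injectivity modulo the radical makes the matrix of t invertible over V. Both halves produce a
    primitive row with radical image: from a kernel row if T is singular over F, and from a preimage
    with an entry outside V otherwise. *)
Lemma radical_injective_bijective : bijective t.
Proof.
pose n := size e.
pose T : 'M[F]_n := \matrix_(i, j) val (bcoord (t e`_i) j).
have t0 : t 0 = 0 by rewrite -[X in t X](scale0r 0) tZ scale0r.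
have t_lc v (u : nat -> Vt) :
    \row_j val (u (val j)) = \row_(j < n) val (v (val j)) *m T ->
  t (lincomb v e) = lincomb u e.
  move=> /rowP uE.
  have -> : t (lincomb v e) = \sum_(i < n) v i *: t e`_i.
    rewrite /lincomb; elim/big_rec2: _ => // i y1 y2 _ <-.
    by rewrite tD tZ.
  have -> : \sum_(i < n) v i *: t e`_i
      = \sum_(i < n) \sum_(j < n) (v i * bcoord (t e`_i) j) *: e`_j.
    apply: eq_bigr => i _; rewrite -{1}(bcoordE (t e`_i)) scaler_sumr.
    by apply: eq_bigr => j _; rewrite scalerA.
  rewrite exchange_big /=; apply: eq_bigr => j _; rewrite -scaler_suml.
  congr (_ *: _); apply: val_inj; rewrite rmorph_sum /=.
  have := uE j; rewrite !mxE /= => ->; apply: eq_bigr => i _.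
  by rewrite !mxE.
have unit_contra v (j : 'I_n) : v j = 1 -> ~ radical_elt (t (lincomb v e)).
  move=> vj /t_rad/e_free/(_ j (ltn_ord j)).
  by rewrite vj /nonunit unitr1.
have rowE (v : nat -> Vt) (x : 'rV[F]_n) k :
    (forall j : 'I_n, val (v j) = k * x 0 j) -> \row_(j < n) val (v (val j)) = k *: x.
  by move=> vE; apply/rowP=> j; rewrite !mxE vE.
have Tu : T \in unitmx.
  rewrite -row_free_unit; apply: inj_row_free => x xT; apply/eqP.
  apply: contraT => /scale_to_base[k [nzk [v [vE [j [vj _]]]]]].
  exfalso; apply: (unit_contra v j vj).
  rewrite (t_lc v (fun=> 0)); first by rewrite lincomb0; exact: radical0.
  by rewrite (rowE _ _ _ vE) -scalemxAl xT scaler0; apply/rowP=> i; rewrite !mxE.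
have T_inv (w : nat -> Vt) : exists v : nat -> Vt, t (lincomb v e) = lincomb w e.
  pose x := \row_(j < n) val (w j) *m invmx T.
  case: (pselect (forall j, x 0 j \in V)) => [Vx|nVx].
    pose v i : Vt := if insub i is Some j then insubd 0 (x 0 j) else 0.
    have vE (j : 'I_n) : val (v (val j)) = 1 * x 0 j.
      by rewrite /v valK val_insubd Vx mul1r.
    exists v; apply: t_lc; rewrite (rowE _ _ _ vE) scale1r.
    by rewrite mulmxKV.
  (* The scaling factor k is a nonunit of V: otherwise x_j = k^-1 would lie in V, and so would every
     x_i = x_j (k x_i). The primitive row k x then maps to k w, which is radical. *)
  have [|k [nzk [v [vE [j [vj kE]]]]]] := @scale_to_base _ x.
    apply/eqP => x0; apply: nVx => j; rewrite x0 mxE; exact: rpred0.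
  exfalso; apply: (unit_contra v j vj).
  have Vk : k \in V.
    rewrite kE; case: (hV (x 0 j)) => // Vxj; exfalso; apply: nVx => i.
    have -> : x 0 i = x 0 j * (k * x 0 i).
      by rewrite kE mulVKf // -invr_eq0 -kE.
    by rewrite -vE rpredM //; exact: valP.
  have nk : nonunit (Sub k Vk : Vt).
    rewrite /nonunit base_unitE /= nzk kE invrK; apply/negP => Vxj; apply: nVx => i.
    have -> : x 0 i = x 0 j * (k * x 0 i).
      by rewrite kE mulVKf // -invr_eq0 -kE.
    by rewrite -vE rpredM //; exact: valP.
  exists (Sub k Vk) => //; exists (lincomb w e); rewrite -lincombZ.
  apply: t_lc; rewrite (rowE _ _ _ vE) -scalemxAl mulmxKV //.
  by apply/rowP => i; rewrite !mxE.
have t_inj : injective t.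
  suff t_ker m : t m = 0 -> m = 0.
    move=> x y xy; apply/eqP; rewrite -subr_eq0; apply/eqP/t_ker.
    by rewrite tD xy -tD subrr.
  move=> tm; rewrite -(bcoordE m).
  have x0 : \row_(j < n) val (bcoord m j) *m T = 0.
    apply/rowP => j; rewrite !mxE.
    transitivity (val (\sum_(i < n) bcoord m i * bcoord (t e`_i) j)).
      by rewrite rmorph_sum; apply: eq_bigr => i _; rewrite !mxE.
    suff -> : \sum_(i < n) bcoord m i * bcoord (t e`_i) j = 0 by [].
    apply: (lincomb_free (v := fun j => \sum_(i < n) bcoord m i * bcoord (t e`_i) j)) => //.
    rewrite -[RHS]tm -[in RHS](bcoordE m); symmetry; apply: t_lc.
    apply/rowP => i; rewrite !mxE rmorph_sum; apply: eq_bigr => i' _.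
    by rewrite !mxE rmorphM.
  rewrite /lincomb big1 // => j _.
  have /rowP/(_ j) : \row_(j < n) val (bcoord m j) = 0.
    by rewrite -(mulmxK Tu (\row__ _)) x0 mul0mx.
  by rewrite !mxE => /eqP; rewrite -[0]/(val (0 : Vt)) => /eqP/val_inj->; rewrite scale0r.
have t_surj m : exists m', t m' = m.
  by have [v vE] := T_inv (bcoord m); exists (lincomb v e); rewrite vE bcoordE.
exists (fun m => sval (cid (t_surj m))) => m; last exact: (svalP (cid (t_surj m))).
by apply: t_inj; exact: (svalP (cid (t_surj (t m)))).
Qed.

End Basis.
End BaseModules.

(** * The preorder defined by a cocycle *)

Section Cocycle.
Variables (F : fieldType) (V : subringClosed F) (K : splittingFieldType F).
Local Notation G := (gal_of {:K}).
Local Notation St := (subring_type (integral_closure V K)).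
Local Notation gal := (@gal_closure F V K).

(** Stated for S-valued functions so that the cocycle of the opposite order is an instance too. *)
Record integral_cocycle (f : G -> G -> St) : Prop := IntegralCocycle {
  icocycle1l : forall g, f 1%g g = 1;
  icocycle1r : forall g, f g 1%g = 1;
  icocycle_neq0 : forall g h, f g h != 0;
  icocycleP : forall g h k,
    f g h * f (gcomp g h) k = gal g (f h k) * f g (gcomp h k) }.

Variable f : G -> G -> St.
Hypothesis fC : integral_cocycle f.
Variable M : St -> bool.
Hypothesis mM : is_max M.

Lemma cocycle_invV g : f g^-1%g g = gal g^-1%g (f g g^-1%g).
Proof.
have := icocycleP fC g^-1%g g g^-1%g.
by rewrite gcompVg gcompgV (icocycle1l fC) (icocycle1r fC) !mulr1.
Qed.

(* This makes the relation [cocycle_le] below a total preorder. *)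
Lemma cocycle_splits g r :
  f g r * f (gcomp g r) r^-1%g = gal g (f r r^-1%g).
Proof. by rewrite (icocycleP fC) gcompgV (icocycle1r fC) mulr1. Qed.

(** Since x_g x_(g^-1 h) = f(g, g^-1 h) x_h, the relation g <= h puts x_h P inside x_g P locally at
    M: going up shrinks the submodule. *)
Definition cocycle_le g h := ~~ M (f g (gcomp g^-1%g h)).
(** The equivalence of the preorder ([cocycle_simE]), written with the single diagonal value at g^-1
    h, which makes its behaviour under translation visible. *)
Definition cocycle_sim g h :=
  ~~ M (gal g (f (gcomp g^-1%g h) (gcomp g^-1%g h)^-1%g)).

Lemma gcomp_invM (g h : G) : (gcomp g^-1%g h)^-1%g = gcomp h^-1%g g.
Proof. by rewrite /gcomp invMg invgK. Qed.

Lemma cocycle_simE g h : cocycle_sim g h = cocycle_le g h && cocycle_le h g.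
Proof.
rewrite /cocycle_sim -cocycle_splits max_prime // negb_or gcompKV.
by rewrite gcomp_invM.
Qed.

Lemma cocycle_sim_sym g h : cocycle_sim g h = cocycle_sim h g.
Proof. by rewrite !cocycle_simE andbC. Qed.

Lemma cocycle_le_refl g : cocycle_le g g.
Proof. by rewrite /cocycle_le gcompVg (icocycle1r fC) (max1 mM). Qed.

Lemma cocycle_le_trans g h k : cocycle_le g h -> cocycle_le h k -> cocycle_le g k.
Proof.
rewrite /cocycle_le => gh hk.
have := icocycleP fC g (gcomp g^-1%g h) (gcomp h^-1%g k).
rewrite gcompKV -[gcomp (gcomp _ _) _]gcompA gcompKV => E.
have : ~~ M (f g (gcomp g^-1%g h) * f h (gcomp h^-1%g k)).
  by rewrite max_prime // negb_or gh hk.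
by rewrite E max_prime // negb_or => /andP[].
Qed.

Lemma cocycle_sim_trans g h k :
  cocycle_sim g h -> cocycle_sim h k -> cocycle_sim g k.
Proof.
rewrite !cocycle_simE => /andP[gh hg] /andP[hk kh].
by rewrite (cocycle_le_trans gh hk) (cocycle_le_trans kh hg).
Qed.

Lemma cocycle_sim_refl g : cocycle_sim g g.
Proof. by rewrite cocycle_simE cocycle_le_refl. Qed.
End Cocycle.

Section PartialTrace.
Variables (F : fieldType) (V : subringClosed F) (K : splittingFieldType F).
Local Notation G := (gal_of {:K}).
Local Notation St := (subring_type (integral_closure V K)).
Local Notation gal := (@gal_closure F V K).
Variable f : G -> G -> St.
Hypothesis fC : integral_cocycle f.
Variable M0 : St -> bool.
Hypothesis mM0 : is_max M0.
Local Notation sim := (cocycle_sim f M0).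
Variable l : seq (St * St).
Hypothesis hl : forall g, \sum_(p <- l) p.1 * gal g p.2 = (g == 1%g)%:R.

Lemma cocycle_sim_translate (d g h : G) : (forall s, M0 (gal d s) = M0 s) ->
  sim (gcomp d g) (gcomp d h) = sim g h.
Proof.
move=> Md; rewrite /cocycle_sim.
have -> : gcomp (gcomp d g)^-1%g (gcomp d h) = gcomp g^-1%g h.
  by rewrite /gcomp invMg mulgA mulgK.
by rewrite gal_closureM Md.
Qed.

Definition partial_trace h0 c := \sum_(h | sim h h0) gal h c.

Lemma partial_trace_sim h h0 c : sim h h0 -> partial_trace h c = partial_trace h0 c.
Proof.
move=> hh0; apply: eq_bigl => k; apply/idP/idP=> kh.
  exact: (cocycle_sim_trans fC mM0 kh hh0).
by apply: (cocycle_sim_trans fC mM0 kh); rewrite (cocycle_sim_sym fC mM0).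
Qed.

(** The element d = h h'^-1 stabilizes M0, and translation by d carries the class of h' onto that of
    h. *)
Lemma partial_trace_conj h h' c : (forall s, M0 (gal h s) = M0 (gal h' s)) ->
  M0 (partial_trace h c) = M0 (partial_trace h' c).
Proof.
move=> hh'; pose d := gcomp h h'^-1%g.
have Md s : M0 (gal d s) = M0 s.
  by rewrite /d gal_closureM hh' gal_closureKV.
rewrite -[RHS]Md rmorph_sum; congr (M0 _); rewrite /partial_trace.
rewrite (reindex_inj (mulIg d)) /=; apply: eq_big => [k|k _].
  have -> : h = gcomp d h' by rewrite gcompVK.
  exact: cocycle_sim_translate.
by rewrite -gal_closureM.
Qed.

Lemma partial_trace_unit : exists c, forall h, ~~ M0 (partial_trace h c).
Proof.
suff [c Mc] : exists c, forall h, h \in index_enum G -> ~~ M0 (partial_trace h c).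
  by exists c => h; apply: Mc; exact: mem_index_enum.
elim: (index_enum G) => [|h0 hs [c Mc]]; first by exists 0.
case: (boolP (M0 (partial_trace h0 c))) => [Mc0|]; last first.
  by exists c => h; rewrite inE => /predU1P[->|/Mc].
(* Correcting c at h0 must not spoil the h already treated. So [a] is chosen with h(a) in M0 at
   every h whose conjugate is not that of a member of the class of h0. *)
pose same h := `[< exists2 h', sim h' h0 & forall s, M0 (gal h s) = M0 (gal h' s) >].
have [|a Ma0 Ma] := @notin_conj _ _ _ M0 mM0 h0 (fun h => ~~ same h).
  move=> h /asboolP nh; apply: contrapT => nE; apply: nh.
  exists h0; first exact: cocycle_sim_refl.
  move=> s; apply/idP/idP=> Ms.
    by apply: contrapT => /negP Ms0; apply: nE; exists s.
  apply: contrapT => /negP Mhs; apply: nE.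
  by apply: conj_notin_sub Ms Mhs.
(* Independence of characters: the Galois coordinates recover h0(a) from the partial traces of the a
   p.2, so these cannot all lie in M0. *)
have [b Mb] : exists b, ~~ M0 (partial_trace h0 (a * b)).
  apply: contrapT => nE; case/negP: (Ma0).
  have -> : gal h0 a = \sum_(p <- l) gal h0 p.1 * partial_trace h0 (a * p.2).
    under eq_bigr do rewrite mulr_sumr.
    rewrite exchange_big /= (bigD1 h0) ?cocycle_sim_refl //= [X in _ + X]big1.
      rewrite addr0; transitivity (\sum_(p <- l) gal h0 a * gal h0 (p.1 * p.2)).
        have := hl 1%g; rewrite eqxx => l1.
        rewrite -mulr_sumr -rmorph_sum.
        rewrite (eq_bigr (fun p => p.1 * gal 1%g p.2)) ?l1 ?rmorph1 ?mulr1 //.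
        by move=> p _; rewrite gal_closure1.
      by apply: eq_bigr => p _; rewrite !rmorphM /=; ring.
    move=> h /andP[_ hh0].
    transitivity (gal h a * gal h0 (\sum_(p <- l) p.1 * gal (gcomp h0^-1%g h) p.2)).
      rewrite rmorph_sum mulr_sumr; apply: eq_bigr => p _.
      by rewrite !rmorphM /= -gal_closureM gcompKV; ring.
    rewrite hl (_ : (_ == _) = false) ?rmorph0 ?mulr0 //.
    apply: contraNF hh0 => /eqP h1.
    by rewrite -(gcompKV h0 h) h1 gcompg1.
  apply: max_sum => // p _; apply: maxMl => //.
  by apply: contrapT => /negP Mp; apply: nE; exists p.2.
have ptD h x y : partial_trace h (x + y) = partial_trace h x + partial_trace h y.
  by rewrite -big_split; apply: eq_bigr => k _; rewrite rmorphD.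
(* For an earlier h, a member k of its class in [same] would force the partial trace of c at h into
   M0 along with the one at h0. So every k(a) lies in M0 and the correction is invisible at h. *)
exists (c + a * b) => h; rewrite inE ptD => /predU1P[->|/Mc Mch].
  by rewrite max_addl.
rewrite addrC max_addl //; apply: max_sum => // k kh.
rewrite rmorphM; apply: maxMr => //; apply: Ma.
apply: contra Mch => /asboolP[h' hh0 kh'].
by rewrite -(partial_trace_sim c kh) (partial_trace_conj c kh') (partial_trace_sim c hh0).
Qed.
End PartialTrace.

(** * Averaging over a crossed-product order *)

Section Restriction.
Variables (A R : nzRingType) (phi : {rmorphism A -> R}) (P : lmodType R).
Definition restriction of {rmorphism A -> R} : Type := P.
Local Notation PA := (restriction phi).
HB.instance Definition _ := GRing.Zmodule.copy PA P.
Definition restriction_scale (a : A) (m : PA) : PA := phi a *: (m : P).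
Fact restriction_scaleA a b m :
  restriction_scale a (restriction_scale b m) = restriction_scale (a * b) m.
Proof. by rewrite /restriction_scale scalerA rmorphM. Qed.
Fact restriction_scale1 : left_id 1 restriction_scale.
Proof. by move=> m; rewrite /restriction_scale rmorph1 scale1r. Qed.
Fact restriction_scaleDr : right_distributive restriction_scale +%R.
Proof. by move=> a m n; rewrite /restriction_scale scalerDr. Qed.
Fact restriction_scaleDl m : {morph restriction_scale^~ m : a b / a + b}.
Proof. by move=> a b; rewrite /restriction_scale rmorphD scalerDl. Qed.
HB.instance Definition _ := GRing.Zmodule_isLmodule.Build A PA
  restriction_scaleA restriction_scale1 restriction_scaleDr restriction_scaleDl.
End Restriction.

Section LinearMap.
Variables (R : nzRingType) (P X : lmodType R) (h : P -> X).
Hypothesis hD : forall m n, h (m + n) = h m + h n.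
Hypothesis hZ : forall r m, h (r *: m) = r *: h m.
Definition linear_map of (forall m n, h (m + n) = h m + h n) &
  (forall r m, h (r *: m) = r *: h m) := h.
Fact linear_map_linear : linear (linear_map hD hZ).
Proof. by move=> r m n; rewrite /linear_map hD hZ. Qed.
HB.instance Definition _ := GRing.isLinear.Build R P X *:%R (linear_map hD hZ)
  linear_map_linear.
End LinearMap.

Section CrossedSystem.
Variables (F : fieldType) (V : subringClosed F) (K : splittingFieldType F).
Local Notation G := (gal_of {:K}).
Local Notation St := (subring_type (integral_closure V K)).
Local Notation gal := (@gal_closure F V K).
Variable f : G -> G -> St.

(** Satisfied by the order and by its opposite, so that one projectivity argument covers left and
    right ideals. *)
Record crossed_system (R : nzRingType) (i : {rmorphism St -> R}) (x : G -> R) :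
    Prop := CrossedSystem {
  cs1 : x 1%g = 1;
  cs_scal : forall g s, x g * i s = i (gal g s) * x g;
  cs_mul : forall g h, x g * x h = i (f g h) * x (gcomp g h);
  cs_gen : forall r, exists a : G -> St, r = \sum_g i (a g) * x g }.
End CrossedSystem.

Section CrossedModule.
Variables (F : fieldType) (V : subringClosed F) (K : splittingFieldType F).
Hypothesis hV : valuation_ring V.
Hypothesis hK : galois 1 {:K}.
Local Notation G := (gal_of {:K}).
Local Notation St := (subring_type (integral_closure V K)).
Local Notation Vt := (subring_type V).
Local Notation gal := (@gal_closure F V K).
Local Notation base := (@base_to_closure F V K).
Variable f : G -> G -> St.
Hypothesis fC : integral_cocycle f.
Variable l : seq (St * St).
Hypothesis hl : forall g, \sum_(p <- l) p.1 * gal g p.2 = (g == 1%g)%:R.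
Variables (R : nzRingType) (i : {rmorphism St -> R}) (x : G -> R).
Hypothesis cs : crossed_system f i x.
Variables (pi : Vt) (u : G -> St).
Hypothesis nz_pi : pi != 0.
Hypothesis uE : forall g, u g * f g^-1%g g = base pi.

Definition xinv g := i (u g) * x g^-1%g.
Local Notation y := xinv.
Local Notation bpi := (i (base pi)).

Lemma xinvK g : y g * x g = bpi.
Proof. by rewrite /y -mulrA (cs_mul cs) gcompVg (cs1 cs) mulr1 -rmorphM uE. Qed.

Lemma xinvVK g : x g * y g = bpi.
Proof.
rewrite /y mulrA (cs_scal cs) -mulrA (cs_mul cs) gcompgV (cs1 cs) mulr1 -rmorphM.
have -> : f g g^-1%g = gal g (f g^-1%g g).
  by rewrite (cocycle_invV fC) gal_closureKV.
by rewrite -rmorphM uE /= gal_closure_base.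
Qed.

Lemma xinv_scal g s : y g * i s = i (gal g^-1%g s) * y g.
Proof. by rewrite /y -mulrA (cs_scal cs) !mulrA -!rmorphM mulrC. Qed.

Lemma basis_pi g : x g * bpi = bpi * x g.
Proof. by rewrite (cs_scal cs) gal_closure_base. Qed.

Section Averaging.
Variables (P X : lmodType R).
Hypothesis P_tf : forall s (m : P), s != 0 -> i s *: m = 0 -> m = 0.

Lemma basis_inj g (m n : P) : x g *: m = x g *: n -> m = n.
Proof.
move=> mn; apply/eqP; rewrite -subr_eq0; apply/eqP.
apply: (@P_tf (base pi)); first by rewrite base_eq0.
by rewrite -(xinvK g) -scalerA scalerBr mn subrr scaler0.
Qed.

(** Checked after applying the injective x_(t r). This rule makes averaging over the y_g compatible
    with x_t. *)
Lemma xinv_comp_basis t r (m : P) :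
  y (gcomp t r) *: (x t *: m) = i (gal (gcomp t r)^-1%g (f t r)) *: (y r *: m).
Proof.
apply: (@basis_inj (gcomp t r)); rewrite !scalerA xinvVK.
by rewrite (cs_scal cs) gal_closureKV -(cs_mul cs) -[_ * y r]mulrA xinvVK basis_pi.
Qed.

Lemma basis_xinv_comp t k (m : P) :
  x t *: (y (gcomp k t) *: m) = y k *: (i (f k t) *: m).
Proof.
apply: (@basis_inj k); rewrite !scalerA (cs_mul cs) -[_ * y _]mulrA !xinvVK.
by rewrite -!rmorphM mulrC.
Qed.

(** Averaging evaluates its map only at elements s (y_g m), so a map that is linear on this
    submodule suffices. It is stable under S and all x_t, and contains pi P. *)
Definition xinv_span (m : P) := exists n : G -> P, m = \sum_g y g *: n g.
Local Notation J := xinv_span.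

Lemma xinv_spanD m n : J m -> J n -> J (m + n).
Proof.
move=> [a ->] [b ->]; exists (fun g => a g + b g); rewrite -big_split.
by apply: eq_bigr => g _; rewrite scalerDr.
Qed.

Lemma xinv_span_xinv g m : J (y g *: m).
Proof.
exists (fun h => if h == g then m else 0); rewrite (bigD1 g) //= eqxx big1 ?addr0 //.
by move=> h /negPf ->; rewrite scaler0.
Qed.

Lemma xinv_span0 : J 0. Proof. by rewrite -(scaler0 _ (y 1%g)); exact: xinv_span_xinv. Qed.

Lemma xinv_span_sum (I : Type) (r : seq I) (E : I -> P) :
  (forall k, J (E k)) -> J (\sum_(k <- r) E k).
Proof. by move=> JE; elim/big_ind: _ => //; [exact: xinv_span0 | exact: xinv_spanD]. Qed.

Lemma xinv_span_scal s m : J m -> J (i s *: m).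
Proof.
move=> [a ->]; rewrite scaler_sumr; apply: xinv_span_sum => g.
by rewrite scalerA -{1}(gal_closureK g s) -xinv_scal -scalerA; exact: xinv_span_xinv.
Qed.

Lemma xinv_span_basis t m : J m -> J (x t *: m).
Proof.
move=> [a ->]; rewrite scaler_sumr; apply: xinv_span_sum => g.
by rewrite -(gcompVK g t) basis_xinv_comp; exact: xinv_span_xinv.
Qed.

Lemma xinv_span_pi m : J (bpi *: m).
Proof. by rewrite -(xinvK 1%g) -scalerA; exact: xinv_span_xinv. Qed.

Lemma xinv_spanN m : J m -> J (- m).
Proof. by move=> Jm; rewrite -scaleN1r -(rmorphN1 i); apply: xinv_span_scal. Qed.

Variable L : P -> X.
Hypothesis LD : forall m n, J m -> J n -> L (m + n) = L m + L n.
Hypothesis LZ : forall v m, J m -> L (i (base v) *: m) = i (base v) *: L m.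

(** Placing the two halves of the Casimir element around the V-linear L makes it S-linear on J. *)
Definition casimir_average m := \sum_(p <- l) i p.1 *: L (i p.2 *: m).
Local Notation Q := casimir_average.

Lemma averaged_map0 : L 0 = 0.
Proof. by have := LZ 0 xinv_span0; rewrite !rmorph0 !scale0r. Qed.

Lemma casimir_averageD m n : J m -> J n -> Q (m + n) = Q m + Q n.
Proof.
move=> Jm Jn; rewrite -big_split; apply: eq_bigr => p _.
by rewrite /= -scalerDr -LD ?scalerDr //; apply: xinv_span_scal.
Qed.

Lemma casimir_averageZ s m : J m -> Q (i s *: m) = i s *: Q m.
Proof.
move=> Jm; pose b (p q : St) : X := i p *: L (i q *: m).
have := @casimir F V K hV hK l hl X b s; rewrite {}/b => C.
rewrite /Q scaler_sumr; symmetry.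
under eq_bigr do rewrite scalerA -rmorphM.
under [RHS]eq_bigr do rewrite scalerA -rmorphM.
apply: C => [p q r|p q r|p|p|v p q].
- by rewrite rmorphD scalerDl.
- by rewrite rmorphD scalerDl LD ?scalerDr //; apply: xinv_span_scal.
- by rewrite rmorph0 scale0r.
- by rewrite rmorph0 scale0r averaged_map0 scaler0.
- by rewrite !rmorphM /= -!scalerA LZ //; apply: xinv_span_scal.
Qed.

Variable c : St.

(** On passing x_g the factor c becomes the weight g(c) of the g-th term; its choice decides whether
    the average is bijective. *)
Definition average m := \sum_g x g *: (i c *: Q (y g *: m)).

Lemma averageD m n : average (m + n) = average m + average n.
Proof.
rewrite -big_split; apply: eq_bigr => g _.
by rewrite scalerDr casimir_averageD ?scalerDr //; exact: xinv_span_xinv.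
Qed.

Lemma average0 : average 0 = 0.
Proof. by apply: (addrI (average 0)); rewrite -averageD !addr0. Qed.

Lemma average_scal s m : average (i s *: m) = i s *: average m.
Proof.
rewrite scaler_sumr; apply: eq_bigr => g _.
rewrite [y g *: _]scalerA xinv_scal -scalerA casimir_averageZ; last exact: xinv_span_xinv.
rewrite !scalerA; congr (_ *: _).
by rewrite -mulrA -rmorphM [c * _]mulrC rmorphM mulrA (cs_scal cs) gal_closureKV.
Qed.

Lemma average_x t m : average (x t *: m) = x t *: average m.
Proof.
rewrite scaler_sumr [LHS](reindex_inj (mulIg t)) /=; apply: eq_bigr => r _.
rewrite -/(gcomp t r) xinv_comp_basis casimir_averageZ; last exact: xinv_span_xinv.
rewrite !scalerA; congr (_ *: _).
rewrite -mulrA -rmorphM [c * _]mulrC rmorphM mulrA (cs_scal cs) gal_closureKV.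
by rewrite -(cs_mul cs).
Qed.

Lemma averageZ r m : average (r *: m) = r *: average m.
Proof.
have [a ->] := cs_gen cs r; rewrite !scaler_suml.
elim: (index_enum G) => [|g s IHs]; first by rewrite !big_nil average0.
by rewrite !big_cons averageD IHs -!scalerA average_scal average_x.
Qed.

End Averaging.

Lemma average_comp (P X N : lmodType R) (h : {linear X -> N}) (L : P -> X) c m :
  h (average L c m) = average (h \o L) c m.
Proof.
rewrite linear_sum; apply: eq_bigr => g _; rewrite !linearZ /=.
by rewrite linear_sum; congr (_ *: (_ *: _)); apply: eq_bigr => p _; rewrite linearZ.
Qed.

Lemma eq_average (P X : lmodType R) (L L' : P -> X) c m :
  (forall m, xinv_span m -> L m = L' m) -> average L c m = average L' c m.
Proof.
move=> LL'; apply: eq_bigr => g _; congr (_ *: (_ *: _)); apply: eq_bigr => p _.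
by rewrite LL' //; apply: xinv_span_scal; exact: xinv_span_xinv.
Qed.

Section Criterion.
Variable P : lmodType R.
Hypothesis P_tf : forall s (m : P), s != 0 -> i s *: m = 0 -> m = 0.
Variables (n : nat) (e : 'I_n -> P) (D : 'I_n -> P -> Vt).
Hypothesis DD : forall j m m', xinv_span m -> xinv_span m' ->
  D j (m + m') = D j m + D j m'.
Hypothesis DZ : forall j v m, xinv_span m -> D j (i (base v) *: m) = v * D j m.

Definition combine (X : lmodType R) (z : 'I_n -> X) m : X :=
  \sum_j i (base (D j m)) *: z j.

Lemma combineD (X : lmodType R) (z : 'I_n -> X) m m' : xinv_span m -> xinv_span m' ->
  combine z (m + m') = combine z m + combine z m'.
Proof.
move=> Jm Jm'; rewrite -big_split; apply: eq_bigr => j _.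
by rewrite DD // !rmorphD /= scalerDl.
Qed.

Lemma combineZ (X : lmodType R) (z : 'I_n -> X) v m : xinv_span m ->
  combine z (i (base v) *: m) = i (base v) *: combine z m.
Proof.
move=> Jm; rewrite scaler_sumr; apply: eq_bigr => j _.
by rewrite DZ // scalerA -!rmorphM.
Qed.

(** Replacing the e_j by elements z_j of X with the right images, the same coordinate functions D_j
    average to a linear q with g q = h t. Composing q with the inverse of t lifts h. *)
Lemma projective_criterion c : bijective (average (combine e) c) -> projective P.
Proof.
move=> [t' tK t'K] X N g h g_surj.
set t := average (combine e) c in tK t'K.
have tD : forall m m', t (m + m') = t m + t m'.
  by move=> m m'; apply: averageD; exact: combineD.
have tZ : forall r m, t (r *: m) = r *: t m.
  by move=> r m; apply: averageZ => //; [exact: combineD | exact: combineZ].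
pose z j := sval (cid (g_surj (h (e j)))).
have gz j : g (z j) = h (e j) by exact: svalP (cid (g_surj (h (e j)))).
pose q := average (combine z) c.
have qD : forall m m', q (m + m') = q m + q m'.
  by move=> m m'; apply: averageD; exact: combineD.
have qZ : forall r m, q (r *: m) = r *: q m.
  by move=> r m; apply: averageZ => //; [exact: combineD | exact: combineZ].
have gq m : g (q m) = h (t m).
  rewrite !average_comp; apply: eq_average => m' _ /=.
  by rewrite !linear_sum; apply: eq_bigr => j _; rewrite !linearZ /= gz.
have t'D : forall m m', t' (m + m') = t' m + t' m'.
  by move=> m m'; rewrite -{1}(t'K m) -{1}(t'K m') -tD tK.
have t'Z : forall r m, t' (r *: m) = r *: t' m.
  by move=> r m; rewrite -{1}(t'K m) -tZ tK.
have lD : forall m m', q (t' (m + m')) = q (t' m) + q (t' m').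
  by move=> m m'; rewrite t'D qD.
have lZ : forall r m, q (t' (r *: m)) = r *: q (t' m).
  by move=> r m; rewrite t'Z qZ.
exists (linear_map lD lZ) => m.
by rewrite /linear_map /= gq t'K.
Qed.

End Criterion.
End CrossedModule.

(** * Projectivity of torsion-free modules *)

Section Chain.
Variables (F : fieldType) (V : subringClosed F) (K : splittingFieldType F).
Hypothesis hV : valuation_ring V.
Hypothesis hK : galois 1 {:K}.
Local Notation G := (gal_of {:K}).
Local Notation St := (subring_type (integral_closure V K)).
Local Notation Vt := (subring_type V).
Local Notation gal := (@gal_closure F V K).
Local Notation base := (@base_to_closure F V K).
Variable f : G -> G -> St.
Hypothesis fC : integral_cocycle f.
Variable l : seq (St * St).
Hypothesis hl : forall g, \sum_(p <- l) p.1 * gal g p.2 = (g == 1%g)%:R.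
Variables (R : nzRingType) (i : {rmorphism St -> R}) (x : G -> R).
Hypothesis cs : crossed_system f i x.
Variables (pi : Vt) (u : G -> St).
Hypothesis nz_pi : pi != 0.
Hypothesis uE : forall g, u g * f g^-1%g g = base pi.
Local Notation y := (xinv i x u).
Local Notation bpi := (i (base pi)).
Variable M0 : St -> bool.
Hypothesis mM0 : is_max M0.
Hypothesis nonunit_pi : forall v, nonunit v -> exists w, v = w * pi.
Hypothesis square_free : forall r g a b s, ~~ M0 (gal g s) ->
  M0 (gal g a) -> M0 (gal g b) -> s * f r r^-1%g <> a * b.

Variable P : lmodType R.
Hypothesis P_tf : forall s (m : P), s != 0 -> i s *: m = 0 -> m = 0.
Local Notation J := (@xinv_span F V K R i x u P).
Variable L : P -> P.
Hypothesis LD : forall m n, J m -> J n -> L (m + n) = L m + L n.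
Hypothesis LZ : forall v m, J m -> L (i (base v) *: m) = i (base v) *: L m.
Hypothesis L_pi : forall m, J (L (bpi *: m) - m).
Local Notation Q := (casimir_average l i L).
Variable c : St.
Hypothesis c_unit : forall h, ~~ M0 (partial_trace f M0 h c).
Local Notation t := (average l i x u L c).

Let Jscal := xinv_span_scal cs (u := u) (P := P).
Let JD := xinv_spanD (x := x) (u := u) (i := i) (P := P).

Definition x_image g (m : P) := exists m', m = x g *: m'.
Definition xJ_image g (m : P) := exists2 j, J j & m = x g *: j.
Definition pi_image (m : P) := exists m', m = bpi *: m'.

Lemma coords_split (m : P) : \sum_(p <- l) i p.1 *: (i p.2 *: m) = m.
Proof.
have l1 : \sum_(p <- l) p.1 * p.2 = 1.
  transitivity (\sum_(p <- l) p.1 * gal 1%g p.2); last by rewrite hl eqxx.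
  by apply: eq_bigr => p _; rewrite gal_closure1.
rewrite -[RHS]scale1r -(rmorph1 i) -l1 rmorph_sum scaler_suml.
by apply: eq_bigr => p _; rewrite rmorphM scalerA.
Qed.

Lemma scal_pi_comm s (m : P) : bpi *: (i s *: m) = i s *: (bpi *: m).
Proof. by rewrite !scalerA -!rmorphM mulrC. Qed.

Lemma basis_pi_comm g (m : P) : bpi *: (x g *: m) = x g *: (bpi *: m).
Proof. by rewrite !scalerA -(basis_pi cs). Qed.

Lemma basis_scal_comm g s (m : P) : x g *: (i s *: m) = i (gal g s) *: (x g *: m).
Proof. by rewrite !scalerA (cs_scal cs). Qed.

Lemma basis_xinv g (m : P) : x g *: (y g *: m) = bpi *: m.
Proof. by rewrite scalerA (xinvVK fC cs uE). Qed.

Lemma xinv_basis g (m : P) : y g *: (x g *: m) = bpi *: m.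
Proof. by rewrite scalerA (xinvK cs uE). Qed.

Lemma basis_basis g h (m : P) : x g *: (x h *: m) = i (f g h) *: (x (gcomp g h) *: m).
Proof. by rewrite !scalerA (cs_mul cs). Qed.

Lemma casimir_average_pi m : J (Q (bpi *: m) - m).
Proof.
rewrite -{2}(coords_split m) -sumrB; apply: xinv_span_sum => p.
by rewrite -scal_pi_comm -scalerBr; apply: Jscal.
Qed.

Lemma casimir_average_scal s m : J m -> Q (i s *: m) = i s *: Q m.
Proof. exact: (casimir_averageZ hV hK hl cs LD LZ). Qed.

(** The g-th term of the average without its weight. It is S-linear, is the identity on x_g P modulo
    x_g J, and maps x_g J into pi P. *)
Definition tr_piece g m := x g *: Q (y g *: m).

Lemma averageE m : t m = \sum_g i (gal g c) *: tr_piece g m.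
Proof. by apply: eq_bigr => g _; rewrite basis_scal_comm. Qed.

Lemma tr_piece_scal g s m : tr_piece g (i s *: m) = i s *: tr_piece g m.
Proof.
rewrite /tr_piece [y g *: _]scalerA (xinv_scal cs) -scalerA.
rewrite casimir_average_scal; last exact: xinv_span_xinv.
by rewrite basis_scal_comm gal_closureKV.
Qed.

Lemma tr_piece_x g m : xJ_image g (tr_piece g (x g *: m) - x g *: m).
Proof.
exists (Q (bpi *: m) - m); first exact: casimir_average_pi.
by rewrite /tr_piece xinv_basis scalerBr.
Qed.

Lemma tr_piece_xJ g j : J j -> pi_image (tr_piece g (x g *: j)).
Proof.
move=> Jj; exists (x g *: Q j).
by rewrite /tr_piece xinv_basis casimir_average_scal // basis_pi_comm.
Qed.

Section Local.
Variable g : G.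
Local Notation M := (fun s => M0 (gal g s)).
Local Notation le := (cocycle_le f M).
Let mM : is_max M := conj_max mM0 g.

Definition locally (N : P -> Prop) m := exists2 s, ~~ M s & N (i s *: m).

Record submodule (N : P -> Prop) : Prop := Submodule {
  submod0 : N 0;
  submodD : forall m n, N m -> N n -> N (m + n);
  submodZ : forall s m, N m -> N (i s *: m) }.

Lemma locallyT N m : N m -> locally N m.
Proof. by exists 1; rewrite ?(max1 mM) // rmorph1 scale1r. Qed.

Lemma locallyM N s m : ~~ M s -> locally N (i s *: m) -> locally N m.
Proof.
move=> Ms [r Mr Nm]; exists (r * s); first by rewrite (max_prime _ _ mM) negb_or Mr.
by rewrite rmorphM -scalerA.
Qed.

Lemma locallyD N m n : submodule N -> locally N m -> locally N n -> locally N (m + n).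
Proof.
move=> sN [r Mr Nm] [s Ms Nn]; exists (r * s).
  by rewrite (max_prime _ _ mM) negb_or Mr.
rewrite scalerDr; apply: (submodD sN).
  by rewrite mulrC rmorphM -scalerA; apply: submodZ.
by rewrite rmorphM -scalerA; apply: submodZ.
Qed.

Lemma locallyZ N s m : submodule N -> locally N m -> locally N (i s *: m).
Proof.
move=> sN [r Mr Nm]; exists r => //.
by rewrite scalerA -rmorphM mulrC rmorphM -scalerA; apply: submodZ.
Qed.

Lemma locally_sum N (I : Type) (r : seq I) (E : I -> P) : submodule N ->
  (forall k, locally N (E k)) -> locally N (\sum_(k <- r) E k).
Proof.
move=> sN NE; elim/big_ind: _ => // [|m n Nm Nn].
  by apply: locallyT; apply: submod0.
exact: locallyD.
Qed.

Lemma locally_sub N N' m : (forall n, N n -> N' n) -> locally N m -> locally N' m.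
Proof. by move=> NN' [s Ms Nm]; exists s => //; apply: NN'. Qed.

Lemma x_image_submod h : submodule (x_image h).
Proof.
split=> [|_ _ [m ->] [n ->]|s _ [m ->]].
- by exists 0; rewrite scaler0.
- by exists (m + n); rewrite scalerDr.
- by exists (i (gal h^-1%g s) *: m); rewrite basis_scal_comm gal_closureKV.
Qed.

Lemma xJ_image_submod h : submodule (xJ_image h).
Proof.
split=> [|_ _ [m Jm ->] [n Jn ->]|s _ [m Jm ->]].
- by exists 0; [exact: xinv_span0 | rewrite scaler0].
- by exists (m + n); [exact: JD | rewrite scalerDr].
- exists (i (gal h^-1%g s) *: m); first exact: Jscal.
  by rewrite basis_scal_comm gal_closureKV.
Qed.

Lemma pi_image_submod : submodule pi_image.
Proof.
split=> [|_ _ [m ->] [n ->]|s _ [m ->]].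
- by exists 0; rewrite scaler0.
- by exists (m + n); rewrite scalerDr.
- by exists (i s *: m); rewrite scal_pi_comm.
Qed.

Lemma pi_x_image h m : pi_image m -> x_image h m.
Proof. by move=> [n ->]; exists (y h *: n); rewrite basis_xinv. Qed.

Lemma pi_xJ_image h m : pi_image m -> xJ_image h m.
Proof. by move=> [n ->]; exists (y h *: n); [exact: xinv_span_xinv | rewrite basis_xinv]. Qed.

Lemma le_x_image h k m : le h k -> locally (x_image h) (x k *: m).
Proof.
move=> hk; apply: (locallyM hk); apply: locallyT.
by exists (x (gcomp h^-1%g k) *: m); rewrite basis_basis gcompKV.
Qed.

Lemma le_xJ_image h k j : le h k -> J j -> locally (xJ_image h) (x k *: j).
Proof.
move=> hk Jj; apply: (locallyM hk); apply: locallyT.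
exists (x (gcomp h^-1%g k) *: j); last by rewrite basis_basis gcompKV.
exact: (xinv_span_basis fC cs nz_pi uE P_tf).
Qed.

(** With r = h^-1 k, the product f(h, r) f(k, r^-1) equals h(f(r, r^-1)). If both factors were in M,
    a diagonal value would be a product of two elements of a maximal ideal. *)
Lemma le_total h k : ~~ le h k -> le k h.
Proof.
rewrite /cocycle_le negbK => Mhk; apply/negP => Mkh.
pose r := gcomp h^-1%g k.
apply: (@square_free r (gcomp g h) (gal h^-1%g (f h r)) (gal h^-1%g (f k r^-1%g)) 1).
- by rewrite rmorph1 (max1 mM0).
- by rewrite gal_closureM gal_closureKV.
- by rewrite gal_closureM gal_closureKV /r gcomp_invM.
apply: (can_inj (gal_closureK h)).
rewrite mul1r rmorphM /= !gal_closureKV -(cocycle_splits fC).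
by rewrite /r gcompKV.
Qed.

(** With r = h^-1 k, the value f(r, r^-1) lies in the conjugate at g h, so it is locally a multiple
    of pi. Hence x_(r^-1) P lies locally in y_r P, a part of J, and x_k x_(r^-1) is x_h up to a
    local unit. *)
Lemma nle_xJ_image h k m : ~~ le h k -> locally (xJ_image k) (x h *: m).
Proof.
move=> hk; have kh := le_total hk; pose r := gcomp h^-1%g k.
have Md : M0 (gal (gcomp g h) (f r r^-1%g)).
  rewrite gal_closureM -(cocycle_splits fC).
  move: hk; rewrite /cocycle_le negbK => hk.
  by rewrite rmorphM; apply: maxMr.
have [e Me [v [nv eE]]] := uniformizer hV hK hl mM0 Md.
have [w wE] : exists w : St, e * f r r^-1%g = w * base pi.
  rewrite eE; exists (\sum_(p <- l) p.1 * base (sval (cid (nonunit_pi (nv p))))).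
  rewrite mulr_suml; apply: eq_bigr => p _.
  by rewrite -mulrA -rmorphM -(svalP (cid (nonunit_pi (nv p)))).
apply: (@locallyM _ (gal h e)); first by rewrite -gal_closureM.
apply: (locallyM kh); apply: locallyT.
exists (y r *: (i w *: m)); first exact: xinv_span_xinv.
have <- : x r^-1%g *: (i e *: m) = y r *: (i w *: m).
  apply: (basis_inj cs nz_pi uE P_tf (g := r)).
  rewrite basis_xinv basis_basis gcompgV (cs1 cs) scale1r !scalerA -!rmorphM.
  by rewrite mulrC wE mulrC.
by rewrite basis_basis /r gcomp_invM gcompKV basis_scal_comm.
Qed.

(** Modulo x_h J, the map t multiplies x_h P by the partial trace of c over the class of h, a unit
    at M; and pi P lies in x_h J. *)
Lemma chain_step h m : pi_image (t m) -> locally (x_image h) m ->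
  locally (xJ_image h) m.
Proof.
move=> tm [s Ms [m' mE]]; apply: (locallyM Ms); set n := i s *: m in mE *.
have tn : pi_image (t n).
  rewrite /n (average_scal hV hK hl cs LD LZ).
  by apply: (submodZ pi_image_submod).
pose T := \sum_(k | cocycle_sim f M k h) gal k c.
have MT : ~~ M T.
  rewrite /T rmorph_sum.
  have := c_unit (gcomp g h); rewrite /partial_trace.
  rewrite (reindex_inj (mulIg g)) /=.
  rewrite (eq_bigl (fun k => cocycle_sim f M k h)) => [|k].
    by rewrite (eq_bigr (fun k => gal g (gal k c))) // => k _; rewrite -gal_closureM.
  rewrite /cocycle_sim -/(gcomp g k) gal_closureM.
  suff -> : gcomp (gcomp g k)^-1%g (gcomp g h) = gcomp k^-1%g h by [].
  by rewrite /gcomp invMg mulgA mulgK.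
apply: (locallyM MT).
have -> : i T *: n = t n - \sum_k i (gal k c) *:
    (tr_piece k n - (if cocycle_sim f M k h then n else 0)).
  rewrite averageE -sumrB /T rmorph_sum scaler_suml [LHS]big_mkcond /=.
  apply: eq_bigr => k _; rewrite -scalerBr subKr.
  by case: ifP => _; rewrite ?scaler0.
apply: locallyD; first exact: xJ_image_submod.
  by apply: locallyT; apply: pi_xJ_image.
rewrite -scaleN1r -(rmorphN1 i); apply: locallyZ; first exact: xJ_image_submod.
apply: locally_sum => [|k]; first exact: xJ_image_submod.
apply: locallyZ; first exact: xJ_image_submod.
(* Three cases. If k <= h fails, the piece takes values in x_k P, which lies in x_h J. If k and h
   are equivalent, it is the identity modulo x_k J, which lies in x_h J. If k is strictly below h,
   then n lies in x_k J, which the piece sends into pi P. *)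
rewrite (cocycle_simE fC mM); case: (boolP (le k h)) => [kh|nkh] /=; last first.
  by rewrite subr0; apply: nle_xJ_image.
case: (boolP (le h k)) => [hk|nhk] /=.
  apply: (locallyM kh); rewrite scalerBr -tr_piece_scal.
  have -> : i (f k (gcomp k^-1%g h)) *: n = x k *: (x (gcomp k^-1%g h) *: m').
    by rewrite basis_basis gcompKV mE.
  have [j Jj ->] := tr_piece_x k (x (gcomp k^-1%g h) *: m').
  exact: le_xJ_image.
rewrite subr0.
have [s' Ms' [j Jj jE]] := nle_xJ_image m' nhk.
apply: (locallyM Ms'); rewrite -tr_piece_scal mE jE.
by apply: locallyT; apply: pi_xJ_image; apply: tr_piece_xJ.
Qed.

(** An element of x_h J is a sum of terms x_h y_k a_k. If h k^-1 <= h the term is locally in pi P;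
    otherwise h k^-1 is strictly above h and the term lies in x_(h k^-1) P. So m falls into a
    smaller member of the chain, where [chain_step] applies again, until nothing is strictly above
    h. *)
Lemma chain_descent h m : pi_image (t m) -> locally (x_image h) m ->
  locally pi_image m.
Proof.
move=> tm; have [n] := ubnP #|[set k | le h k]|; elim: n h => // n IHn h hn hm.
have [s Ms [_ [a ->] mE]] := chain_step tm hm.
have termE k : x h *: (y k *: a k)
    = i (gal h (u k) * f h k^-1%g) *: (x (gcomp h k^-1%g) *: a k).
  by rewrite /xinv -scalerA basis_scal_comm basis_basis !scalerA -rmorphM.
case: (pickP (fun k => ~~ le k h)) => [k0 bad0|good]; last first.
  apply: (locallyM Ms); rewrite mE scaler_sumr.
  apply: locally_sum => [|k]; first exact: pi_image_submod.
  have := good (gcomp h k^-1%g) => /negbFE; rewrite /cocycle_le.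
  rewrite (_ : gcomp (gcomp h k^-1%g)^-1%g h = k); last first.
    by rewrite /gcomp invMg invgK mulKVg.
  move=> kh; apply: (locallyM kh); apply: locallyT.
  exists (x (gcomp h k^-1%g) *: a k).
  by rewrite basis_pi_comm -(basis_xinv k) basis_basis gcompVK.
(* Among the elements strictly above h, one with the largest upper set is the least by totality, so
   x_k P locally contains all the terms. *)
have [k bad kmax] := @arg_maxnP _ k0 (fun k => ~~ le k h)
  (fun k => #|[set k' | le k k']|) bad0.
have k_least k' : ~~ le k' h -> le k k'.
  move=> bad'; apply: contraT => nkk'.
  have k'k := le_total nkk'.
  have : (#|[set k1 | le k' k1]| <= #|[set k1 | le k k1]|)%N := kmax _ bad'.
  rewrite leqNgt => /negP[]; apply: proper_card.
  apply/properP; split.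
    by apply/subsetP => k1; rewrite !inE; apply: (cocycle_le_trans fC mM).
  by exists k'; rewrite !inE ?(cocycle_le_refl fC mM).
apply: (IHn k).
  rewrite ltnS in hn; apply: leq_trans hn; apply: proper_card; apply/properP; split.
    apply/subsetP => k1; rewrite !inE; apply: (cocycle_le_trans fC mM).
    exact: le_total.
  by exists h; rewrite !inE ?(cocycle_le_refl fC mM).
apply: (locallyM Ms); rewrite mE scaler_sumr.
apply: locally_sum => [|k']; first exact: x_image_submod.
case: (boolP (le (gcomp h k'^-1%g) h)) => [kh|nkh].
  apply: (locally_sub (@pi_x_image k)).
  move: kh; rewrite /cocycle_le.
  rewrite (_ : gcomp (gcomp h k'^-1%g)^-1%g h = k'); last first.
    by rewrite /gcomp invMg invgK mulKVg.
  move=> kh; apply: (locallyM kh); apply: locallyT.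
  exists (x (gcomp h k'^-1%g) *: a k').
  by rewrite basis_pi_comm -(basis_xinv k') basis_basis gcompVK.
rewrite termE; apply: locallyZ; first exact: x_image_submod.
by apply: le_x_image; apply: k_least.
Qed.

End Local.

(** The descent starts at h = 1, where x_1 P = P; [ideal_unit] removes the local multipliers. *)
Lemma average_pi_image m : pi_image (t m) -> pi_image m.
Proof.
move=> tm; have [||g|] := @ideal_unit F V K hV hK M0 mM0 (fun s => pi_image (i s *: m)).
- by move=> r s rm sm; rewrite rmorphD scalerDl; apply: (submodD pi_image_submod).
- by move=> r s sm; rewrite rmorphM -scalerA; apply: (submodZ pi_image_submod).
- have [|s Ms sm] := @chain_descent g 1%g m tm; last by exists s.
  by apply: locallyT; exists m; rewrite (cs1 cs) scale1r.
by move=> n; rewrite rmorph1 scale1r => ->; exists n.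
Qed.

End Chain.

Section CrossedProjective.
Variables (F : fieldType) (V : subringClosed F) (K : splittingFieldType F).
Hypothesis hV : valuation_ring V.
Hypothesis hK : galois 1 {:K}.
Local Notation G := (gal_of {:K}).
Local Notation St := (subring_type (integral_closure V K)).
Local Notation Vt := (subring_type V).
Local Notation gal := (@gal_closure F V K).
Local Notation base := (@base_to_closure F V K).
Variable f : G -> G -> St.
Hypothesis fC : integral_cocycle f.
Variable l : seq (St * St).
Hypothesis hl : forall g, \sum_(p <- l) p.1 * gal g p.2 = (g == 1%g)%:R.
Variable M0 : St -> bool.
Hypothesis mM0 : is_max M0.
Variables (R : nzRingType) (i : {rmorphism St -> R}) (x : G -> R).
Hypothesis cs : crossed_system f i x.
Variable P : lmodType R.
Hypothesis P_tf : forall s (m : P), s != 0 -> i s *: m = 0 -> m = 0.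
Hypothesis P_fg : finitely_generated P.
Local Notation PV := (restriction P (i \o base)).

Lemma trace_unit : exists c, trace hV hK c \is a GRing.unit.
Proof.
apply: contrapT => nE; case/negP: (max1 mM0).
rewrite (trace_dual hV hK hl 1); apply: max_sum => // p _; apply: maxMl => //.
rewrite (base_max hV hK mM0) mulr1; apply/negP => U; apply: nE; by exists p.2.
Qed.

Lemma restriction_fg : exists s : seq PV, forall m : PV, spans s m.
Proof.
have [s sE] := P_fg.
exists [seq i pg.1.1 *: (x pg.2 *: m) : PV |
         pg <- [seq (p, g) | p <- l, g <- index_enum G], m <- s] => m.
have [a ->] := sE m; apply: spans_sum => k _.
have [b ->] := cs_gen cs (a k); rewrite scaler_suml; apply: spans_sum => g _.
rewrite {1}(trace_dual hV hK hl (b g)) rmorph_sum !mulr_suml scaler_suml big_seq.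
apply: spans_sum => p lp.
set v := trace _ _ _.
have -> : (i (p.1 * base v) * x g) *: s`_k
    = v *: (i p.1 *: (x g *: s`_k) : PV).
  by rewrite mulrC rmorphM -!scalerA.
apply: spansZ; apply: spans_mem; apply/allpairsP.
exists ((p, g), s`_k); split=> //; last exact: mem_nth.
by apply: allpairs_f => //; exact: mem_index_enum.
Qed.

Lemma restriction_tf (v : Vt) (m : PV) : v != 0 -> v *: m = 0 -> m = 0.
Proof. by move=> nzv; apply: P_tf; rewrite base_eq0. Qed.

(** Here pi = 1 and J = P, so L can be the identity, written in coordinates; its average is
    multiplication by the trace of c, which can be made a unit. *)
Lemma projective_of_units (u : G -> St) :
  (forall g, u g * f g^-1%g g = 1) -> projective P.
Proof.
move=> u1; have uE g : u g * f g^-1%g g = base 1 by rewrite rmorph1.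
have [s sP] := restriction_fg.
have [e1 [e2 [eP _ _ e_free]]] := @adapted_basis F V hV PV (fun=> True) s s
  (fun _ _ _ _ => I) (fun _ _ _ => I) (fun _ _ _ => I) sP (fun _ _ => I)
  (fun m _ => sP m).
set e := e1 ++ e2 in eP e_free.
pose co := bcoord eP.
have coD j m n : (j < size e)%N -> co (m + n) j = co m j + co n j.
  by move=> je; apply: (bcoordD hV eP e_free restriction_tf).
have coZ j v m : (j < size e)%N -> co (v *: m) j = v * co m j.
  by move=> je; apply: (bcoordZ hV eP e_free restriction_tf).
have [c Uc] := trace_unit.
pose D (j : 'I_(size e)) (m : P) : Vt := co m j.
have nz1 : (1 : Vt) != 0 by rewrite oner_neq0.
apply: (@projective_criterion F V K hV hK f fC l hl R i x cs 1 u nz1 uE P P_tf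
  (size e) (fun j => e`_j) D _ _ c).
- by move=> j m n _ _; apply: coD.
- by move=> j v m _; apply: coZ.
have LE m : combine i D (fun j : 'I_(size e) => e`_j : P) m = m by exact: (bcoordE eP m).
have tE m : average l i x u (combine i D (fun j : 'I_(size e) => e`_j : P)) c m
    = i (base (trace hV hK c)) *: m.
  rewrite traceE rmorph_sum scaler_suml; apply: eq_bigr => g _.
  have -> : casimir_average l i (combine i D (fun j : 'I_(size e) => e`_j : P))
     (xinv i x u g *: m) = xinv i x u g *: m.
    rewrite -[RHS](coords_split hl i); apply: eq_bigr => p _.
    by rewrite LE.
  rewrite (basis_scal_comm cs) (basis_xinv fC cs uE).
  by rewrite (rmorph1 base) (rmorph1 i) scale1r.
exists (fun m => i (base (trace hV hK c)^-1) *: m) => m; rewrite tE scalerA -!rmorphM.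
  by rewrite mulVr // !rmorph1 scale1r.
by rewrite mulrV // !rmorph1 scale1r.
Qed.

Lemma projective_of_square_free (pi : Vt) (u : G -> St) :
    pi != 0 -> nonunit pi -> (forall v, nonunit v -> exists w, v = w * pi) ->
    (forall g, u g * f g^-1%g g = base pi) ->
    (forall r g a b s, ~~ M0 (gal g s) -> M0 (gal g a) -> M0 (gal g b) ->
       s * f r r^-1%g <> a * b) ->
  projective P.
Proof.
move=> nz_pi n_pi nonunit_pi uE sq_free.
have [s sP] := restriction_fg.
pose JP : P -> Prop := @xinv_span F V K R i x u P.
pose J : PV -> Prop := JP.
have JD m n : J m -> J n -> J (m + n) by exact: xinv_spanD.
have JZ (v : Vt) (m : PV) : J m -> J (v *: m) by exact: (xinv_span_scal cs).
have JV (v : Vt) (m : PV) : nonunit v -> J (v *: m).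
  move=> /nonunit_pi[w ->]; rewrite -scalerA; apply: JZ.
  exact: (xinv_span_pi cs uE m).
pose sJ : seq PV := [seq xinv i x u g *: m : PV | g <- index_enum G, m <- s].
have sJJ m : m \in sJ -> J m.
  by case/allpairsP=> -[g n] [_ _ ->]; exact: xinv_span_xinv.
have JsJ m : J m -> spans sJ m.
  case=> n ->; apply: spans_sum => g _.
  have [v ->] := sP (n g); rewrite scaler_sumr; apply: spans_sum => k _.
  have -> : xinv i x u g *: (v k *: s`_k : P) = v k *: (xinv i x u g *: (s`_k : P) : PV).
    change (xinv i x u g *: (i (base (v k)) *: (s`_k : P))
            = i (base (v k)) *: (xinv i x u g *: (s`_k : P))).
    by rewrite !scalerA (xinv_scal cs) gal_closure_base.
  apply: spansZ; apply: spans_mem; apply: allpairs_f; last exact: mem_nth.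
  exact: mem_index_enum.
have [e1 [e2 [eP Je2 e1J e_free]]] := adapted_basis hV JD JZ JV sP sJJ JsJ.
set e := e1 ++ e2 in eP e_free.
pose co := bcoord eP.
have e1e j : (j < size e1)%N -> (j < size e)%N.
  by move=> je; rewrite size_cat (leq_trans je) // leq_addr.
have coD j m n : (j < size e)%N -> co (m + n) j = co m j + co n j.
  by move=> je; apply: (bcoordD hV eP e_free restriction_tf).
have coZ j v m : (j < size e)%N -> co (v *: m) j = v * co m j.
  by move=> je; apply: (bcoordZ hV eP e_free restriction_tf).
have J_e2 v : J (lincomb v e2).
  apply: (@spans_closed _ _ J e2) => //; last by exists v.
  by rewrite -(scale0r (0 : PV)); apply: JV; exact: nonunit0.
have coE m : lincomb (co m) e1 + lincomb (fun j => co m (size e1 + j)%N) e2 = m.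
  by rewrite -lincomb_cat; exact: bcoordE.
(* The e1-coordinate divided by pi, possible on J; the default 0 can occur only outside J. Thus L
   (pi m) is the e1-part of m and differs from m by its e2-part, which lies in J. *)
pose D (j : 'I_(size e1)) (m : P) : Vt :=
  if pselect (exists w, co m j = w * pi) is left ex then sval (cid ex) else 0.
have DE j m : J m -> D j m * pi = co m j.
  move=> Jm; rewrite /D; case: pselect => [ex|[]].
    by rewrite -(svalP (cid ex)).
  apply: nonunit_pi; apply: (e1J (co m)) (ltn_ord j).
  rewrite -(addrK (lincomb (fun j => co m (size e1 + j)%N) e2) (lincomb _ e1)) coE.
  by apply: JD => //; rewrite -scaleN1r; apply: JZ.
have piI (v w : Vt) : v * pi = w * pi -> v = w.
  move=> /(congr1 base); rewrite !rmorphM /= ![_ * base pi]mulrC => E.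
  by apply: (@base_inj F V K); apply: mulSI E; rewrite base_eq0.
have DD j (m n : P) : JP m -> JP n -> D j (m + n) = D j m + D j n.
  move=> Jm Jn; apply: piI; rewrite mulrDl !DE ?coD ?e1e //.
  exact: JD.
have DZ j v (m : P) : JP m -> D j (i (base v) *: m) = v * D j m.
  move=> Jm; apply: piI; rewrite -mulrA !DE //; last exact: (JZ v m).
  exact/coZ/e1e.
pose z (j : 'I_(size e1)) : P := e1`_j.
pose L := combine i D z.
have LD (m n : P) : JP m -> JP n -> L (m + n) = L m + L n by exact: combineD.
have LZ v (m : P) : JP m -> L (i (base v) *: m) = i (base v) *: L m by exact: combineZ.
have Lpi (m : P) : JP (L (i (base pi) *: m) - m).
  have -> : L (i (base pi) *: m) = lincomb (co m) e1.
    apply: eq_bigr => j _; congr (i (base _) *: _); apply: piI.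
    by rewrite DE ?(coZ _ pi) ?e1e 1?mulrC //; exact: (xinv_span_pi cs uE).
  rewrite -{2}[m]coE opprD addrA subrr add0r; exact: (xinv_spanN cs (J_e2 _)).
have [c Mc] := partial_trace_unit fC mM0 hl.
apply: (@projective_criterion F V K hV hK f fC l hl R i x cs pi u nz_pi uE P P_tf
  (size e1) z D DD DZ c).
(* As J(V) = pi V, the radical of P over V is pi P, so [average_pi_image] is the injectivity modulo
   the radical required here. *)
apply: (radical_injective_bijective hV eP e_free restriction_tf).
- exact: (averageD l cs LD c).
- by move=> v m; exact: (averageZ hV hK fC hl cs nz_pi uE P_tf LD LZ c (i (base v)) m).
move=> m [w /nonunit_pi[w' ->] [m' tm]].
have [|m'' ->] := @average_pi_image F V K hV hK f fC l hl R i x cs pi u nz_pi uE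
  M0 mM0 nonunit_pi sq_free P P_tf L LD LZ Lpi c Mc m.
  exists (w' *: (m' : PV)); rewrite [LHS]tm mulrC -scalerA; by [].
by exists pi => //; exists m''.
Qed.

End CrossedProjective.

(** * The order and its opposite as crossed systems *)

Section OrderSystem.
Variables (F : fieldType) (V : subringClosed F) (K : splittingFieldType F).
Variable f : normalized_cocycle K.
Hypothesis hf : integral_values V f.
Local Notation G := (gal_of {:K}).
Local Notation S := (integral_closure V K).
Local Notation St := (subring_type S).
Local Notation gal := (@gal_closure F V K).
Local Notation A := (crossed_order hf).
Local Notation fS := (cocycleS hf).

Lemma cocycleS_integral : integral_cocycle fS.
Proof.
split=> [g|g|g h|g h k].
- by apply: val_inj; rewrite /= cocycle1l.
- by apply: val_inj; rewrite /= cocycle1r.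
- by rewrite -val_eq0 /= cocycle_neq0.
- by apply: val_inj; rewrite /= cocycleP.
Qed.

Fact order_basis_subproof (c : St) g :
  crossed_basis f (val c) g \in crossed_order_pred hf.
Proof.
by apply/forallP => h; rewrite ffunE; case: ifP => _; [exact: valP | exact: rpred0].
Qed.
Definition order_basis (c : St) g : A :=
  Sub (crossed_basis f (val c) g) (order_basis_subproof c g).

Definition order_coef (a : A) g : St := Sub (coef (val a) g) (forallP (valP a) g).

Lemma order_coef_inj a b : (forall g, order_coef a g = order_coef b g) -> a = b.
Proof.
by move=> ab; apply/val_inj/coef_inj/ffunP => g; exact: (congr1 val (ab g)).
Qed.

Lemma order_coef0 g : order_coef 0 g = 0.
Proof. by apply: val_inj; rewrite /= ffunE. Qed.

Lemma order_coefD a b g : order_coef (a + b) g = order_coef a g + order_coef b g.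
Proof. by apply: val_inj; rewrite /= ffunE. Qed.

Lemma order_coef_sum (I : Type) (r : seq I) (E : I -> A) g :
  order_coef (\sum_(k <- r) E k) g = \sum_(k <- r) order_coef (E k) g.
Proof.
elim: r => [|k r IHr]; first by rewrite !big_nil order_coef0.
by rewrite !big_cons order_coefD IHr.
Qed.

Lemma order_coef_basis c g h : order_coef (order_basis c g) h = if h == g then c else 0.
Proof. by apply: val_inj; rewrite /= ffunE; case: ifP. Qed.

Lemma order_decomp a : a = \sum_g order_basis (order_coef a g) g.
Proof.
apply: order_coef_inj => h; rewrite order_coef_sum (bigD1 h) //= big1 => [|g].
  by rewrite addr0 order_coef_basis eqxx.
by rewrite eq_sym order_coef_basis => /negPf->.
Qed.

Lemma order_basisM c d g h :
  order_basis c g * order_basis d h = order_basis (c * gal g d * fS g h) (gcomp g h).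
Proof. by apply: val_inj; exact: crossed_basisM. Qed.

Lemma order_basis1 : order_basis 1 1%g = 1.
Proof. by apply/val_inj/coef_inj/ffunP => g; rewrite !ffunE. Qed.

Lemma order_basisD c d g : order_basis (c + d) g = order_basis c g + order_basis d g.
Proof.
apply: order_coef_inj => h; rewrite order_coefD !order_coef_basis.
by case: ifP => _; rewrite ?addr0.
Qed.

Lemma order_basis0 g : order_basis 0 g = 0.
Proof.
by apply: order_coef_inj => h; rewrite order_coef_basis order_coef0; case: ifP.
Qed.

Lemma order_coefMl c g a h :
  order_coef (order_basis c g * a) (gcomp g h) = c * gal g (order_coef a h) * fS g h.
Proof.
rewrite {1}(order_decomp a) mulr_sumr order_coef_sum (bigD1 h) //= big1 => [|k nk].
  by rewrite addr0 order_basisM order_coef_basis eqxx.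
rewrite order_basisM order_coef_basis; case: eqP => // /(congr1 (gcomp g^-1%g)).
by rewrite !gcompK => hk; rewrite hk eqxx in nk.
Qed.

Lemma order_coefMr c h a g :
  order_coef (a * order_basis c h) (gcomp g h) = order_coef a g * gal g c * fS g h.
Proof.
rewrite {1}(order_decomp a) mulr_suml order_coef_sum (bigD1 g) //= big1 => [|k nk].
  by rewrite addr0 order_basisM order_coef_basis eqxx.
rewrite order_basisM order_coef_basis; case: eqP => // /(congr1 (fun z : G => gcomp z h^-1%g)).
by rewrite /= !gcompV => hk; rewrite hk eqxx in nk.
Qed.

Definition order_scalar s := order_basis s 1%g.

Lemma order_scalarM s c g : order_scalar s * order_basis c g = order_basis (s * c) g.
Proof.
by rewrite order_basisM gal_closure1 gcomp1g (icocycle1l cocycleS_integral) mulr1.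
Qed.

Lemma order_basis_scalar c g s :
  order_basis c g * order_scalar s = order_basis (c * gal g s) g.
Proof. by rewrite order_basisM gcompg1 (icocycle1r cocycleS_integral) mulr1. Qed.

Lemma order_coef_scalar s a g : order_coef (order_scalar s * a) g = s * order_coef a g.
Proof.
rewrite -{1}(gcomp1g g) order_coefMl gal_closure1.
by rewrite (icocycle1l cocycleS_integral) mulr1.
Qed.

Lemma order_coef_scalar_r s a g :
  order_coef (a * order_scalar s) g = order_coef a g * gal g s.
Proof.
by rewrite -{1}(gcompg1 g) order_coefMr (icocycle1r cocycleS_integral) mulr1.
Qed.

Fact order_scalar_zmod : zmod_morphism order_scalar.
Proof.
move=> s t; apply: (addIr (order_scalar t)).
by rewrite subrK -order_basisD subrK.
Qed.
Fact order_scalar_monoid : monoid_morphism order_scalar.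
Proof. by split=> [|s t]; [exact: order_basis1 | rewrite order_scalarM]. Qed.
HB.instance Definition _ := GRing.isZmodMorphism.Build St A order_scalar
  order_scalar_zmod.
HB.instance Definition _ := GRing.isMonoidMorphism.Build St A order_scalar
  order_scalar_monoid.

Lemma order_system : crossed_system fS order_scalar (order_basis 1).
Proof.
split=> [|g s|g h|a].
- exact: order_basis1.
- by rewrite /= order_basis_scalar order_scalarM mul1r mulr1.
- by rewrite /= order_basisM order_scalarM rmorph1 !mul1r mulr1.
exists (order_coef a); rewrite {1}(order_decomp a).
by apply: eq_bigr => g _; rewrite /= order_scalarM mulr1.
Qed.

Lemma order_tf s (a : A) : s != 0 -> order_scalar s * a = 0 -> a = 0.
Proof.
move=> nzs sa; apply: order_coef_inj => g; rewrite order_coef0.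
apply: (mulSI nzs); rewrite mulr0 -order_coef_scalar sa; exact: order_coef0.
Qed.

(* The opposite ring of A is again a crossed-product order, with basis
   x_(g^-1) and this cocycle. *)
Definition opp_cocycle g h := gal (gcomp g h) (fS h^-1%g g^-1%g).

Lemma opp_cocycle_integral : integral_cocycle opp_cocycle.
Proof.
have fC := cocycleS_integral.
split=> [g|g|g h|g h k]; rewrite /opp_cocycle.
- by rewrite invg1 (icocycle1r fC) rmorph1.
- by rewrite invg1 (icocycle1l fC) rmorph1.
- by rewrite gal_closure_eq0; exact: (icocycle_neq0 fC).
have E z : gal (gcomp g h) z = gal (gcomp (gcomp g h) k) (gal k^-1%g z).
  by rewrite -gal_closureM gcompV.
rewrite -[gal g (gal _ _)]gal_closureM gcompA E -!rmorphM; congr (gal _ _).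
have := icocycleP fC k^-1%g h^-1%g g^-1%g.
by rewrite /gcomp !invMg mulrC => <-; rewrite mulrC.
Qed.

(** Square-freeness concerns only these values, so it passes to the opposite order unchanged. *)
Lemma opp_cocycle_diag g : opp_cocycle g g^-1%g = fS g g^-1%g.
Proof. by rewrite /opp_cocycle gcompgV gal_closure1 invgK. Qed.

Definition opp_scalar (s : St) : A^c := order_scalar s.
Definition opp_basis g : A^c := order_basis 1 g^-1%g.

Fact opp_scalar_zmod : zmod_morphism opp_scalar.
Proof. exact: order_scalar_zmod. Qed.
Fact opp_scalar_monoid : monoid_morphism opp_scalar.
Proof.
split=> [|s t]; first exact: order_basis1.
by rewrite -[RHS]/(order_scalar t * order_scalar s) order_scalarM mulrC.
Qed.
HB.instance Definition _ := GRing.isZmodMorphism.Build St A^c opp_scalar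
  opp_scalar_zmod.
HB.instance Definition _ := GRing.isMonoidMorphism.Build St A^c opp_scalar
  opp_scalar_monoid.

Lemma opp_mulE (a b : A) : (a : A^c) * (b : A^c) = b * a. Proof. by []. Qed.

Lemma opp_system : crossed_system opp_cocycle opp_scalar opp_basis.
Proof.
split=> [|g s|g h|a].
- by rewrite /opp_basis invg1; exact: order_basis1.
- rewrite /= /opp_basis /opp_scalar !opp_mulE order_basis_scalar order_scalarM.
  by rewrite gal_closureK mulr1 mul1r.
- rewrite /= /opp_basis /opp_scalar !opp_mulE order_basisM order_basis_scalar.
  rewrite rmorph1 !mul1r; have -> : (gcomp g h)^-1%g = gcomp h^-1%g g^-1%g.
    by rewrite /gcomp invMg.
  rewrite /opp_cocycle -gal_closureM.
  have -> : gcomp (gcomp h^-1%g g^-1%g) (gcomp g h) = 1%g.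
    by rewrite /gcomp mulgA mulgK mulgV.
  by rewrite gal_closure1.
exists (fun g => gal g (order_coef a g^-1%g)).
rewrite {1}(order_decomp a) (reindex_inj invg_inj) /=; apply: eq_bigr => g _.
by rewrite /opp_basis /opp_scalar opp_mulE order_basis_scalar gal_closureK mul1r.
Qed.

Lemma opp_tf s (a : A^c) : s != 0 -> opp_scalar s * a = 0 -> a = 0.
Proof.
rewrite opp_mulE => nzs sa; apply: order_coef_inj => g; rewrite order_coef0.
have nzgs : gal g s != 0 by rewrite gal_closure_eq0.
apply: (mulSI nzgs); rewrite mulr0 mulrC -order_coef_scalar_r sa; exact: order_coef0.
Qed.

End OrderSystem.

(** * The square-freeness condition *)

Section Sufficiency.
Variables (F : fieldType) (V : subringClosed F) (K : splittingFieldType F).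
Hypothesis hV : valuation_ring V.
Hypothesis hK : galois 1 {:K}.
Local Notation G := (gal_of {:K}).
Local Notation S := (integral_closure V K).
Local Notation St := (subring_type S).
Local Notation Vt := (subring_type V).
Local Notation gal := (@gal_closure F V K).
Local Notation base := (@base_to_closure F V K).
Variable l : seq (St * St).
Hypothesis hl : forall g, \sum_(p <- l) p.1 * gal g p.2 = (g == 1%g)%:R.
Variable M0 : St -> bool.
Hypothesis mM0 : is_max M0.

Lemma common_divisor (I : eqType) (r : seq I) (v : I -> Vt) :
    (forall k, nonunit (v k)) ->
  exists2 w, nonunit w & forall k, k \in r -> exists z, v k = z * w.
Proof.
move=> nv; elim: r => [|k r [w nw wr]]; first by exists 0 => //; exact: nonunit0.
have [[z zE]|[z zE]] := base_div hV (v k) w.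
  exists w => // k'; rewrite inE => /predU1P[->|/wr//]; by exists z.
exists (v k) => // k'; rewrite inE => /predU1P[->|/wr[z' ->]].
  by exists 1; rewrite mul1r.
by exists (z' * z); rewrite zE mulrA.
Qed.

Definition generates_nonunits (pi : Vt) :=
  nonunit pi /\ forall v, nonunit v -> exists w, v = w * pi.

Variable d : G -> St.
Hypothesis nz_d : forall r, d r != 0.
Hypothesis sq_free : forall r g a b s, ~~ M0 (gal g s) -> M0 (gal g a) ->
  M0 (gal g b) -> s * d r <> a * b.

(** At a conjugate M write c pi = b d_r with b or c outside M. If c were in M, then b would not be,
    and b d_r = c pi would be a product of two elements of M. The multipliers c are combined by
    [ideal_unit]. *)
Lemma square_free_dvd pi r : pi != 0 -> generates_nonunits pi ->
  exists u, u * d r = base pi.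
Proof.
move=> nz_pi [n_pi gen_pi].
have [||g|u uE] := @ideal_unit F V K hV hK M0 mM0
    (fun s => exists u, u * d r = s * base pi).
- by move=> s t [u uE] [w wE]; exists (u + w); rewrite !mulrDl uE wE.
- by move=> s t [u uE]; exists (s * u); rewrite -!mulrA uE.
- have [b [c [cE Mbc]]] := local_valuation hV (val (d r) / val (base pi)) (conj_max mM0 g).
  have {}cE : c * base pi = b * d r.
    apply: val_inj; rewrite !valSM cE -!mulrA mulVf ?mulr1 //.
    by rewrite val_eq0 base_eq0.
  case: (boolP (M0 (gal g c))) => [Mc|Mc]; last by exists c => //; exists b.
  move: Mbc; rewrite Mc orbF => Mb; case: (@sq_free r g c (base pi) b Mb Mc) => //.
  by rewrite gal_closure_base (base_max hV hK).
by exists u; rewrite uE mul1r.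
Qed.

(** If d_r lay in a conjugate M, then e d_r = U w with e outside M and w a nonunit of V. As w does
    not generate the nonunits, it is a product z v' of two nonunits, and e d_r = (U z) v'
    contradicts square-freeness. *)
Lemma square_free_unit r : (forall pi, pi != 0 -> ~ generates_nonunits pi) ->
  exists u, u * d r = 1.
Proof.
move=> npi.
have [||g|u uE] := @ideal_unit F V K hV hK M0 mM0 (fun s => exists u, u * d r = s).
- by move=> s t [u uE] [w wE]; exists (u + w); rewrite mulrDl uE wE.
- by move=> s t [u uE]; exists (s * u); rewrite -mulrA uE.
- exists (d r); first by exists 1; rewrite mul1r.
  apply/negP => Md; have [e Me [v [nv eE]]] := uniformizer hV hK hl mM0 Md.
  have [w nw wE] := common_divisor l nv.
  have {eE} [U eE] : exists U, e * d r = U * base w.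
    rewrite eE big_seq; elim/big_ind: _ => [|x y [a ->] [b ->]|p /wE[z ->]].
    - by exists 0; rewrite mul0r.
    - by exists (a + b); rewrite mulrDl.
    - by exists (p.1 * base z); rewrite rmorphM mulrA.
  (* This holds because e and d_r are nonzero; it also settles the case where V is a field and 0 is
     the only nonunit. *)
  have nzw : w != 0.
    apply: contraTneq (isT) => w0; move/eqP: eE; rewrite w0 rmorph0 mulr0 mulS_eq0.
    rewrite (negPf (nz_d r)) orbF => /eqP e0.
    by move: Me; rewrite e0 rmorph0 (max0 mM0).
  have [v' nv' v'w] : exists2 v', nonunit v' & ~ exists z, v' = z * w.
    apply: contrapT => nE; apply: (npi w nzw); split=> // v' nv'.
    by apply: contrapT => nz; apply: nE; exists v'.
  have [//|[z zE]] := base_div hV v' w.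
  have nz : nonunit z.
    apply/negP => Uz; case: v'w; exists z^-1.
    by rewrite zE mulrA mulVr // mul1r.
  apply: (@sq_free r g (U * base z) (base v') e Me).
  - rewrite rmorphM; apply: maxMl => //.
    by rewrite /= gal_closure_base (base_max hV hK).
  - by rewrite gal_closure_base (base_max hV hK).
  - by rewrite eE zE rmorphM mulrA.
by exists u.
Qed.

Lemma crossed_left_semihereditary (f : G -> G -> St) (R : nzRingType)
    (i : {rmorphism St -> R}) (x : G -> R) :
    integral_cocycle f -> (forall r, f r r^-1%g = d r) -> crossed_system f i x ->
    (forall s r, s != 0 -> i s * r = 0 -> r = 0) ->
  left_semihereditary R.
Proof.
move=> fC fd cs R_tf I I_fg.
have I_tf s (m : submod I) : s != 0 -> i s *: m = 0 -> m = 0.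
  move=> nzs /(congr1 val) im; apply: val_inj; exact: (R_tf s _ nzs im).
have fdV g : f g^-1%g g = d g^-1%g by rewrite -fd invgK.
have sqf r g a b s : ~~ M0 (gal g s) -> M0 (gal g a) -> M0 (gal g b) ->
  s * f r r^-1%g <> a * b by rewrite fd; apply: sq_free.
case: (pselect (exists pi, pi != 0 /\ generates_nonunits pi)) => [[pi [nz_pi gpi]]|npi].
  pose u g := sval (cid (square_free_dvd g^-1%g nz_pi gpi)).
  have uE g : u g * f g^-1%g g = base pi.
    by rewrite fdV; exact: svalP (cid (square_free_dvd g^-1%g nz_pi gpi)).
  have [n_pi gen_pi] := gpi.
  exact: (projective_of_square_free hV hK fC hl mM0 cs I_tf I_fg nz_pi n_pi gen_pi uE).
have npi' pi : pi != 0 -> ~ generates_nonunits pi.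
  by move=> nz_pi gpi; apply: npi; exists pi.
pose u g := sval (cid (square_free_unit g^-1%g npi')).
have uE g : u g * f g^-1%g g = 1.
  by rewrite fdV; exact: svalP (cid (square_free_unit g^-1%g npi')).
exact: (projective_of_units hV hK fC hl mM0 cs I_tf I_fg uE).
Qed.

End Sufficiency.

Section SquareIdeal.
Variable S : comNzRingType.

Lemma in_ideal_square_locally (M : submodClosed S^o) (N : S -> bool) z s a b :
    (forall x, (x \in M) = N x) -> is_max N ->
    ~~ N s -> N a -> N b -> s * z = a * b -> in_ideal_square M z.
Proof.
move=> MN mN Ns Na Nb sz.
have Nz : N z.
  have : N (s * z) by rewrite sz; apply: maxMr.
  by rewrite max_prime // (negPf Ns).
have [r Nr] := max_inv mN Ns.
(* Here z = (r a) b + (1 - r s) z with r inverse to s modulo the ideal; z itself lies in the ideal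
   because s z does. *)
exists [:: (r * a, b); (1 - r * s, z)]; split.
  move=> p; rewrite !inE => /orP[]/eqP-> /=; rewrite !MN //.
  by split=> //; apply: maxMl.
rewrite !big_cons big_nil addr0 /= -mulrA -sz; ring.
Qed.

Lemma in_ideal_square_Ml (M : submodClosed S^o) r x :
  in_ideal_square M x -> in_ideal_square M (r * x).
Proof.
move=> [s [sM ->]]; exists [seq (r * p.1, p.2) | p <- s]; split.
  move=> _ /mapP[p /sM[p1 p2] ->]; split=> //; exact: (@rpredZ S S^o M r).
by rewrite big_map mulr_sumr; apply: eq_bigr => p _; rewrite mulrA.
Qed.
End SquareIdeal.

Section LeftIdealSpan.
Variables (R : nzRingType) (s : seq R).
Definition left_span : {pred R^o} :=
  fun y => `[< exists c : 'I_(size s) -> R, y = \sum_(k < size s) c k * s`_k >].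
Fact left_span_subproof : subsemimod_closed left_span.
Proof.
split; first split.
- by apply/asboolP; exists (fun=> 0); rewrite big1 // => k _; rewrite mul0r.
- move=> _ _ /asboolP[a ->] /asboolP[b ->]; apply/asboolP.
  exists (fun k => a k + b k); rewrite -big_split; apply: eq_bigr => k _.
  by rewrite mulrDl.
- move=> r _ /asboolP[a ->]; apply/asboolP; exists (fun k => r * a k).
  by rewrite scaler_sumr; apply: eq_bigr => k _; rewrite -mulrA.
Qed.
HB.instance Definition _ :=
  GRing.isSubmodClosed.Build R R^o left_span left_span_subproof.

Lemma mem_left_span (k : 'I_(size s)) : s`_k \in left_span.
Proof.
apply/asboolP; exists (fun j => if j == k then 1 else 0).
by rewrite (bigD1 k) //= eqxx mul1r big1 ?addr0 // => j /negPf->; rewrite mul0r.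
Qed.

Lemma left_span_fg : finitely_generated (submod left_span).
Proof.
pose gen k : submod left_span := Sub s`_(val k) (mem_left_span k).
exists [seq gen k | k <- enum 'I_(size s)] => -[y /[dup] /asboolP[c yE] sy].
have sz : size [seq gen k | k <- enum 'I_(size s)] = size s.
  by rewrite size_map size_enum_ord.
exists (fun k => c (cast_ord sz k)); apply: val_inj.
transitivity y => //; rewrite raddf_sum yE (reindex (cast_ord sz)) /=; last first.
  apply: onW_bij; exists (cast_ord (esym sz)); first exact: cast_ordK.
  exact: cast_ordKV.
apply: eq_bigr => k _ /=.
have ks : (k < size s)%N := ltn_ord (cast_ord sz k).
by rewrite (nth_map (cast_ord sz k)) ?size_enum_ord //= nth_enum_ord.
Qed.

(** A splitting of the free cover of the ideal. The coordinate functions are total on R, [insubd]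
    sending everything outside the ideal to 0, so their laws are stated on the ideal. *)
Lemma left_span_dual_basis : projective (submod left_span) ->
  exists phi : 'I_(size s) -> R -> R,
    (forall k r y, y \in left_span -> phi k (r * y) = r * phi k y) /\
    (forall k y z, y \in left_span -> z \in left_span ->
       phi k (y + z) = phi k y + phi k z) /\
    (forall y, y \in left_span -> y = \sum_k phi k y * s`_k).
Proof.
move=> pI; pose I := submod left_span.
pose gen k : I := Sub s`_(val k) (mem_left_span k).
pose g (c : 'rV[R]_(size s)) : I := \sum_k c 0 k *: gen k.
have gD c d : g (c + d) = g c + g d.
  by rewrite -big_split; apply: eq_bigr => k _; rewrite mxE scalerDl.
have gZ r c : g (r *: c) = r *: g c.
  by rewrite scaler_sumr; apply: eq_bigr => k _; rewrite mxE scalerA.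
have g_surj (y : I) : exists c, linear_map gD gZ c = y.
  have /asboolP[c yE] := valP y; exists (\row_k c k); apply: val_inj.
  rewrite /linear_map raddf_sum yE; apply: eq_bigr => k _ /=.
  by rewrite mxE.
have [h hE] := pI _ _ (linear_map gD gZ) idfun g_surj.
exists (fun k y => h (insubd 0 y) 0 k); split; [|split].
- move=> k r y Iy; have -> : insubd 0 (r * y) = r *: insubd 0 y :> I.
    apply: val_inj; rewrite val_insubd (@rpredZ R R^o left_span r) //=.
    by rewrite -/(val (insubd _ _)) val_insubd Iy.
  by rewrite linearZ mxE.
- move=> k y z Iy Iz; have -> : insubd 0 (y + z) = insubd 0 y + insubd 0 z :> I.
    by apply: val_inj; rewrite raddfD /= !val_insubd Iy Iz rpredD.
  by rewrite linearD mxE.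
- move=> y Iy; have vy : val (insubd 0 y : I) = y by rewrite val_insubd Iy.
  transitivity (val (g (h (insubd 0 y)))).
    by rewrite -{1}vy; congr (val _); symmetry; exact: hE.
  by rewrite raddf_sum; apply: eq_bigr => k _.
Qed.
End LeftIdealSpan.

Section Necessity.
Variables (F : fieldType) (V : subringClosed F) (K : splittingFieldType F).
Variable f : normalized_cocycle K.
Hypothesis hf : integral_values V f.
Local Notation G := (gal_of {:K}).
Local Notation S := (integral_closure V K).
Local Notation St := (subring_type S).
Local Notation gal := (@gal_closure F V K).
Local Notation A := (crossed_order hf).
Local Notation fS := (cocycleS hf).
Local Notation basis := (order_basis hf).
Local Notation coefA := (@order_coef F V K f hf).

(* If f(t, t^-1) = sum_j b_j a_j lies in M^2, the left ideal generated by
   x_(t^-1) and the a_j has no dual basis: applying one to f(t, t^-1) and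
   taking the coefficient at 1 gives 1 in M. *)
Lemma semihereditary_not_square (t : G) (M : submodClosed St^o) :
  left_semihereditary A -> maximal_left_ideal M ->
  ~ in_ideal_square M (fS t t^-1%g).
Proof.
move=> hA /maximal_is_max mM [ab [abM fE]].
have fC := cocycleS_integral hf.
pose s := basis 1 t^-1%g :: [seq order_scalar hf p.1 | p <- ab].
have [phi [phiZ [phiD phiE]]] := left_span_dual_basis (hA _ (left_span_fg s)).
pose k0 : 'I_(size s) := ord0.
pose z := order_scalar hf (fS t t^-1%g).
have xI : basis 1 t^-1%g \in left_span s by exact: (mem_left_span k0).
have aI p : p \in ab -> order_scalar hf p.1 \in left_span s.
  move=> pab; have ks : ((index p ab).+1 < size s)%N.
    by rewrite /= size_map ltnS index_mem.
  have := mem_left_span (Ordinal ks).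
  by rewrite /= (nth_map p) ?index_mem // nth_index.
have zE : z = basis 1 t * basis 1 t^-1%g.
  by rewrite order_basisM rmorph1 !mul1r gcompgV.
have zI : z \in left_span s by rewrite zE; exact: (@rpredZ A A^o (left_span s)).
have phi_z k : phi k z = basis 1 t * phi k (basis 1 t^-1%g) by rewrite zE phiZ.
have phi0 k : phi k 0 = 0 by rewrite -(mul0r (0 : A)) phiZ ?mul0r ?rpred0.
have phi_z' k : phi k z
    = \sum_(p <- ab) order_scalar hf p.2 * phi k (order_scalar hf p.1).
  have -> : z = \sum_(p <- ab) order_scalar hf p.2 * order_scalar hf p.1.
    rewrite /z fE rmorph_sum; apply: eq_bigr => p _.
    by rewrite mulrC rmorphM.
  rewrite big_seq [RHS]big_seq.
  suff [//] : phi k (\sum_(p <- ab | p \in ab) order_scalar hf p.2 * order_scalar hf p.1)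
     = \sum_(p <- ab | p \in ab) order_scalar hf p.2 * phi k (order_scalar hf p.1)
     /\ \sum_(p <- ab | p \in ab) order_scalar hf p.2 * order_scalar hf p.1 \in left_span s.
  elim/big_rec2: _ => [|p y1 y2 pab [IH1 IH2]]; first by rewrite phi0 rpred0.
  have pI : order_scalar hf p.2 * order_scalar hf p.1 \in left_span s.
    by apply: (@rpredZ A A^o (left_span s)); exact: aI.
  by rewrite phiD // IH1 phiZ ?aI // rpredD.
have coef_z : coefA z 1%g = fS t t^-1%g by rewrite order_coef_basis eqxx.
have nzf := icocycle_neq0 fC t t^-1%g.
(* Two expressions of z serve complementary terms: z = x_t x_(t^-1) for the coordinates along the
   a_j, and z = sum b_j a_j for the one along x_(t^-1). In each, f(t, t^-1) factors out and leaves
   an element of M, so f(t, t^-1) = f(t, t^-1) m with m in M. *)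
have coef_x k : coefA (phi k z) 1%g
    = fS t t^-1%g * gal t (coefA (phi k (basis 1 t^-1%g)) t^-1%g).
  by rewrite phi_z -{1}(gcompgV t) order_coefMl mul1r mulrC.
have coef_0 : coefA (phi k0 z * basis 1 t^-1%g) 1%g
    = fS t t^-1%g * \sum_(p <- ab) p.2 * coefA (phi k0 (order_scalar hf p.1)) t.
  rewrite -{1}(gcompgV t) order_coefMr rmorph1 mulr1 mulrC; congr (_ * _).
  rewrite phi_z' order_coef_sum; apply: eq_bigr => p _.
  by rewrite order_coef_scalar.
suff [m Mm mE] : exists2 m, m \in M & fS t t^-1%g = fS t t^-1%g * m.
  case/negP: (max1 mM); have -> // : 1 = m.
  by apply: (mulSI nzf); rewrite mulr1.
pose b k := (nth (0, 0) ab k).1.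
have bM k : (k < size ab)%N -> b k \in M.
  by move=> kab; have [] := abM _ (mem_nth (0, 0) kab).
have sab (k : 'I_(size s).-1) : (k < size ab)%N.
  by apply: leq_trans (ltn_ord k) _; rewrite /= size_map.
have bE (k : 'I_(size s).-1) : s`_(lift k0 k) = order_scalar hf (b k).
  rewrite -[LHS]/(nth 0 [seq order_scalar hf p.1 | p <- ab] k).
  by rewrite (nth_map (0, 0)) ?sab.
exists (\sum_(p <- ab) p.2 * coefA (phi k0 (order_scalar hf p.1)) t
   + \sum_(k < (size s).-1) gal t (coefA (phi (lift k0 k) (basis 1 t^-1%g)) t^-1%g) * b k).
  apply: rpredD.
    rewrite big_seq; apply: rpred_sum => p pab; rewrite mulrC.
    by apply: (@rpredZ St St^o M); have [] := abM p pab.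
  by apply: rpred_sum => k _; apply: (@rpredZ St St^o M); exact/bM/sab.
have := congr1 (fun a => coefA a 1%g) (phiE z zI); rewrite coef_z => {1}->.
rewrite order_coef_sum big_ord_recl /= coef_0 mulrDr; congr (_ + _).
rewrite mulr_sumr; apply: eq_bigr => k _.
rewrite -[nth _ _ _]/(s`_(lift k0 k)) bE order_coef_scalar_r gal_closure1 coef_x.
by rewrite mulrA.
Qed.
End Necessity.

(** * Azumaya orders *)

Section Tensor.
Local Open Scope quotient_scope.
Variables (R : comNzRingType) (M N : lmodType R).

(** The quotient by [tensor_eq], as a commutative monoid, turns tensor identities into identities
    between iterated sums. *)
Definition tensor_rel (s t : seq (M * N)) : bool := `[< tensor_eq s t >].
Fact tensor_rel_equiv : equiv_class_of tensor_rel.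
Proof.
split=> [s|s t|t s u].
- exact/asboolP/tensor_refl.
- by apply/asboolP/asboolP => /tensor_sym.
- by move=> /asboolP st /asboolP tu; apply/asboolP; exact: tensor_trans tu.
Qed.
Canonical tensor_rel_canonical := EquivRelPack tensor_rel_equiv.
Definition tensor := {eq_quot tensor_rel}.
HB.instance Definition _ := Choice.on tensor.
HB.instance Definition _ := EqQuotient.on tensor.

Lemma tensor_piP s t : reflect (tensor_eq s t) (\pi_tensor s == \pi_tensor t).
Proof. by rewrite eqmodE; exact: asboolP. Qed.

Lemma tensor_repr s : tensor_eq (repr (\pi_tensor s)) s.
Proof. by apply/tensor_piP; rewrite reprK. Qed.

Definition tensor_add (x y : tensor) : tensor := \pi_tensor (repr x ++ repr y).
Definition tensor_zero : tensor := \pi_tensor [::].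

Lemma tensor_addE s t : tensor_add (\pi_tensor s) (\pi_tensor t) = \pi_tensor (s ++ t).
Proof. by apply/eqP/tensor_piP/tensor_cat; exact: tensor_repr. Qed.

Fact tensor_addA : associative tensor_add.
Proof.
move=> x y z; rewrite -[x]reprK -[y]reprK -[z]reprK (tensor_addE (repr y)).
by rewrite (tensor_addE (repr x) (repr y)) !tensor_addE catA.
Qed.
Fact tensor_addC : commutative tensor_add.
Proof.
move=> x y; rewrite -[x]reprK -[y]reprK !tensor_addE.
by apply/eqP/tensor_piP/tensor_catC.
Qed.
Fact tensor_add0 : left_id tensor_zero tensor_add.
Proof. by move=> x; rewrite -[x]reprK tensor_addE. Qed.
HB.instance Definition _ := GRing.isNmodule.Build tensor tensor_addA tensor_addC tensor_add0.

Definition pure (m : M) (n : N) : tensor := \pi_tensor [:: (m, n)].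

Lemma sum_pure s : \sum_(p <- s) pure p.1 p.2 = \pi_tensor s.
Proof.
elim: s => [|[m n] s IHs]; first by rewrite big_nil.
by rewrite big_cons IHs; exact: tensor_addE.
Qed.

Lemma tensor_eq_sum s t :
  \sum_(p <- s) pure p.1 p.2 = \sum_(p <- t) pure p.1 p.2 -> tensor_eq s t.
Proof. by rewrite !sum_pure => /eqP/tensor_piP. Qed.

Lemma pureDl m m' n : pure (m + m') n = pure m n + pure m' n.
Proof.
rewrite -[RHS]/(tensor_add _ _) tensor_addE; apply/eqP/tensor_piP; exact: tensor_Dl.
Qed.
Lemma pureDr m n n' : pure m (n + n') = pure m n + pure m n'.
Proof.
rewrite -[RHS]/(tensor_add _ _) tensor_addE; apply/eqP/tensor_piP; exact: tensor_Dr.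
Qed.
Lemma pureZ a m n : pure (a *: m) n = pure m (a *: n).
Proof. apply/eqP/tensor_piP; exact: tensor_Z. Qed.
Lemma pure0l n : pure 0 n = 0.
Proof. apply/eqP/tensor_piP; exact: tensor_0l. Qed.
Lemma pure0r m : pure m 0 = 0.
Proof. by rewrite -(scale0r (0 : N)) -pureZ scale0r pure0l. Qed.
End Tensor.

Record balanced (R : comNzRingType) (M N : lmodType R) (T : nmodType)
    (b : M -> N -> T) : Prop := Balanced {
  balDl : forall m m' n, b (m + m') n = b m n + b m' n;
  balDr : forall m n n', b m (n + n') = b m n + b m n';
  bal0l : forall n, b 0 n = 0;
  bal0r : forall m, b m 0 = 0;
  balZ : forall a m n, b (a *: m) n = b m (a *: n) }.

Section Balanced.
Variables (R : comNzRingType) (A : algType R) (T : nmodType) (b : A -> A -> T).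
Hypothesis bB : balanced b.

Lemma bal_suml (I : Type) (r : seq I) (E : I -> A) n :
  b (\sum_(k <- r) E k) n = \sum_(k <- r) b (E k) n.
Proof.
by elim: r => [|k r IHr]; rewrite ?big_nil ?(bal0l bB) // !big_cons (balDl bB) IHr.
Qed.
Lemma bal_sumr (I : Type) (r : seq I) (E : I -> A) m :
  b m (\sum_(k <- r) E k) = \sum_(k <- r) b m (E k).
Proof.
by elim: r => [|k r IHr]; rewrite ?big_nil ?(bal0r bB) // !big_cons (balDr bB) IHr.
Qed.
Lemma bal_mul p q : balanced (fun m n => b (p * m) (n * q)).
Proof.
split=> [m m' n|m n n'|n|m|a m n].
- by rewrite mulrDr (balDl bB).
- by rewrite mulrDl (balDr bB).
- by rewrite mulr0 (bal0l bB).
- by rewrite mul0r (bal0r bB).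
- by rewrite -scalerAr (balZ bB) scalerAl.
Qed.
End Balanced.

Lemma pure_balanced (R : comNzRingType) (M N : lmodType R) : balanced (@pure R M N).
Proof.
split; [exact: pureDl | exact: pureDr | exact: pure0l | exact: pure0r | exact: pureZ].
Qed.

Section Azumaya.
Variables (F : fieldType) (V : subringClosed F) (K : splittingFieldType F).
Hypothesis hV : valuation_ring V.
Hypothesis hK : galois 1 {:K}.
Local Notation G := (gal_of {:K}).
Local Notation S := (integral_closure V K).
Local Notation St := (subring_type S).
Local Notation Vt := (subring_type V).
Local Notation gal := (@gal_closure F V K).
Local Notation base := (@base_to_closure F V K).
Local Notation tr := (trace hV hK).
Variable l : seq (St * St).
Hypothesis hl : forall g, \sum_(p <- l) p.1 * gal g p.2 = (g == 1%g)%:R.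
Variable f : normalized_cocycle K.
Hypothesis hf : integral_values V f.
Local Notation A := (crossed_order hf).
Local Notation fS := (cocycleS hf).
Local Notation basis := (order_basis hf).
Local Notation scal := (order_scalar hf).
Local Notation coefA := (@order_coef F V K f hf).
Let fC := cocycleS_integral hf.
Let cs := order_system hf.

Lemma order_scaleE (v : Vt) (a : A) : v *: a = scal (base v) * a.
Proof.
apply: order_coef_inj => g; rewrite order_coef_scalar; apply: val_inj.
by rewrite valSM /= ffunE mulr_algl.
Qed.

Lemma order_coefZ (v : Vt) (a : A) g : coefA (v *: a) g = base v * coefA a g.
Proof. by rewrite order_scaleE order_coef_scalar. Qed.

Local Notation Lp := [seq (g, p) | g <- index_enum G, p <- l].

Definition order_gen (k : G * (St * St)) : A := basis k.2.1 k.1.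
Definition order_coord (k : G * (St * St)) (a : A) : Vt := tr (k.2.2 * coefA a k.1).

Lemma order_coordD k a b : order_coord k (a + b) = order_coord k a + order_coord k b.
Proof. by rewrite /order_coord order_coefD mulrDr traceD. Qed.

Lemma order_coordZ k v a : order_coord k (v *: a) = v * order_coord k a.
Proof. by rewrite /order_coord order_coefZ mulrCA traceZ. Qed.

Lemma order_coord_sum a : a = \sum_(k <- Lp) order_coord k a *: order_gen k.
Proof.
rewrite {1}(order_decomp a) big_allpairs; apply: eq_bigr => g _.
rewrite {1}(trace_dual hV hK hl (coefA a g)).
have -> : basis (\sum_(p <- l) p.1 * base (tr (p.2 * coefA a g))) g
    = \sum_(p <- l) basis (p.1 * base (tr (p.2 * coefA a g))) g.
  apply: (big_morph (fun c => basis c g)) => [c d|]; first exact: order_basisD.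
  exact: order_basis0.
by apply: eq_bigr => p _; rewrite order_scaleE order_scalarM mulrC.
Qed.

Lemma order_fg : finitely_generated A.
Proof.
suff [s sA] : exists s : seq A, forall a, spans s a.
  by exists s => a; have [v ->] := sA a; exists (fun j => v j).
exists [seq order_gen k | k <- Lp] => a; rewrite (order_coord_sum a) big_seq.
by apply: spans_sum => k kL; apply: spansZ; apply: spans_mem; apply: map_f.
Qed.

Lemma order_projective : projective A.
Proof.
move=> M N g h g_surj.
pose z k := sval (cid (g_surj (h (order_gen k)))).
have gz k : g (z k) = h (order_gen k) by exact: svalP (cid (g_surj _)).
pose q a := \sum_(k <- Lp) order_coord k a *: z k.
have qD a b : q (a + b) = q a + q b.
  by rewrite -big_split; apply: eq_bigr => k _; rewrite order_coordD scalerDl.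
have qZ v a : q (v *: a) = v *: q a.
  by rewrite scaler_sumr; apply: eq_bigr => k _; rewrite order_coordZ scalerA.
exists (linear_map qD qZ) => a; rewrite {2}(order_coord_sum a) !linear_sum.
by apply: eq_bigr => k _; rewrite !linearZ /= gz.
Qed.

Lemma order_faithful : Defs.faithful A.
Proof.
move=> v /(_ 1); rewrite order_scaleE mulr1 => /(congr1 (fun a => coefA a 1%g)).
rewrite order_coef_basis order_coef0 eqxx => /eqP.
by rewrite base_eq0 => /eqP.
Qed.

Section Units.
Local Notation x := (basis 1).
Variable y : G -> A.
Hypothesis order_yx : forall g, y g * x g = 1.
Hypothesis order_xy : forall g, x g * y g = 1.

Lemma order_xs g s : x g * scal s = scal (gal g s) * x g.
Proof. exact: (cs_scal cs). Qed.
Lemma order_xx g h : x g * x h = scal (fS g h) * x (gcomp g h).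
Proof. exact: (cs_mul cs). Qed.
Lemma order_ys g s : y g * scal s = scal (gal g^-1%g s) * y g.
Proof.
rewrite -[LHS]mulr1 -(order_xy g) -[y g * _ * _]mulrA [scal s * _]mulrA.
by rewrite -{1}(gal_closureKV g s) -order_xs !mulrA order_yx mul1r.
Qed.
Lemma order_sx g s : scal s * x g = x g * scal (gal g^-1%g s).
Proof. by rewrite order_xs gal_closureKV. Qed.
Lemma order_scalM s t : scal s * scal t = scal (s * t).
Proof. by rewrite rmorphM. Qed.

Lemma order_yx_comp t r :
  y (gcomp t r) * x t = scal (gal (gcomp t r)^-1%g (fS t r)) * y r.
Proof.
rewrite -[LHS]mulr1 -(order_xy r) mulrA -[_ * x t * x r]mulrA order_xx.
by rewrite [_ * (scal _ * _)]mulrA order_ys -[_ * y _ * x _]mulrA order_yx mulr1.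
Qed.

(** For fixed k, the sum over c of left leg (x) right leg is an element of the enveloping algebra
    acting as the functional [order_coord k], with values in the copy of V in A. *)
Definition left_leg (k c : G * (St * St)) : A := x c.1 * scal (k.2.2 * c.2.1).
Definition right_leg (k c : G * (St * St)) : A :=
  scal (gal k.1^-1%g c.2.2) * (y k.1 * y c.1).

(** Let t be the group component of k. From the inside outwards: sum a_p a t^-1(b_p) extracts the
    x_t-term of a, y_t removes x_t, and conjugation by x_g, summed over g, forms the trace. *)
Lemma legs_action k a :
  \sum_(c <- Lp) left_leg k c * a * right_leg k c = scal (base (order_coord k a)).
Proof.
rewrite big_allpairs /order_coord traceE rmorph_sum; apply: eq_bigr => g _.
rewrite /left_leg /right_leg /=.
have -> : \sum_(p <- l) x g * scal (k.2.2 * p.1) * a * (scal (gal k.1^-1%g p.2) * (y k.1 * y g))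
    = x g * scal k.2.2 * (\sum_(p <- l) scal p.1 * a * scal (gal k.1^-1%g p.2)) * (y k.1 * y g).
  rewrite mulr_sumr mulr_suml; apply: eq_bigr => p _.
  by rewrite rmorphM !mulrA.
have -> : \sum_(p <- l) scal p.1 * a * scal (gal k.1^-1%g p.2) = basis (coefA a k.1) k.1.
  apply: order_coef_inj => h; rewrite order_coef_sum order_coef_basis.
  transitivity (coefA a h * \sum_(p <- l) p.1 * gal (gcomp h k.1^-1%g) p.2).
    rewrite mulr_sumr; apply: eq_bigr => p _.
    by rewrite order_coef_scalar_r order_coef_scalar -gal_closureM mulrCA mulrA.
  rewrite hl; have -> : (gcomp h k.1^-1%g == 1%g) = (h == k.1).
    by rewrite /gcomp -eq_mulVg1 eq_sym.
  by case: eqP => [->|_]; rewrite ?mulr1 ?mulr0.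
have -> : basis (coefA a k.1) k.1 = scal (coefA a k.1) * x k.1.
  by rewrite order_scalarM mulr1.
rewrite -!mulrA [x k.1 * _]mulrA order_xy mul1r.
by rewrite [scal _ * (scal _ * _)]mulrA order_scalM mulrA order_xs -mulrA order_xy mulr1.
Qed.

Lemma order_enveloping_surjective (phi : {linear A -> A}) :
  exists s : seq (A * A), enveloping_action s =1 phi.
Proof.
exists [seq (phi (order_gen k) * left_leg k c, right_leg k c) | k <- Lp, c <- Lp].
move=> a; rewrite /enveloping_action big_allpairs_dep /= {2}(order_coord_sum a) linear_sum.
apply: eq_bigr => k _; rewrite linearZ /= order_scaleE.
transitivity (phi (order_gen k) * scal (base (order_coord k a))).
  rewrite -(legs_action k a) mulr_sumr; apply: eq_bigr => c _.
  by rewrite !mulrA.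
by rewrite -order_scaleE -[_ * scal _](mulr1) -mulrA -order_scaleE -scalerAr mulr1.
Qed.

Section Casimir.
Variable T : nmodType.

(** The commutation property of a separability element, tested on balanced maps so that it also
    applies to [pure] composed with multiplications on both factors. *)
Definition commutes_with_legs (q : A) := forall (b : A -> A -> T) k, balanced b ->
  \sum_(c <- Lp) b (q * left_leg k c) (right_leg k c)
  = \sum_(c <- Lp) b (left_leg k c) (right_leg k c * q).

Lemma casimir_legs (b : A -> A -> T) (p q z w : A) s t : balanced b ->
  \sum_(r <- l) b (p * scal (s * r.1 * t) * z) (q * scal r.2 * w)
  = \sum_(r <- l) b (p * scal (s * r.1) * z) (q * scal (r.2 * t) * w).
Proof.
move=> bB.
pose b' (m n : St) := b (p * scal (s * m) * z) (q * scal n * w).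
rewrite (eq_bigr (fun r => b' (t * r.1) r.2)) => [|r _]; last first.
  by rewrite /b' mulrA mulrAC.
rewrite (casimir hV hK hl) // {}/b' => [m m' n|m n n'|n|m|v m n].
- by rewrite mulrDr rmorphD mulrDr mulrDl (balDl bB).
- by rewrite rmorphD mulrDr mulrDl (balDr bB).
- by rewrite mulr0 rmorph0 mulr0 mul0r (bal0l bB).
- by rewrite rmorph0 mulr0 mul0r (bal0r bB).
- have E1 : p * scal (s * (m * base v)) * z = v *: (p * scal (s * m) * z).
    by rewrite mulrA mulrC rmorphM -order_scaleE -scalerAr -scalerAl.
  have E2 : q * scal (base v * n) * w = v *: (q * scal n * w).
    by rewrite rmorphM -order_scaleE -scalerAr -scalerAl.
  by rewrite E1 E2 (balZ bB).
Qed.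

Lemma legs_scal s : commutes_with_legs (scal s).
Proof.
move=> b k bB; rewrite !big_allpairs; apply: eq_bigr => g _.
rewrite /left_leg /right_leg /=.
transitivity (\sum_(r <- l) b (x g * scal (k.2.2 * r.1) * 1)
   (y k.1 * scal (r.2 * gal g^-1%g s) * y g)).
  rewrite -casimir_legs //; apply: eq_bigr => r _; congr (b _ _).
    by rewrite mulr1 mulrA order_sx -mulrA order_scalM [gal _ _ * _]mulrC.
  by rewrite mulrA order_ys.
apply: eq_bigr => r _; rewrite mulr1; congr (b _ _).
by rewrite rmorphM /= mulrA order_ys -!mulrA order_ys.
Qed.

(** Multiplication by x_t shifts the sum over G by t; the cocycle value created on the left factor
    crosses the Casimir element and matches the one from y_(t g) x_t on the right. *)
Lemma legs_x t : commutes_with_legs (x t).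
Proof.
move=> b k bB; rewrite !big_allpairs.
rewrite [RHS](reindex_inj (mulIg t)) /=; apply: eq_bigr => g _.
rewrite -/(gcomp t g) /left_leg /right_leg /=.
transitivity (\sum_(r <- l) b (x (gcomp t g) * scal (k.2.2 * r.1) * 1)
   (y k.1 * scal (r.2 * gal (gcomp t g)^-1%g (fS t g)) * y g)).
  rewrite -casimir_legs //; apply: eq_bigr => r _; congr (b _ _).
    by rewrite mulr1 mulrA order_xx order_sx -mulrA order_scalM [gal _ _ * _]mulrC.
  by rewrite mulrA order_ys.
apply: eq_bigr => r _; rewrite mulr1; congr (b _ _).
by rewrite rmorphM /= mulrA order_ys -!mulrA order_yx_comp.
Qed.

Lemma legs_commute q : commutes_with_legs q.
Proof.
have legsM p q' : commutes_with_legs p -> commutes_with_legs q' ->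
    commutes_with_legs (p * q').
  move=> Cp Cq b k bB.
  transitivity (\sum_(c <- Lp) b (p * (q' * left_leg k c)) (right_leg k c * 1)).
    by apply: eq_bigr => c _; rewrite mulrA mulr1.
  rewrite (Cq (fun m n => b (p * m) (n * 1))); last exact: bal_mul.
  transitivity (\sum_(c <- Lp) b (1 * (p * left_leg k c)) (right_leg k c * q')).
    by apply: eq_bigr => c _; rewrite mul1r mulr1.
  rewrite (Cp (fun m n => b (1 * m) (n * q'))); last exact: bal_mul.
  by apply: eq_bigr => c _; rewrite mul1r mulrA.
rewrite (order_decomp q); elim/big_rec: _ => [|g q' _ Cq] b k bB.
  by apply: eq_bigr => c _; rewrite mul0r mulr0 (bal0l bB) (bal0r bB).
under eq_bigr do rewrite mulrDl (balDl bB).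
under [RHS]eq_bigr do rewrite mulrDr (balDr bB).
rewrite !big_split /= (Cq b k bB); congr (_ + _).
rewrite -[basis _ _](_ : scal (coefA q g) * x g = _); last by rewrite order_scalarM mulr1.
by apply: legsM => //; [exact: legs_scal | exact: legs_x].
Qed.

(** The identity map is the sum over k of [order_coord k] times [order_gen k]; this computes the
    corresponding tensor as 1 (x) 1. *)
Lemma legs_one (b : A -> A -> T) : balanced b ->
  \sum_(k <- Lp) \sum_(c <- Lp) b (order_gen k * left_leg k c) (right_leg k c) = b 1 1.
Proof.
move=> bB; rewrite big_allpairs.
transitivity (\sum_t \sum_g \sum_(r <- l)
   b (scal (\sum_(p <- l) p.1 * gal (gcomp t g) p.2) * (x t * x g * scal r.1))
     (scal (gal t^-1%g r.2) * (y t * y g))).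
  apply: eq_bigr => t _.
  under eq_bigr do rewrite big_allpairs.
  rewrite exchange_big /=; apply: eq_bigr => g _.
  rewrite exchange_big /=; apply: eq_bigr => r _.
  rewrite rmorph_sum mulr_suml (bal_suml bB); apply: eq_bigr => p _.
  congr (b _ _); rewrite /order_gen /left_leg /=.
  have -> : basis p.1 t = scal p.1 * x t by rewrite order_scalarM mulr1.
  rewrite !rmorphM /= -!mulrA; congr (_ * _).
  by rewrite [x g * _]mulrA order_xs -!mulrA [x t * _]mulrA order_xs gal_closureM -!mulrA.
(* By [hl] only g = t^-1 survives. There x_t x_(t^-1) = f(t, t^-1) crosses the Casimir element and
   cancels against y_t and y_(t^-1). *)
transitivity (\sum_t \sum_(r <- l) b (scal r.1) (scal (gal t^-1%g r.2))).
  apply: eq_bigr => t _; rewrite (bigD1 t^-1%g) //= [X in _ + X]big1 => [|g ng]; last first.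
    rewrite big1 // => r _; rewrite hl (_ : (_ == _) = false).
      by rewrite rmorph0 mul0r (bal0l bB).
    apply: contraNF ng => /eqP tg; rewrite -[t^-1%g]gcompg1 -tg gcompK; exact: eqxx.
  rewrite addr0 hl gcompgV eqxx.
  set d := fS t t^-1%g.
  transitivity (\sum_(r <- l) b (1 * scal (1 * r.1 * d) * 1) (y t * scal r.2 * y t^-1%g)).
    apply: eq_bigr => r _; rewrite order_xx gcompgV (cs1 cs) rmorph1 !mul1r !mulr1.
    by rewrite order_scalM mulrC mulrA order_ys.
  rewrite casimir_legs //; apply: eq_bigr => r _.
  rewrite !mul1r mulr1 -order_scalM.
  have -> : scal d = x t * x t^-1%g by rewrite order_xx gcompgV (cs1 cs) mulr1.
  rewrite [y t * _]mulrA order_ys -!mulrA order_xy mulr1 order_yx mulr1.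
  by [].
rewrite exchange_big /=.
(* The sum over t is the trace of r.2, an element of V that crosses to the left factor and produces
   the dual expansion of 1. *)
transitivity (\sum_(r <- l) b (scal (r.1 * base (tr (r.2 * 1)))) 1).
  apply: eq_bigr => r _; rewrite -(bal_sumr bB).
  rewrite mulrC -order_scalM -order_scaleE (balZ bB); congr (b _ _).
  rewrite order_scaleE mulr1 mulr1 traceE rmorph_sum [RHS](reindex_inj invg_inj).
  by [].
by rewrite -(bal_suml bB) -rmorph_sum -(trace_dual hV hK hl 1) rmorph1.
Qed.

End Casimir.

(** By [legs_one], p (x) q is the sum of p gen_k left (x) right q, and [legs_commute] moves q to the
    left factor. A tensor is thus recovered from its action on the generators, whence injectivity of
    the canonical map. *)
Lemma enveloping_tensor (s : seq (A * A)) :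
  \sum_(p <- s) pure p.1 p.2
  = \sum_(k <- Lp) \sum_(c <- Lp)
      pure (enveloping_action s (order_gen k) * left_leg k c) (right_leg k c).
Proof.
have pB := pure_balanced A A.
elim: s => [|[p q] s IHs].
  rewrite big_nil big1 // => k _; rewrite big1 // => c _.
  by rewrite /enveloping_action big_nil mul0r pure0l.
rewrite big_cons IHs /enveloping_action.
under [RHS]eq_bigr do under eq_bigr do rewrite big_cons mulrDl pureDl.
under [RHS]eq_bigr do rewrite big_split.
rewrite big_split /=; congr (_ + _).
transitivity (\sum_(k <- Lp) \sum_(c <- Lp)
   pure (p * (order_gen k * left_leg k c)) (right_leg k c * q)).
  have := legs_one (bal_mul pB p q); rewrite mulr1 mul1r => <-.
  by [].
apply: eq_bigr => k _; symmetry.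
transitivity (\sum_(c <- Lp) pure (p * order_gen k * (q * left_leg k c)) (right_leg k c * 1)).
  by apply: eq_bigr => c _; rewrite mulr1 !mulrA.
have := @legs_commute _ q _ k (bal_mul pB (p * order_gen k) 1) => /= ->.
by apply: eq_bigr => c _; rewrite mulr1 !mulrA.
Qed.

Lemma order_azumaya_of_inverses : azumaya A.
Proof.
split; [exact: order_fg | exact: order_projective | exact: order_faithful | |].
  move=> s t st; apply: tensor_eq_sum; rewrite !enveloping_tensor.
  by apply: eq_bigr => k _; apply: eq_bigr => c _; rewrite st.
exact: order_enveloping_surjective.
Qed.
End Units.

Lemma order_azumaya : (forall g, exists u, u * fS g g^-1%g = 1) -> azumaya A.
Proof.
move=> fU; pose u g := sval (cid (fU g^-1%g)).
have uE g : u g * fS g^-1%g g = base 1.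
  by rewrite /u; case: (cid _) => /= w; rewrite invgK rmorph1.
apply: (@order_azumaya_of_inverses (xinv scal (basis 1) u)) => g.
  by rewrite (xinvK cs uE) !rmorph1.
by rewrite (xinvVK fC cs uE) !rmorph1.
Qed.

Variable M0 : St -> bool.
Hypothesis mM0 : is_max M0.

(* When f(t, t^-1) is not a unit, this is a proper two-sided ideal that is not
   contained in J(V)A. *)
Definition degenerate_ideal (a : A) :=
  forall g h, M0 (gal h (coefA a g * fS g g^-1%g)).

Lemma degenerate0 : degenerate_ideal 0.
Proof. by move=> g h; rewrite order_coef0 mul0r rmorph0 (max0 mM0). Qed.

Lemma degenerateD a b :
  degenerate_ideal a -> degenerate_ideal b -> degenerate_ideal (a + b).
Proof.
move=> Ja Jb g h; rewrite order_coefD mulrDl rmorphD.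
exact: (maxD mM0 (Ja g h) (Jb g h)).
Qed.

(** By the cocycle identity f(t, g) f(t g, (t g)^-1) is a multiple of t(f(g, g^-1)); the quantifier
    over h in the definition absorbs the twist by t. *)
Lemma degenerateMl b a : degenerate_ideal a -> degenerate_ideal (b * a).
Proof.
move=> Ja; rewrite (order_decomp b) mulr_suml.
elim/big_rec: _ => [|t c _ Jc]; first exact: degenerate0.
apply: degenerateD => // k h; rewrite -[k](gcompKV t); set g := gcomp t^-1%g k.
rewrite order_coefMl.
pose q := gcomp g^-1%g t^-1%g.
have qE : (gcomp t g)^-1%g = q by rewrite /q /gcomp invMg.
have E1 := icocycleP fC t g q; have E2 := icocycleP fC g q t.
have gq : gcomp g q = t^-1%g by rewrite /q gcompKV.
have qt : gcomp q t = g^-1%g by rewrite /q gcompVK.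
rewrite gq in E1 E2; rewrite qt in E2.
have -> : coefA b t * gal t (coefA a g) * fS t g * fS (gcomp t g) (gcomp t g)^-1%g
    = coefA b t * gal t (gal g (fS q t)) * gal t (coefA a g * fS g g^-1%g).
  rewrite qE -mulrA E1 -[fS t t^-1%g](gal_closureKV t) -(cocycle_invV fC).
  rewrite -!mulrA; congr (_ * _); rewrite mulrCA -!rmorphM; congr (gal _ _).
  by rewrite mulrCA E2 mulrCA.
rewrite rmorphM; apply: (maxMl mM0); rewrite /= -gal_closureM; exact: Ja.
Qed.

Lemma degenerateMr a b : degenerate_ideal a -> degenerate_ideal (a * b).
Proof.
move=> Ja; rewrite (order_decomp b) mulr_sumr.
elim/big_rec: _ => [|t c _ Jc]; first exact: degenerate0.
apply: degenerateD => // k h; rewrite -[k](gcompVK _ t); set g := gcomp k t^-1%g.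
rewrite order_coefMr.
pose q := gcomp t^-1%g g^-1%g.
have qE : (gcomp g t)^-1%g = q by rewrite /q /gcomp invMg.
have E1 := icocycleP fC g t q.
have tq : gcomp t q = g^-1%g by rewrite /q gcompKV.
rewrite tq in E1; rewrite qE -mulrA E1.
have -> : coefA a g * gal g (coefA b t) * (gal g (fS t q) * fS g g^-1%g)
   = gal g (coefA b t) * gal g (fS t q) * (coefA a g * fS g g^-1%g) by ring.
rewrite rmorphM; apply: (maxMl mM0); exact: Ja.
Qed.

(** If f(t, t^-1) lay in a conjugate of M0, some e outside it would put e x_t in the degenerate
    ideal. The V-linear [phi] sends e x_t to 1 and is a sum of two-sided multiplications, so that
    ideal would contain 1, against f(1, 1) = 1. *)
Lemma azumaya_units : azumaya A -> forall g, exists u, u * fS g g^-1%g = 1.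
Proof.
case=> _ _ _ _ surj t.
have [||g|u uE] := @ideal_unit F V K hV hK M0 mM0 (fun s => exists u, u * fS t t^-1%g = s).
- by move=> r s [u uE] [w wE]; exists (u + w); rewrite mulrDl uE wE.
- by move=> r s [u uE]; exists (r * u); rewrite -mulrA uE.
- exists (fS t t^-1%g); first by exists 1; rewrite mul1r.
  apply/negP => Mf; have [e Me Mef] := to_jacobson mM0 Mf.
  have [p Up] : exists p, tr (p * e) \is a GRing.unit.
    apply: contrapT => nU; case/negP: Me.
    rewrite (trace_dual hV hK hl e) rmorph_sum; apply: max_sum => // p _.
    rewrite rmorphM; apply: (maxMl mM0); rewrite /= gal_closure_base (base_max hV hK mM0).
    by apply/negP => U; apply: nU; exists p.2.
  pose phi (b : A) : A := ((tr (p * e))^-1 * tr (p * coefA b t)) *: 1.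
  have phiD b b' : phi (b + b') = phi b + phi b'.
    by rewrite /phi order_coefD mulrDr traceD mulrDr scalerDl.
  have phiZ v b : phi (v *: b) = v *: phi b.
    by rewrite /phi order_coefZ mulrCA traceZ mulrCA scalerA.
  have [s sE] := surj (linear_map phiD phiZ).
  have : degenerate_ideal 1.
    have <- : phi (basis e t) = 1.
      by rewrite /phi order_coef_basis eqxx mulVr // scale1r.
    rewrite -[phi _]/(linear_map phiD phiZ (basis e t)) -sE /enveloping_action.
    elim/big_rec: _ => [|q c _ Jc]; first exact: degenerate0.
    apply: degenerateD => //; apply: degenerateMr; apply: degenerateMl => k h.
    rewrite order_coef_basis; case: eqP => [->|_]; last by rewrite mul0r rmorph0 (max0 mM0).
    exact: Mef.
  move/(_ 1%g 1%g); rewrite -[1]order_basis1 order_coef_basis eqxx (icocycle1l fC).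
  by rewrite mulr1 rmorph1 (negPf (max1 mM0)).
by exists u.
Qed.

End Azumaya.

(** * The theorem *)

Section Jacobson.
Variables (F : fieldType) (V : subringClosed F).
Hypothesis hV : valuation_ring V.
Local Notation Vt := (subring_type V).

Lemma nonunit_is_max : is_max (@nonunit F V).
Proof.
split=> [|x y|r x||x].
- exact: nonunit0.
- exact: nonunitD.
- exact: nonunitMl.
- by rewrite /nonunit unitr1.
- by rewrite negbK => Ux; exists x^-1; rewrite mulVr // subrr; exact: nonunit0.
Qed.

Lemma in_jacobsonE (v : Vt) : in_jacobson v <-> nonunit v.
Proof.
split=> [Jv|nv N /maximal_is_max mN].
  have [N [NE mN]] := is_max_maximal nonunit_is_max.
  by rewrite -NE; exact: Jv.
apply: contraT => /(max_inv mN)[r Nr].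
have U : 1 - r * v \is a GRing.unit by apply/nonunit1B/nonunitMl.
by move/(maxMl mN (1 - r * v)^-1): Nr; rewrite mulVr // (negPf (max1 mN)).
Qed.

Lemma generates_jacobson (pi : Vt) : generates_nonunits pi ->
  jacobson_principal (subring_type V).
Proof.
move=> [npi gpi]; exists pi => v; rewrite in_jacobsonE; split; first exact: gpi.
by move=> [r ->]; exact: nonunitMl.
Qed.
End Jacobson.

Lemma in_ideal_square_sub (S : comNzRingType) (M : submodClosed S^o) (x : S) :
  in_ideal_square M x -> x \in M.
Proof.
move=> [s [sM ->]]; rewrite big_seq; apply: rpred_sum => p /sM[_ p2].
exact: (@rpredZ S S^o M).
Qed.

Theorem theorem3p4 (F : fieldType) (V : subringClosed F)
  (hV : valuation_ring V)
  (K : splittingFieldType F) (hK : galois 1 {:K})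
  (hu : unramified_defectless V K)
  (f : normalized_cocycle K) (hf : integral_values V f) :
  let S := subring_type (integral_closure V K) in
  let A := crossed_order hf in
  ((semihereditary A <->
      (forall (t g : gal_of {:K}) (M : submodClosed S^o),
         maximal_left_ideal M -> ~ in_ideal_square M (cocycleS hf t g))) /\
   (semihereditary A <->
      (forall (t : gal_of {:K}) (M : submodClosed S^o),
         maximal_left_ideal M -> ~ in_ideal_square M (cocycleS hf t t^-1%g))))
  /\
  (~ jacobson_principal (subring_type V) ->
   (semihereditary A <-> azumaya A) /\
   (semihereditary A <-> cocycle_subgroup hf = 'Gal({:K} / 1)%g)).
Proof.
move=> S A.
have [M0 mM0] := @exists_max S.
have [l hl] := galois_coordinates hV hK mM0 hu.
have fC := cocycleS_integral hf.
pose d r := cocycleS hf r r^-1%g.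
pose diag := forall (t : gal_of {:K}) (M : submodClosed S^o),
  maximal_left_ideal M -> ~ in_ideal_square M (d t).
pose units := forall g, exists u, u * d g = 1.
have diag_sqf : diag -> forall r g a b s, ~~ M0 (gal_closure g s) ->
    M0 (gal_closure g a) -> M0 (gal_closure g b) -> s * d r <> a * b.
  move=> hd r g a b s Ms Ma Mb E.
  have mN := conj_max mM0 g; have [N [NE N_max]] := is_max_maximal mN.
  exact: (hd r N N_max (in_ideal_square_locally NE mN Ms Ma Mb E)).
have nz_d r : d r != 0 by exact: (icocycle_neq0 fC).
have diag_semi : diag -> semihereditary A.
  move=> /diag_sqf sqf; split.
    apply: (crossed_left_semihereditary hV hK hl mM0 nz_d sqf fC _ (order_system hf)) => //.
    exact: order_tf.
  apply: (crossed_left_semihereditary hV hK hl mM0 nz_d sqf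
    (opp_cocycle_integral hf) _ (opp_system hf)).
    exact: opp_cocycle_diag.
  exact: opp_tf.
have semi_diag : semihereditary A -> diag.
  by move=> [hA _] t M; exact: semihereditary_not_square.
(* The cocycle identity gives f(t, t^-1) = t(f(t^-1, t g)) f(t, g), so the diagonal value lies in
   M^2 as soon as f(t, g) does. *)
have diag_all : diag -> forall (t g : gal_of {:K}) (M : submodClosed S^o),
    maximal_left_ideal M -> ~ in_ideal_square M (cocycleS hf t g).
  move=> hd t g M mM /(in_ideal_square_Ml (gal_closure t (cocycleS hf t^-1%g (gcomp t g)))).
  have := icocycleP fC t t^-1%g (gcomp t g).
  rewrite gcompgV (icocycle1l fC) mulr1 gcompK => <-; exact: hd.
have units_diag : units -> diag.
  move=> hU t M /maximal_is_max mM /in_ideal_square_sub Mf.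
  have [u uE] := hU t; case/negP: (max1 mM); rewrite -uE.
  exact: (maxMl mM).
have units_azumaya : units <-> azumaya A.
  split=> [|hA]; first exact: (order_azumaya hV hK hl).
  exact: (azumaya_units hV hK hl mM0 hA).
have units_subgroup : units <-> cocycle_subgroup hf = 'Gal({:K} / 1)%g.
  split=> [hU|HE g].
    apply/setP => g; rewrite gal_all inE; apply/unitrPr.
    by have [u uE] := hU g; exists u; rewrite mulrC.
  have : g \in cocycle_subgroup hf by rewrite HE gal_all.
  by rewrite inE => /unitrPr[u uE]; exists u; rewrite mulrC.
split; first split.
- split=> [/semi_diag/diag_all//|hd]; apply: diag_semi => t M mM; exact: hd.
- by split.
move=> nJ; have semi_units : semihereditary A <-> units.
  split=> [/semi_diag/diag_sqf sqf g|/units_diag/diag_semi //].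
  apply: (square_free_unit hV hK hl mM0 nz_d sqf) => pi _ gpi.
  by apply: nJ; apply: generates_jacobson gpi.
by rewrite semi_units.
Qed.
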